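(* Let $s\in(0,\frac12)$, let $\Omega\subset\mathbb{R}^n$ be a bounded domain with smooth boundary, let $\epsilon_k\to 0^+$, and let $p\in[2,\infty)$. For $j=1,2$ let $W^{(j)}$ be an admissible potential with exponent $p$ (see context) which is in addition real-analytic on $\mathbb{R}$, and let $(g^{(j)}_k)_k,(f^{(j)}_k)_k,(u^{(j)}_k)_k,g^{(j)},f^{(j)},E^{(j)}_*$ be admissible asymptotic data for $W^{(j)}$ and $(\epsilon_k)$ (see context); in particular $u^{(j)}_k\in H^s_{g^{(j)}_k}(\Omega)\cap L^p(\Omega)$ is a weak solution of $$(-\Delta)^s u^{(j)}_k+\frac{1}{\epsilon_k^{2s}}(W^{(j)})'(u^{(j)}_k)=f^{(j)}_k\ \text{ in }\Omega,\qquad u^{(j)}_k=g^{(j)}_k\ \text{ in }\mathbb{R}^n\setminus\Omega .$$ Assume further, for $j=1,2$: - $E^{(j)}_*\cap\Omega\neq\Omega$ and $E^{(j)}_*\cap\Omega\neq\emptyset$; - for all $k$, $g^{(j)}_k$ is neither identically $1$ nor identically $-1$ in $\mathbb{R}^n\setminus\Omega$; - there is a compact set $K\subset\Omega$ (the same for $j=1,2$ and all $k$) such that $f^{(j)}_k\in C^1_c(\Omega)$ and $\mathrm{supp}\,f^{(j)}_k\subset K$ for all $k$; - $f^{(j)}_k\to f^{(j)}$ in $H^{-s}(\Omega)$ as $k\to\infty$. Let $V\subset\Omega$ be a nonempty open set with $V\cap K=\emptyset$. (i) If $u^{(1)}_k|_V=u^{(2)}_k|_V$ and $(-\Delta)^su^{(1)}_k|_V=(-\Delta)^su^{(2)}_k|_V$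 for all $k$, then $$W^{(1)}=W^{(2)},\quad f^{(1)}=f^{(2)},\quad \partial E^{(1)}_*\cap\Omega=\partial E^{(2)}_*\cap\Omega,\quad P_{2s}(E^{(1)}_*,\Omega')=P_{2s}(E^{(2)}_*,\Omega')$$ for each open $\Omega'$ compactly contained in $\Omega$. (ii) If $W^{(1)}=W^{(2)}$ and $(-\Delta)^su^{(1)}_k|_V=(-\Delta)^su^{(2)}_k|_V$ for all $k$, then $$f^{(1)}=f^{(2)},\quad \partial E^{(1)}_*\cap\Omega=\partial E^{(2)}_*\cap\Omega,\quad P_{2s}(E^{(1)}_*,\Omega')=P_{2s}(E^{(2)}_*,\Omega')$$ for each open $\Omega'$ compactly contained in $\Omega$.
   Context: Function spaces. $c_{n,s}>0$ is the normalizing constant of the fractional Laplacian, depending only on $n,s$ (for smooth bounded $u$, $(-\Delta)^su(x)=c_{n,s}\,\mathrm{p.v.}\int_{\mathbb{R}^n}\frac{u(x)-u(y)}{|x-y|^{n+2s}}dy$). For open $\Omega$, $$\mathcal{E}(u,\Omega):=\frac{c_{n,s}}{4}\Big(\int_\Omega\int_\Omega+2\int_\Omega\int_{\mathbb{R}^n\setminus\Omega}\Big)\frac{|u(x)-u(y)|^2}{|x-y|^{n+2s}}\,dx\,dy .$$ $\hat H^s(\Omega):=\{u\in L^2_{loc}(\mathbb{R}^n):\mathcal{E}(u,\Omega)<\infty\}$. $\tilde H^s(\Omega)$ is the closure of $C_c^\infty(\Omega)$ in $H^s(\mathbb{R}^n)$ and $H^{-s}(\Omega)$ is its dual. For $g\in\hat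 H^s(\Omega)$, $H^s_g(\Omega):=g+\tilde H^s(\Omega)$. For $u\in\hat H^s(\Omega)$, $(-\Delta)^su\in H^{-s}(\Omega)$ is defined by $$\langle(-\Delta)^su,\varphi\rangle:=\frac{c_{n,s}}{2}\Big(\int_\Omega\int_\Omega+2\int_\Omega\int_{\mathbb{R}^n\setminus\Omega}\Big)\frac{(u(x)-u(y))(\varphi(x)-\varphi(y))}{|x-y|^{n+2s}}\,dx\,dy,\quad \varphi\in\tilde H^s(\Omega);$$ its restriction to an open $V\subset\Omega$ is understood in the sense of distributions (testing with $\varphi\in C_c^\infty(V)$). Admissible potential with exponent $p$. $W\in C^2(\mathbb{R};[0,\infty))$ with $W>0$ in $(-1,1)$, $\{W=0\}=\{\pm1\}$, $W'(\pm1)=0$, $W''(\pm1)>0$, and there is $C>0$ with $\frac1C(|t|^{p-1}-1)\le|W'(t)|\le C(|t|^{p-1}+1)$ for all $t\in\mathbb{R}$. Weak solution. For $\epsilon>0$, source $f$ and exterior datum $g$, put $$\mathcal{F}_\epsilon(u,\Omega):=\mathcal{E}(u,\Omega)+\frac{1}{\epsilon^{2s}}\int_\Omega W(u)\,dx-\int_\Omega fu\,dx .$$ A function $u\in H^s_g(\Omega)\cap L^p(\Omega)$ is a weak solution of $(-\Delta)^su+\epsilon^{-2s}W'(u)=f$ in $\Omega$, $u=g$ in $\mathbb{R}^n\setminus\Omega$, if $\frac{d}{dt}\mathcal{F}_\epsilon(u+t\varphi,\Omega)|_{t=0}=0$ for all $\varphi\in\tilde H^s(\Omega)\cap L^p(\Omega)$.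 Fractional perimeter. For $E\subset\mathbb{R}^n$ (with $E^c=\mathbb{R}^n\setminus E$), $$P_{2s}(E,\Omega):=\Big(\int_{E\cap\Omega}\int_{E^c\cap\Omega}+\int_{E\cap\Omega}\int_{E^c\setminus\Omega}+\int_{E\setminus\Omega}\int_{E^c\cap\Omega}\Big)\frac{dx\,dy}{|x-y|^{n+2s}}=\frac{1}{2c_{n,s}}\mathcal{E}(\chi_E-\chi_{\mathbb{R}^n\setminus E},\Omega).$$ For $X\in C^1_c(\Omega;\mathbb{R}^n)$ with flow $\{\phi_t\}$, $\delta P_{2s}(E,\Omega)[X]:=\frac{d}{dt}P_{2s}(\phi_t(E),\Omega)|_{t=0}$. The equation $H^{(2s)}_{\partial E}=\frac{1}{c_{n,s}}f$ along $\partial E\cap\Omega$ means, in weak form, $$\delta P_{2s}(E,\Omega)[X]=\frac{1}{c_{n,s}}\int_{E\cap\Omega}\mathrm{div}(fX)\,dx\qquad\text{for all }X\in C^1_c(\Omega;\mathbb{R}^n).$$ Admissible asymptotic data. Given $W$ (admissible with exponent $p$) and $\epsilon_k\to0^+$, the tuple $(g_k),(f_k),(u_k),g,f,E_*$ is called admissible asymptotic data if: (A1) $g_k\in C^{0,1}_{loc}(\mathbb{R}^n)$, $\sup_k\|g_k\|_{L^\infty(\mathbb{R}^n\setminus\Omega)}<\infty$, $g_k\to g$ in $L^1_{loc}(\mathbb{R}^n\setminus\Omega)$, and $|g|=1$ a.e. in $\mathbb{R}^n\setminus\Omega$. (A2) $f_k\in C^{0,1}(\Omega)$ and, for some $q\in(\frac{n}{1+2s},n)$,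 $\sup_k\{\epsilon_k^{2s}\|f_k\|_{L^\infty(\Omega)}+\|f_k\|_{W^{1,q}(\Omega)}\}<\infty$ and $f_k\rightharpoonup f$ weakly in $W^{1,q}(\Omega)$. (A3) $u_k\in H^s_{g_k}(\Omega)\cap L^p(\Omega)$ is a weak solution of the equation with parameter $\epsilon_k$, potential $W$, source $f_k$ and exterior datum $g_k$, and $\sup_k\mathcal{F}_{\epsilon_k}(u_k,\Omega)<\infty$ (with $f=f_k$ in $\mathcal{F}_{\epsilon_k}$). (A4) $E_*\subset\mathbb{R}^n$ has $P_{2s}(E_*,\Omega)<\infty$, and with $u_*:=\chi_{E_*}-\chi_{\mathbb{R}^n\setminus E_*}$ the following hold for the sequence $(u_k)$ (a subsequence having already been extracted and relabelled): (a) $E_*\cap\Omega$ is open and $H^{(2s)}_{\partial E_*}=\frac{1}{c_{n,s}}f$ along $\partial E_*\cap\Omega$; (b) $u_k\to u_*$ in $C^0_{loc}(\Omega\setminus\partial E_* )$; (c) for each open $\Omega'$ compactly contained in $\Omega$, $\mathcal{E}(u_k,\Omega')\to2c_{n,s}P_{2s}(E_*,\Omega')$; (d) for each open $\Omega'$ compactly contained in $\Omega$, $f_k-\epsilon_k^{-2s}W'(u_k)\to\big(\frac{c_{n,s}}{2}\int_{\mathbb{R}^n}\frac{|u_*(x)-u_*(y)|^2}{|x-y|^{n+2s}}dy\big)u_*(x)$ in $H^{-s}(\Omega')$; (e) for each $\delta\in(-1,1)$, compact $K'\subset\Omega$ and $r>0$, for all sufficiently large $k$, $\{u_k=\delta\}\cap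 K'\subset\mathscr{T}_r(\partial E_*\cap\Omega)$ and $\partial E_*\cap K'\subset\mathscr{T}_r(\{u_k=\delta\}\cap\Omega)$, where $\mathscr{T}_r$ denotes the open tubular neighborhood of radius $r$. (Given (A1)–(A3), a known convergence theorem guarantees that a set $E_*$ as in (A4) exists after passing to a subsequence.) *)

(* Defs.v *)
From HB Require Import structures.
From mathcomp Require Import all_boot all_order all_algebra.
From mathcomp Require Import all_classical all_reals all_analysis.

Set Implicit Arguments.
Unset Strict Implicit.
Unset Printing Implicit Defensive.

Import Order.TTheory GRing.Theory Num.Theory numFieldNormedType.Exports.

Local Open Scope classical_set_scope.
Local Open Scope ring_scope.

(* Lebesgue measure on R^n, carried by 'rV[R]_n: the iterated product of
   [lebesgue_measure] on tuples is transported to row vectors, then completed,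
   so that "measurable" below means Lebesgue measurable. *)
Section lebesgue_tuple_step.
Context (R : realType) (n : nat).
Local Notation T n := (n.-tuple (measurableTypeR R)).
Context (m : {sigma_finite_measure set (T n) -> \bar R}).

Definition tuple_cons (p : measurableTypeR R * T n) : T n.+1 :=
  [the n.+1.-tuple (measurableTypeR R) of p.1 :: p.2].

Lemma measurable_tuple_cons : measurable_fun setT tuple_cons.
Proof. by apply: measurable_cons; [exact: measurable_fst|exact: measurable_snd]. Qed.

Definition lebesgue_cons : set (T n.+1) -> \bar R :=
  fun A => (lebesgue_measure \x m)%E (tuple_cons @^-1` A).

Let lebesgue_cons0 : lebesgue_cons set0 = 0%E.
Proof. by rewrite /lebesgue_cons preimage_set0 measure0. Qed.

Let lebesgue_cons_ge0 A : (0 <= lebesgue_cons A)%E.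
Proof. exact: measure_ge0. Qed.

Let lebesgue_cons_sigma_additive : semi_sigma_additive lebesgue_cons.
Proof.
have mc (B : set (T n.+1)) : measurable B -> measurable (tuple_cons @^-1` B).
  by move=> mB; rewrite -[X in measurable X]setTI; exact: measurable_tuple_cons.
move=> F mF tF mUF; rewrite /lebesgue_cons preimage_bigcup.
apply: (@measure_semi_sigma_additive _ _ _ (lebesgue_measure \x m)%E) => [i||]; first exact: (mc _ (mF i)).
- apply/trivIsetP => i j _ _ ij; rewrite -preimage_setI.
  by move/trivIsetP : tF => /(_ _ _ _ _ ij) ->//; rewrite preimage_set0.
- by rewrite -preimage_bigcup; exact: mc.

Qed.

HB.instance Definition _ := isMeasure.Build _ _ _ lebesgue_cons
  lebesgue_cons0 lebesgue_cons_ge0 lebesgue_cons_sigma_additive.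

Lemma lebesgue_cons_sigma_finite : sigma_finite setT lebesgue_cons.
Proof.
have /sigma_finiteP[F [FT ndF Foo]] := sigma_finiteT (@lebesgue_measure R).
have /sigma_finiteP[G [GT ndG Goo]] := sigma_finiteT m.
pose g (t : T n.+1) : measurableTypeR R * T n := (thead t, [tuple of behead t]).
have gK t : tuple_cons (g t) = t by rewrite [RHS]tuple_eta.
have Kg p : g (tuple_cons p) = p.
  by case: p => x t; rewrite /g; congr pair => //; exact/val_inj.
have mg : measurable_fun setT g.
  apply/measurable_fun_prod; [exact: measurable_tnth | exact: measurable_behead].
exists (fun i => g @^-1` (F i `*` G i)).
  rewrite -preimage_bigcup (_ : \bigcup_i _ = setT) ?preimage_setT//.
  apply/seteqP; split=> // -[x t] _.
  have [i _ Fx] : (\bigcup_i F i) x by rewrite -FT.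
  have [j _ Gt] : (\bigcup_i G i) t by rewrite -GT.
  exists (maxn i j) => //; split=> /=.
  - by move: x Fx; exact/subsetPset/ndF/leq_maxl.
  - by move: t Gt; exact/subsetPset/ndG/leq_maxr.
move=> i; have [mF Fi] := Foo i; have [mG Gi] := Goo i.
split.
  by rewrite -[X in measurable X]setTI; apply: mg => //; exact: measurableX.
rewrite /lebesgue_cons -comp_preimage (_ : g \o tuple_cons = id); last exact/funext.
by rewrite /= product_measure1E// lte_mul_pinfty// ge0_fin_numE.
Qed.

HB.instance Definition _ := Measure_isSigmaFinite.Build _ _ _ lebesgue_cons
  lebesgue_cons_sigma_finite.

End lebesgue_tuple_step.

Fixpoint lebesgue_tuple (R : realType) n :
    {sigma_finite_measure set (n.-tuple (measurableTypeR R)) -> \bar R} :=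
  if n is n'.+1 then lebesgue_cons (lebesgue_tuple R n') else \d_[tuple].


Section lebesgue_rV.
Context (R : realType) (n : nat).
Local Notation T := (n.-tuple (measurableTypeR R)).

Definition row_of_tuple (t : T) : 'rV[R]_n := \row_i tnth t i.

(* The Borel sigma-algebra of R^n. *)
Definition borel_rV : set (set 'rV[R]_n) :=
  [set A | measurable (row_of_tuple @^-1` A)].

Let borel_rV0 : borel_rV set0.
Proof. by rewrite /borel_rV /= preimage_set0. Qed.

Let borel_rVC A : borel_rV A -> borel_rV (~` A).
Proof. by move=> mA; rewrite /borel_rV /= preimage_setC; exact: measurableC. Qed.

Let borel_rV_bigcup (F : (set 'rV[R]_n)^nat) :
  (forall i, borel_rV (F i)) -> borel_rV (\bigcup_i F i).
Proof.
by move=> mF; rewrite /borel_rV /= preimage_bigcup; exact: bigcupT_measurable.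
Qed.

HB.instance Definition _ := @isMeasurable.Build default_measure_display
  'rV[R]_n borel_rV borel_rV0 borel_rVC borel_rV_bigcup.

Lemma measurable_row_of_tuple : measurable_fun setT row_of_tuple.
Proof. by move=> _ A mA; rewrite setTI. Qed.

Definition lebesgue_borel : set 'rV[R]_n -> \bar R :=
  fun A => lebesgue_tuple R n (row_of_tuple @^-1` A).

Let lebesgue_borel0 : lebesgue_borel set0 = 0%E.
Proof. by rewrite /lebesgue_borel preimage_set0 measure0. Qed.

Let lebesgue_borel_ge0 A : (0 <= lebesgue_borel A)%E.
Proof. exact: measure_ge0. Qed.

Let lebesgue_borel_sigma_additive : semi_sigma_additive lebesgue_borel.
Proof.
move=> F mF tF mUF; rewrite /lebesgue_borel preimage_bigcup.
apply: measure_semi_sigma_additive => [//||].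
- apply/trivIsetP => i j _ _ ij; rewrite -preimage_setI.
  by move/trivIsetP : tF => /(_ _ _ _ _ ij) ->//; rewrite preimage_set0.
- by rewrite -preimage_bigcup.
Qed.

HB.instance Definition _ := isMeasure.Build _ _ _ lebesgue_borel
  lebesgue_borel0 lebesgue_borel_ge0 lebesgue_borel_sigma_additive.

Lemma lebesgue_borel_sigma_finite : sigma_finite setT lebesgue_borel.
Proof.
have [F FT Foo] := sigma_finiteT (lebesgue_tuple R n).
pose g (x : 'rV[R]_n) : T := [tuple x ord0 i | i < n].
have gK t : g (row_of_tuple t) = t.
  by apply: eq_from_tnth => i; rewrite tnth_mktuple mxE.
exists (fun i => g @^-1` F i).
  by rewrite -preimage_bigcup -FT preimage_setT.
move=> i.
have e : row_of_tuple @^-1` (g @^-1` F i) = F i.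
  by rewrite -comp_preimage (_ : g \o row_of_tuple = id)//; exact/funext.
by rewrite /lebesgue_borel e; split; [rewrite /measurable/= /borel_rV/= e|];
  case: (Foo i).
Qed.

HB.instance Definition _ := Measure_isSigmaFinite.Build _ _ _ lebesgue_borel
  lebesgue_borel_sigma_finite.

Definition lebesgue_rV := @completed_measure_extension _ _ _ lebesgue_borel.
HB.instance Definition _ := Measure.on lebesgue_rV.

Lemma lebesgue_rV_sigma_finite : sigma_finite setT lebesgue_rV.
Proof.
exact: completed_measure_extension_sigma_finite lebesgue_borel_sigma_finite.
Qed.

HB.instance Definition _ := Measure_isSigmaFinite.Build _ _ _ lebesgue_rV
  lebesgue_rV_sigma_finite.

End lebesgue_rV.

Section defs.
Context (R : realType) (n : nat).
Local Notation Rn := 'rV[R]_n.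
Local Notation mu := (@lebesgue_rV R n).
Local Notation LebesgueRn := (caratheodory_type (@lebesgue_borel R n)^*%mu).
Implicit Types (s p q eps : R) (A B E U V Omega : set Rn) (f g u phi : Rn -> R).

Definition Lmeasurable A : Prop := measurable (A : set LebesgueRn).

Definition Lmeasurable_fun A u : Prop :=
  measurable_fun (A : set LebesgueRn) (u : LebesgueRn -> R).

Definition Lp_norm A (p : \bar R) u : \bar R := 'N[mu]_p[EFin \o (u \_ A)].

Definition Lp A (p : \bar R) u : Prop :=
  Lmeasurable_fun A u /\ (Lp_norm A p u < +oo)%E.

Definition L1loc A u : Prop := Lmeasurable_fun A u /\
  forall K : set Rn, compact K -> K `<=` A ->
    (\int[mu]_(x in K) `|u x|%:E < +oo)%E.

Definition L2loc u : Prop := Lmeasurable_fun setT u /\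
  forall K : set Rn, compact K -> (\int[mu]_(x in K) (u x ^+ 2)%:E < +oo)%E.

(* The library norm on row vectors is the sup norm (same topology). *)
Definition enorm (x : Rn) : R := Num.sqrt (\sum_i x ord0 i ^+ 2).

Definition boundary A : set Rn := closure A `\` A°.

Definition compactly_contained V U : Prop :=
  [/\ open V, compact (closure V) & closure V `<=` U].

Definition tubular (r : R) A : set Rn :=
  [set x | exists2 a, A a & enorm (x - a) < r].

Definition partial (i : 'I_n) f (x : Rn) : R := 'D_(delta_mx ord0 i) f x.

Fixpoint Ck (k : nat) f : Prop :=
  if k is k'.+1 then
    [/\ continuous f, forall i x, derivable f x (delta_mx ord0 i) &
      forall i, Ck k' (partial i f)]
  else continuous f.

Definition supp f : set Rn := closure [set x | f x != 0].

(* C^k_c(U): functions on U are extended by zero to R^n. *)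
Definition Ckc (k : nat) U f : Prop :=
  [/\ Ck k f, compact (supp f) & supp f `<=` U].

Definition test U phi : Prop := forall k, Ckc k U phi.

Definition smooth_boundary Omega : Prop :=
  forall x0, boundary Omega x0 -> exists (U : set Rn) (rho : Rn -> R),
    [/\ open U /\ U x0, forall k, Ck k rho, exists i, partial i rho x0 != 0 &
      forall x, U x -> (Omega x <-> rho x < 0)].

Definition smooth_bounded_domain Omega : Prop :=
  [/\ open Omega /\ Omega !=set0, connected Omega, bounded_set Omega &
    smooth_boundary Omega].

Definition C01 A u : Prop := [lipschitz u x | x in A].

Definition C01loc u : Prop := forall K : set Rn, compact K -> C01 K u.

Definition double_integral A B (F : Rn -> Rn -> R) : \bar R :=
  (\int[mu]_(x in A) \int[mu]_(y in B) (F x y)%:E)%E.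

Definition kernel s (x y : Rn) : R := (enorm (x - y) `^ (n%:R + 2 * s))^-1.

Definition coord1 (x : Rn) : R := \sum_(i < n | val i == 0%N) x ord0 i.

(* c_{n,s}^-1 = \int_{R^n} (1 - cos z_1) / |z|^{n+2s} dz: the constant for which
   the singular integral operator has Fourier symbol |xi|^{2s}. *)
Definition cns s : R :=
  (fine (\int[mu]_z ((1 - cos (coord1 z)) * kernel s z 0)%:E))^-1.

Definition energy s u Omega : \bar R :=
  let F x y := ((u x - u y) ^+ 2 * kernel s x y)%R in
  ((cns s / 4)%:E * (double_integral Omega Omega F +
                     2%:E * double_integral Omega (~` Omega) F))%E.

Definition Hhat s Omega u : Prop := L2loc u /\ (energy s u Omega < +oo)%E.

Definition Hs_norm s u : \bar R :=
  ((\int[mu]_x (u x ^+ 2)%:E +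
    double_integral setT setT (fun x y => (u x - u y) ^+ 2 * kernel s x y)%R)
   `^ 2^-1)%E.

Definition Hs s u : Prop := Lmeasurable_fun setT u /\ (Hs_norm s u < +oo)%E.

Definition Htilde s Omega u : Prop := Hs s u /\
  forall e : R, 0 < e ->
    exists2 phi, test Omega phi & (Hs_norm s (u \- phi)%R < e%:E)%E.

Definition Hsg s Omega g u : Prop := Hhat s Omega g /\ Htilde s Omega (u \- g).

(* The duality pairing of (-Delta)^s u with phi. *)
Definition frac_lap s Omega u phi : R :=
  let F x y := (u x - u y) * (phi x - phi y) * kernel s x y in
  cns s / 2 * fine (double_integral Omega Omega F +
                    2%:E * double_integral Omega (~` Omega) F)%E.

Definition frac_lap_eq_on s Omega V u1 u2 : Prop :=
  forall phi, test V phi -> frac_lap s Omega u1 phi = frac_lap s Omega u2 phi.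

Definition pairing Omega f phi : R :=
  fine (\int[mu]_(x in Omega) (f x * phi x)%:E)%E.

(* Elements of the dual H^{-s}(Omega) of Htilde^s(Omega) are given by their values
   on test functions, which are dense in Htilde^s(Omega). *)
Definition in_Hminus s Omega (T : (Rn -> R) -> R) : Prop :=
  exists C : R, forall phi, test Omega phi ->
    (`|T phi|%:E <= C%:E * Hs_norm s phi)%E.

Definition cvg_Hminus s Omega (T_ : nat -> (Rn -> R) -> R)
    (T : (Rn -> R) -> R) : Prop :=
  [/\ forall k, in_Hminus s Omega (T_ k), in_Hminus s Omega T &
    forall e : R, 0 < e -> \forall k \near \oo, forall phi, test Omega phi ->
      (`|T_ k phi - T phi|%:E <= e%:E * Hs_norm s phi)%E].

Definition is_weak_partial Omega (i : 'I_n) f g : Prop :=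
  [/\ L1loc Omega f, L1loc Omega g & forall phi, test Omega phi ->
    (\int[mu]_(x in Omega) (f x * partial i phi x)%:E =
     - \int[mu]_(x in Omega) (g x * phi x)%:E)%E].

Definition weak_partial Omega (i : 'I_n) f : Rn -> R :=
  xget (fun=> 0) [set g | is_weak_partial Omega i f g].

Definition W1q Omega q f : Prop := Lp Omega q%:E f /\
  forall i, exists2 g, is_weak_partial Omega i f g & Lp Omega q%:E g.

Definition W1q_norm Omega q f : \bar R :=
  (Lp_norm Omega q%:E f +
   \sum_(i < n) Lp_norm Omega q%:E (weak_partial Omega i f))%E.

Definition W1q_dual Omega q (l : (Rn -> R) -> R) : Prop :=
  (forall (a : R) f g, W1q Omega q f -> W1q Omega q g ->
     l (fun x => a * f x + g x) = a * l f + l g) /\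
  exists C : R, forall f, W1q Omega q f ->
     (`|l f|%:E <= C%:E * W1q_norm Omega q f)%E.

Definition W1q_weak_cvg Omega q (f_ : nat -> Rn -> R) f : Prop :=
  [/\ forall k, W1q Omega q (f_ k), W1q Omega q f &
    forall l, W1q_dual Omega q l -> l (f_ k) @[k --> \oo] --> l f].

Definition admissible_potential p (W : R -> R) : Prop :=
  [/\ [/\ forall t, derivable W t 1, forall t, derivable (derive1 W) t 1 &
         continuous (derive1n 2 W)],
      (forall t, 0 <= W t) /\ (forall t, -1 < t < 1 -> 0 < W t),
      forall t, W t = 0 <-> t = 1 \/ t = -1,
      [/\ derive1 W 1 = 0, derive1 W (-1) = 0,
          0 < derive1n 2 W 1 & 0 < derive1n 2 W (-1)] &
      exists2 C : R, 0 < C & forall t,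
        C^-1 * (`|t| `^ (p - 1) - 1) <= `|derive1 W t|
          <= C * (`|t| `^ (p - 1) + 1)].

Definition real_analytic (W : R -> R) : Prop :=
  forall x0, exists (r : R) (a : nat -> R), 0 < r /\ forall x, `|x - x0| < r ->
    series (fun k => a k * (x - x0) ^+ k) @ \oo --> W x.

Definition allen_cahn s eps (W : R -> R) f u Omega : \bar R :=
  (energy s u Omega
   + ((eps `^ (2 * s))^-1)%:E * \int[mu]_(x in Omega) (W (u x))%:E
   - \int[mu]_(x in Omega) (f x * u x)%:E)%E.

Definition weak_solution s p eps (W : R -> R) f g Omega u : Prop :=
  [/\ Hsg s Omega g u, Lp Omega p%:E u &
    forall phi, Htilde s Omega phi -> Lp Omega p%:E phi ->
      is_derive (0 : R) 1
        (fun t => fine (allen_cahn s eps W f (fun x => u x + t * phi x) Omega)) 0].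

Definition perimeter s E Omega : \bar R :=
  (double_integral (E `&` Omega) (~` E `&` Omega) (kernel s) +
   double_integral (E `&` Omega) (~` E `\` Omega) (kernel s) +
   double_integral (E `\` Omega) (~` E `&` Omega) (kernel s))%E.

Definition is_flow (X : Rn -> Rn) (phi : R -> Rn -> Rn) : Prop :=
  (forall x, phi 0 x = x) /\
  forall (t : R) (x : Rn), is_derive t 1 (phi ^~ x) (X (phi t x)).

(* [weak_partial] because f is only a Sobolev function. *)
Definition nonlocal_curvature_eq s E f Omega : Prop :=
  forall (X : Rn -> Rn) (phi : R -> Rn -> Rn),
    (forall i, Ckc 1 Omega (fun x => X x ord0 i)) -> is_flow X phi ->
    is_derive (0 : R) 1 (fun t => fine (perimeter s (phi t @` E) Omega))
      ((cns s)^-1 * fine (\int[mu]_(x in E `&` Omega)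
        (\sum_(i < n) weak_partial Omega i (fun z => f z * X z ord0 i)%R x)%:E)%E).

Definition phase E (x : Rn) : R := \1_E x - \1_(~` E) x.

Definition conditionA1 Omega (g_ : nat -> Rn -> R) g : Prop :=
  [/\ forall k, C01loc (g_ k),
      exists M : R, forall k, (Lp_norm (~` Omega) +oo (g_ k) <= M%:E)%E,
      Lmeasurable_fun (~` Omega) g,
      forall K : set Rn, compact K -> K `<=` ~` Omega ->
        (\int[mu]_(x in K) `|g_ k x - g x|%:E)%E @[k --> \oo] --> 0%E &
      {ae mu, forall x, (~` Omega) x -> `|g x| = 1}].

Definition conditionA2 s Omega (eps : nat -> R) (f_ : nat -> Rn -> R) f : Prop :=
  (forall k, C01 Omega (f_ k)) /\
  exists q : R, [/\ n%:R / (1 + 2 * s) < q < n%:R,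
    exists M : R, forall k,
      ((eps k `^ (2 * s))%:E * Lp_norm Omega +oo (f_ k)
       + W1q_norm Omega q (f_ k) <= M%:E)%E &
    W1q_weak_cvg Omega q f_ f].

Definition conditionA3 s p Omega (W : R -> R) (eps : nat -> R)
    (g_ f_ u_ : nat -> Rn -> R) : Prop :=
  (forall k, weak_solution s p (eps k) W (f_ k) (g_ k) Omega (u_ k)) /\
  exists M : R, forall k,
    (allen_cahn s (eps k) W (f_ k) (u_ k) Omega <= M%:E)%E.

(* Pointwise statements about u_k in Omega (uniform convergence, level sets) are
   about its continuous representative there, hence [A4_continuous]. *)
Record conditionA4 s Omega (W : R -> R) (eps : nat -> R)
    (f_ u_ : nat -> Rn -> R) f E : Prop := ConditionA4 {
  A4_perimeter : Lmeasurable E /\ (perimeter s E Omega < +oo)%E;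
  A4_continuous : forall k x, Omega x -> {for x, continuous (u_ k)};
  A4a : open (E `&` Omega) /\ nonlocal_curvature_eq s E f Omega;
  A4b : forall K : set Rn, compact K -> K `<=` Omega `\` boundary E ->
    forall e : R, 0 < e -> \forall k \near \oo, forall x, K x ->
      `|u_ k x - phase E x| < e;
  A4c : forall Omega', compactly_contained Omega' Omega ->
    energy s (u_ k) Omega' @[k --> \oo] -->
      ((2 * cns s)%:E * perimeter s E Omega')%E;
  A4d : forall Omega', compactly_contained Omega' Omega ->
    cvg_Hminus s Omega'
      (fun k => pairing Omega'
        (fun x => f_ k x - (eps k `^ (2 * s))^-1 * derive1 W (u_ k x)))
      (pairing Omega' (fun x => cns s / 2 * fine (\int[mu]_y
         (`|phase E x - phase E y| ^+ 2 * kernel s x y)%:E)%E * phase E x));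
  A4e : forall (delta r : R) (K : set Rn), -1 < delta < 1 -> compact K ->
    K `<=` Omega -> 0 < r -> \forall k \near \oo,
      [set x | u_ k x = delta] `&` K `<=` tubular r (boundary E `&` Omega) /\
      boundary E `&` K `<=` tubular r ([set x | u_ k x = delta] `&` Omega) }.

Record admissible_data s p Omega (W : R -> R) (eps : nat -> R)
    (g_ f_ u_ : nat -> Rn -> R) g f E : Prop := AdmissibleData {
  data_A1 : conditionA1 Omega g_ g;
  data_A2 : conditionA2 s Omega eps f_ f;
  data_A3 : conditionA3 s p Omega W eps g_ f_ u_;
  data_A4 : conditionA4 s Omega W eps f_ u_ f E }.

End defs.

(* Main.v *)
Require Import Defs.
From HB Require Import structures.
From mathcomp Require Import all_boot all_order all_algebra.
From mathcomp Require Import all_classical all_reals all_analysis.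
From mathcomp Require Import measurable_realfun.
From mathcomp Require Import ring lra zify.
Set Implicit Arguments.
Unset Strict Implicit.
Unset Printing Implicit Defensive.
Import Order.TTheory GRing.Theory Num.Theory numFieldNormedType.Exports.
Local Open Scope classical_set_scope.
Local Open Scope ring_scope.
Local Notation kernel := Defs.kernel.

(** The operator [(-Delta)^s] is antilocal: if [v] and [(-Delta)^s v] both vanish
    (or, more generally, [v] vanishes and the operator is constant) on a ball then
    [v = 0] almost everywhere. Away from the support of [v] the operator is the
    Riesz potential [x |-> \int v(y) |x - y|^(-n-2s) dy], which may be
    differentiated under the integral. If it is constant, its iterated Laplacians
    vanish, because the Laplacian of [|z|^(-2b)] is a nonzero multiple of
    [|z|^(-2b-2)]; so do all derivatives of those. Their values at the centre of
    the ball are, after the inversion [z |-> z / |z|^2], all the moments of a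
    compactly supported signed measure, and a compactly supported measure is
    determined by its moments ([unique_continuation]).

    The weak formulation is turned into the identity
    [<(-Delta)^s u, phi> = \int (f - eps^(-2s) W'(u)) phi] for smooth bumps
    ([weak_solution_frac_lap]). On [V], where the sources vanish, equality of the
    fractional Laplacians therefore gives [W1'(u1) = W2'(u2)] pointwise
    ([derive_potentials_agree]), and as soon as [u1 = u2] on some ball in [V]
    antilocality gives [u1 = u2] almost everywhere ([solutions_agree]).

    In the first case [u1 = u2] on [V] is given. For large [k] the function [u_k] is not
    constant near a point of [V], since otherwise antilocality would make it
    constant on [Omega] while it takes several levels close to the limit interface
    ([datum_nonconstant]). Hence [W1' = W2'] on an interval, and real analyticity
    with [W1(1) = W2(1) = 0] yields [W1 = W2] ([potentials_agree]).

    In the second case choose a ball in [V] on which both limit phases are constant. If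
    they agree, both sequences converge there uniformly to the same well of [W],
    near which [W'] is injective because [W''] is positive, so [u1 = u2] there for
    large [k]. They cannot differ: the limit of the right-hand sides is a
    nonnegative multiple of the phase, and strictly so in the phase [-1], since
    the other phase occupies an open set ([opposite_phases_absurd],
    [eventually_agree]).

    In both cases the solutions coincide for large [k]; then the sources have the
    same distributional limit, and the interfaces and perimeters, being limits of
    level sets and of energies, coincide too ([limits_agree]). *)


(** * Lebesgue measure on row vectors *)

Section lebesgue_basics.
Context (R : realType) (n : nat).
Local Notation Rn := 'rV[R]_n.
Local Notation LRn := (caratheodory_type (@lebesgue_borel R n)^*%mu).
Local Notation mu := (@lebesgue_rV R n).

Lemma borel_Lmeasurable (A : set Rn) :
  measurable A -> measurable (A : set LRn).
Proof. by move=> mA; apply: caratheodory_measurable_mu_ext. Qed.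

Lemma borel_measurable_coord (i : 'I_n) :
  measurable_fun setT (fun x : Rn => x ord0 i).
Proof.
move=> _ A mA; rewrite setTI /measurable/= /borel_rV/=.
rewrite [X in measurable X](_ : _ = (fun t : n.-tuple (measurableTypeR R) => tnth t i) @^-1` A); last first.
  by apply/seteqP; split => t /=; rewrite mxE.
rewrite -[X in measurable X]setTI; exact: measurable_tnth.
Qed.

Lemma borel_fun_Lmeasurable d (T : measurableType d) (f : Rn -> T) :
  measurable_fun setT f -> measurable_fun setT (f : LRn -> T).
Proof.
move=> mf _ A mA; rewrite setTI; apply: borel_Lmeasurable.
by rewrite -[X in measurable X]setTI; exact: mf.
Qed.

Lemma measurable_coord (i : 'I_n) :
  measurable_fun setT (fun x : LRn => (x : Rn) ord0 i).
Proof. exact: (borel_fun_Lmeasurable (borel_measurable_coord i)). Qed.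

Definition box (a c : Rn) : set Rn :=
  [set x | forall i, a ord0 i < x ord0 i < c ord0 i].

Lemma measurable_box a c : measurable (box a c).
Proof.
rewrite (_ : box a c = \bigcap_(i in [set: 'I_n])
    ((fun x : Rn => x ord0 i) @^-1` `]a ord0 i, c ord0 i[)); last first.
  by apply/seteqP; split=> x H i; have := H i; rewrite /= ?in_itv//=; exact.
apply: fin_bigcap_measurable => // i _; rewrite -[X in measurable X]setTI.
exact: borel_measurable_coord.
Qed.

Lemma ball_box (x : Rn) (r : R) : 0 < r ->
  ball x r = box (\row_i (x ord0 i - r)) (\row_i (x ord0 i + r)).
Proof.
move=> r0; apply/seteqP; split=> y.
  move=> xy i; rewrite !mxE; have [_ /(_ ord0 i)] := xy.
  by rewrite /ball/= distrC ltr_distl.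
move=> xy; split=> // i j; rewrite ord1; have := xy j; rewrite !mxE.
by rewrite /ball/= distrC ltr_distl.
Qed.

Lemma rational_ball_between (x : Rn) (e : R) : 0 < e -> exists (q : 'rV[rat]_n) (r : rat),
  ball (map_mx ratr q : Rn) (ratr r : R) x /\ ball (map_mx ratr q : Rn) (ratr r : R) `<=` ball x e.
Proof.
move=> e0.
have [r /andP[r0 re]] : exists r : rat, 0 < (ratr r : R) < e / 2.
  have : 0 < e / 2 by rewrite divr_gt0.
  by move=> /(rat_in_itvoo)[r]; rewrite in_itv/=; exists r.
have /choice[q qP] : forall i, exists q : rat, x ord0 i - ratr r < ratr q < x ord0 i + ratr r.
  move=> i; have : x ord0 i - ratr r < x ord0 i + ratr r by lra.
  by move=> /(rat_in_itvoo)[q]; rewrite in_itv/=; exists q.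
have xq : ball (map_mx ratr (\row_i q i) : Rn) (ratr r : R) x.
  by rewrite ball_box// => i; rewrite !mxE; have := qP i; lra.
exists (\row_i q i), r; split=> // y qy.
apply: (@le_ball _ _ _ (ratr r + ratr r)); first by lra.
by apply: ball_triangle qy; exact: ball_sym.
Qed.

Lemma open_measurable_rV (A : set Rn) : open A -> measurable A.
Proof.
move=> oA.
pose B (q : 'rV[rat]_n) (r : rat) : set Rn := ball (map_mx ratr q : Rn) (ratr r).
pose F (k : nat) : set Rn :=
  if @unpickle ('rV[rat]_n * rat)%type k is Some (q, r) then
    [set y | B q r y /\ B q r `<=` A] else set0.
have -> : A = \bigcup_k F k.
  apply/seteqP; split=> [x Ax|x [k _]]; last first.
    by rewrite /F; case: unpickle => [[q r] [qx]|//]; exact.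
  have [e /= e0 eA] : nbhs_ball x A by rewrite nbhs_ballE; exact: open_nbhs_nbhs.
  have [q [r [xq qr]]] := rational_ball_between x e0.
  exists (pickle (q, r)) => //; rewrite /F pickleK/=.
  by split=> //; exact: subset_trans qr eA.
apply: bigcupT_measurable => k; rewrite /F; case: unpickle => [[q r]|] //.
have [r0|r0] := ltP 0 (ratr r : R); last first.
  rewrite (_ : [set y | _] = set0)//; apply/seteqP; split=> // y [[r0' _] _].
  by move: r0'; rewrite ltNge r0.
have [qA|qA] := pselect (B q r `<=` A).
  rewrite (_ : [set y | _] = B q r).
    by rewrite /B ball_box//; exact: measurable_box.
  by apply/seteqP; split=> y // -[].
by rewrite (_ : [set y | _] = set0)//; apply/seteqP; split=> // y [].
Qed.

End lebesgue_basics.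

Section lebesgue_box.
Context (R : realType).

Lemma lebesgue_tuple_box (n : nat) (a c : 'I_n -> R) : (forall i, a i <= c i) ->
  lebesgue_tuple R n [set t | forall i, a i < tnth t i < c i] =
  (\prod_(i < n) (c i - a i))%:E.
Proof.
elim: n a c => [|n IHn] a c ac.
  rewrite big_ord0 /= diracE mem_set//= => -[].
  by case.
rewrite big_ord_recl /= /lebesgue_cons.
rewrite (_ : _ @^-1` _ = `]a ord0, c ord0[%classic `*`
  [set t : n.-tuple R | forall i : 'I_n, a (lift ord0 i) < tnth t i < c (lift ord0 i)]).
  rewrite product_measure1E/=.
  - rewrite lebesgue_measure_itv/= lte_fin.
    rewrite (IHn (fun i => a (lift ord0 i)) (fun i => c (lift ord0 i)))// EFinM.
    have := ac ord0; rewrite le_eqVlt => /predU1P[->|->]; last by rewrite EFinB.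
    by rewrite ltxx subrr !mul0e.
  - exact: measurable_itv.
  - rewrite (_ : [set t | _] = \bigcap_(i in [set: 'I_n])
      ((fun t : n.-tuple (measurableTypeR R) => tnth t i) @^-1`
         `]a (lift ord0 i), c (lift ord0 i)[)).
      apply: fin_bigcap_measurable => // i _; rewrite -[X in measurable X]setTI.
      exact: measurable_tnth.
    by apply/seteqP; split=> x H i; have := H i; rewrite /= ?in_itv//=; exact.
apply/seteqP; split=> [[x t] /= H|[x t] /= [H1 H2] i].
  split=> /=; first by have := H ord0; rewrite in_itv/=.
  by move=> i; have := H (lift ord0 i); rewrite tnthS.
by case: (unliftP ord0 i) => [j|] ->; rewrite ?tnthS//; move: H1; rewrite in_itv.
Qed.

Variable (n : nat).
Local Notation Rn := 'rV[R]_n.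
Local Notation LRn := (caratheodory_type (@lebesgue_borel R n)^*%mu).
Local Notation mu := (@lebesgue_rV R n).

Lemma lebesgue_rVE (A : set Rn) : measurable A -> mu A = @lebesgue_borel R n A.
Proof. by move=> mA; rewrite /lebesgue_rV /completed_measure_extension/= measurable_mu_extE. Qed.

Lemma lebesgue_box (a c : Rn) : (forall i, a ord0 i <= c ord0 i) ->
  mu (box a c) = (\prod_(i < n) (c ord0 i - a ord0 i))%:E.
Proof.
move=> ac; rewrite lebesgue_rVE; last exact: measurable_box.
rewrite /lebesgue_borel -lebesgue_tuple_box//; congr (lebesgue_tuple R n _).
by apply/seteqP; split=> t H i; have := H i; rewrite mxE.
Qed.

Lemma lebesgue_ball (x : Rn) (r : R) : 0 < r -> mu (ball x r) = ((2 * r) ^+ n)%:E.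
Proof.
move=> r0; rewrite ball_box// lebesgue_box.
  congr EFin; rewrite (eq_bigr (fun=> 2 * r)) ?prodr_const ?card_ord//.
  by move=> i _; rewrite !mxE; ring.
by move=> i; rewrite !mxE; lra.
Qed.

(** The completed measure is an outer measure built from Borel covers, so an
    intersection of covers of nearly minimal mass is a hull. *)
Lemma borel_hull (A : set Rn) : (mu A < +oo)%E ->
  exists B, [/\ measurable B, A `<=` B & mu B = mu A].
Proof.
move=> Aoo.
have A0 : (0 <= mu A)%E by exact: outer_measure_ge0.
have /choice[F FP] : forall k : nat, exists F : (set Rn)^nat,
    measurable_cover A F /\ (\sum_(0 <= i <oo) lebesgue_borel (F i) <= mu A + (k.+1%:R^-1)%:E)%E.
  move=> k.
  have : (mu A < mu A + (k.+1%:R^-1)%:E)%E.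
    by rewrite lteDl// ?ge0_fin_numE// lte_fin.
  rewrite {1}/lebesgue_rV /completed_measure_extension /mu_ext.
  by move/ereal_inf_lt => [_ [F FA <-] /ltW FA2]; exists F.
exists (\bigcap_k \bigcup_i F k i).
have mF k : measurable (\bigcup_i F k i).
  by apply: bigcupT_measurable => i; have [[+ _] _] := FP k; exact.
have mB : measurable (\bigcap_k \bigcup_i F k i) by exact: bigcapT_measurable.
have AB : A `<=` \bigcap_k \bigcup_i F k i.
  by move=> x Ax k _; have [[_ +] _] := FP k; exact.
split => //.
apply/eqP; rewrite eq_le; apply/andP; split; last exact: le_outer_measure.
apply/lee_addgt0Pr => e e0.
have [k ke] : exists k, k.+1%:R^-1 < e.
  have [k _ ke] := near_infty_natSinv_lt (PosNum e0).
  by exists k; apply: (ke k) => /=.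
have [[mFk _] Fk] := FP k.
apply: (@le_trans _ _ (mu (\bigcup_i F k i))).
  by apply: le_outer_measure; exact: bigcap_inf.
apply: (@le_trans _ _ (mu A + (k.+1%:R^-1)%:E)%E); last first.
  by rewrite leeD2l// lee_fin ltW.
apply: le_trans Fk.
rewrite (eq_eseriesr (g := fun i => mu (F k i))); last first.
  by move=> i _; rewrite lebesgue_rVE.
exact: outer_measure_sigma_subadditive.
Qed.
End lebesgue_box.

(** * Signed densities and the sets that determine them *)

Section integral_toolbox.
Context d (T : measurableType d) (R : realType) (mu : {measure set T -> \bar R}).
Implicit Types f g h w : T -> R.

Lemma integrable_dominated f g : measurable_fun setT f ->
  mu.-integrable setT (EFin \o g) -> (forall x, `|f x| <= g x) ->
  mu.-integrable setT (EFin \o f).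
Proof.
move=> mf ig fg; apply: le_integrable ig => //; first exact/measurable_EFinP.
move=> x _; rewrite /= lee_fin [leRHS]ger0_norm//.
exact: le_trans (normr_ge0 _) (fg x).
Qed.

Lemma Rdominated_cvg (f_ : nat -> T -> R) f g :
  (forall k, measurable_fun setT (f_ k)) -> measurable_fun setT f ->
  (forall x, f_ k x @[k --> \oo] --> f x) ->
  mu.-integrable setT (EFin \o g) -> (forall k x, `|f_ k x| <= g x) ->
  \int[mu]_x f_ k x @[k --> \oo] --> \int[mu]_x f x.
Proof.
move=> mf_ mf cf ig fg.
have fi : mu.-integrable setT (EFin \o f).
  apply: integrable_dominated ig _ => // x.
  rewrite -(cvg_lim (@Rhausdorff R) (cvg_norm (cf x))).
  apply: limr_le; first exact: cvgP (cvg_norm (cf x)).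
  by apply: nearW => k; exact: fg.
apply: fine_cvg; rewrite fineK; last exact: integrable_fin_num.
apply: (@dominated_cvg _ _ _ mu setT _ _ _ (EFin \o g)) => //.
- by move=> k; exact/measurable_EFinP.
- by move=> x _; apply/fine_cvgP; split; [exact: nearW|exact: cf].
- by move=> k x _; rewrite /= lee_fin.
Qed.

Lemma Rdominated_cvg0 (f_ : nat -> T -> R) f g :
  (forall k, measurable_fun setT (f_ k)) -> measurable_fun setT f ->
  (forall x, f_ k x @[k --> \oo] --> f x) ->
  mu.-integrable setT (EFin \o g) -> (forall k x, `|f_ k x| <= g x) ->
  (forall k, \int[mu]_x f_ k x = 0) -> \int[mu]_x f x = 0.
Proof.
move=> mf_ mf cf ig fg f0.
have := Rdominated_cvg mf_ mf cf ig fg.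
under eq_fun do rewrite f0.
by move/(cvg_unique (@Rhausdorff R)); apply; exact: cvg_cst.
Qed.

End integral_toolbox.

Section orthants.
Context (R : realType) (n : nat).
Local Notation Rn := 'rV[R]_n.

Definition orthant (c : Rn) : set Rn := [set x | forall i, x ord0 i < c ord0 i].

Lemma row_lt_nat (x : Rn) : exists k : nat, forall j, x ord0 j < k%:R.
Proof.
exists (Num.bound (\sum_j `|x ord0 j|)) => j.
apply: le_lt_trans (archi_boundP _); last by rewrite sumr_ge0.
by rewrite (bigD1 j)//= (le_trans (ler_norm _))// lerDl sumr_ge0.
Qed.

Lemma orthantI c1 c2 : orthant c1 `&` orthant c2 =
  orthant (\row_i Num.min (c1 ord0 i) (c2 ord0 i)).
Proof.
apply/seteqP; split=> [x [H1 H2] i|x H].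
  by rewrite mxE lt_min H1 H2.
by split=> i; have := H i; rewrite mxE lt_min => /andP[].
Qed.

(** Through the coordinates everything reduces to half spaces, which are
    countable unions of orthants. *)
Lemma orthant_generate (A : set Rn) : measurable A -> <<s range orthant >> A.
Proof.
pose sA := @smallest_sigma_algebra Rn setT (range orthant).
pose g (x : Rn) : n.-tuple (measurableTypeR R) := [tuple x ord0 i | i < n].
have gK x : @row_of_tuple R n (g x) = x.
  by apply/rowP => i; rewrite mxE tnth_mktuple.
move=> mA; rewrite (_ : A = g @^-1` (@row_of_tuple R n @^-1` A)); last first.
  by rewrite -comp_preimage (_ : _ \o _ = id)//; apply/funext => x /=.
have : measurable (@row_of_tuple R n @^-1` A) by exact: mA.
rewrite [X in X -> _]/measurable/= /g_sigma_preimage.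
move: (@row_of_tuple R n @^-1` A) => B; move: B.
pose S := [set B : set (n.-tuple (measurableTypeR R)) | <<s range orthant >> (g @^-1` B)].
rewrite -/(_ `<=` S); apply: smallest_sub.
  split=> [|B SB|F SF].
  - by rewrite /S/= preimage_set0; case: sA.
  - rewrite /S/= setTD preimage_setC -setTD; case: sA => _ + _; exact.
  - by rewrite /S/= preimage_bigcup; case: sA => _ _; exact.
elim/big_ind: _ => [//|X Y XS YS B [/XS|/YS]//|i _ _ [C mC <-]].
rewrite setTI /S/=.
have -> : g @^-1` ((tnth (T:=R))^~ i @^-1` C) = [set x : Rn | C (x ord0 i)].
  by apply/seteqP; split=> x /=; rewrite tnth_mktuple.
have {mC} : <<s @RGenInftyO.G R >> C.
  by have := mC; rewrite [X in X C -> _](_ : _ = @measurable _ (g_sigma_algebraType (@RGenInftyO.G R)))// -RGenInftyO.measurableE.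
move: C.
pose S' := [set C : set R | <<s range orthant >> [set x : Rn | C (x ord0 i)]].
rewrite -/(_ `<=` S'); apply: smallest_sub.
  split=> [|B SB|F SF].
  - by rewrite /S'/= (_ : [set x | _] = set0)//; case: sA.
  - by case: sA => _ /(_ _ SB).
  - by case: sA => _ _ /(_ _ SF).
move=> _ [c ->]; rewrite /S'/=.
have -> : [set x : Rn | `]-oo, c[%classic (x ord0 i)] =
    \bigcup_k orthant (\row_j (if j == i then c else k%:R)); last first.
  by case: sA => _ _; apply => k; apply: sub_sigma_algebra; eexists.
apply/seteqP; split=> [x /=|x [k _ /(_ i)]]; last by rewrite mxE eqxx /= in_itv.
rewrite in_itv/= => xi.
have [k xk] := row_lt_nat x.
exists k => // j; rewrite mxE; case: eqP => [->|]//.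
Qed.

Context d (T : measurableType d) (mu : {measure set T -> \bar R}).

(** Orthants generate the Borel sets and are stable under intersection, and the
    sets charged with mass 0 by the image under [Z] of the signed measure of
    density [w] form a Dynkin class. *)
Lemma orthant_unique (w : T -> R) (Z : T -> Rn) (B : set Rn) :
  mu.-integrable setT (EFin \o w) -> measurable_fun setT Z ->
  (forall c, \int[mu]_x (w x * \1_(orthant c) (Z x)) = 0) ->
  measurable B -> \int[mu]_x (w x * \1_B (Z x)) = 0.
Proof.
move=> iw mZ w0 mB.
have mw : measurable_fun setT w by case/integrableP : iw => /measurable_EFinP.
have mwI A : measurable A -> measurable_fun setT (fun x => w x * \1_A (Z x)).
  by move=> mA; apply: measurable_funM => //; apply: measurableT_comp => //; exact: measurable_indic.
have iwI A : measurable A -> mu.-integrable setT (EFin \o (fun x => w x * \1_A (Z x))).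
  move=> mA; apply: (@integrable_dominated _ _ _ _ _ (fun x => `|w x|)); first exact: mwI.
    exact: integrable_norm.
  move=> x; rewrite normrM indicE; case: (_ \in _); by rewrite ?normr0 ?normr1 ?mulr1 ?mulr0.
pose H := [set A : set Rn | measurable A /\ \int[mu]_x (w x * \1_A (Z x)) = 0].
have HN : ndseq_closed H.
  move=> F ndF HF; split.
    by apply: bigcupT_measurable => k; case: (HF k).
  apply: (@Rdominated_cvg0 _ _ _ mu (fun k x => w x * \1_(F k) (Z x)) _ (fun x => `|w x|)).
  - by move=> k; apply: mwI; case: (HF k).
  - by apply: mwI; apply: bigcupT_measurable => k; case: (HF k).
  - move=> x; apply: cvgM; first exact: cvg_cst.
    have [[k _ Fk]|nF] := pselect ((\bigcup_i F i) (Z x)).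
      rewrite indicE mem_set//=; last by exists k.
      apply: cvg_near_cst; exists k => // m /= km; rewrite indicE mem_set//.
      exact: (subsetPset _ _ (ndF _ _ km)).
    rewrite indicE memNset//; apply: cvg_near_cst; apply: nearW => k.
    by rewrite indicE memNset// => Fk; apply: nF; exists k.
  - exact: integrable_norm.
  - move=> k x; rewrite normrM indicE; case: (_ \in _); by rewrite ?normr0 ?normr1 ?mulr1 ?mulr0.
  - by move=> k; case: (HF k).
have HO c : H (orthant c).
  split=> //; rewrite (_ : orthant c =
      \bigcap_(i in [set: 'I_n]) ((fun x : Rn => x ord0 i) @^-1` `]-oo, c ord0 i[)); last first.
    by apply/seteqP; split=> x H' i; have := H' i; rewrite /= ?in_itv//=; exact.
  apply: fin_bigcap_measurable => // i _; rewrite -[X in measurable X]setTI.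
  exact: borel_measurable_coord.
have HT : H setT.
  rewrite (_ : setT = \bigcup_k orthant (const_mx k%:R)); last first.
    apply/seteqP; split=> // x _; have [k xk] := row_lt_nat x.
    by exists k => // j; rewrite mxE.
  apply: HN => // k m km; apply/subsetPset => x xk j; have := xk j; rewrite !mxE.
  by move/lt_le_trans; apply; rewrite ler_nat.
suff : <<s range orthant >> `<=` H by move/(_ _ (orthant_generate mB)) => -[].
apply: lambda_system_subset => //.
- by move=> _ _ [c1 _ <-] [c2 _ <-]; rewrite orthantI; eexists.
- split => // A C CA [mA A0] [mC C0]; split; first exact: measurableD.
  transitivity (\int[mu]_x (w x * \1_A (Z x) - w x * \1_C (Z x))).
    congr (fine _); apply: eq_integral => x _; congr EFin.
    rewrite !indicE in_setD; case: (boolP (Z x \in C)) => xC; last by rewrite mulr0 subr0 andbT.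
    by rewrite (mem_set (CA _ (set_mem xC))) /= mulr0 subrr.
  by rewrite RintegralB ?A0 ?C0 ?subrr//; exact: iwI.
- by move=> _ [c _ <-].
Qed.

End orthants.

Section moments.
Context (R : realType).

Lemma bernoulli_le (x : R) (m : nat) : -1 <= x -> 1 + m%:R * x <= (1 + x) ^+ m.
Proof.
move=> x1; elim: m => [|m IH]; first by rewrite expr0 mul0r addr0.
rewrite exprS; apply: le_trans (ler_wpM2l _ IH); last lra.
rewrite -natr1; have : 0 <= m%:R * x ^+ 2 by rewrite mulr_ge0// sqr_ge0.
by rewrite expr2; nra.
Qed.

Lemma cvg_nat_geometric (r : R) : 0 <= r < 1 -> (m%:R * r ^+ m) @[m --> \oo] --> (0 : R).
Proof.
move=> /andP[]; rewrite le_eqVlt => /predU1P[<- _|r0 r1].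
  apply: cvg_near_cst; exists 1%N => // m /= m0.
  by rewrite expr0n; case: m m0 => //= m _; rewrite mulr0.
pose q := Num.sqrt r.
have q0 : 0 < q by rewrite sqrtr_gt0.
have rq : r = q ^+ 2 by rewrite sqr_sqrtr// ltW.
have q1 : q < 1 by rewrite -sqrtr1 ltr_sqrt.
pose e := q^-1 - 1.
have e0 : 0 < e by rewrite subr_gt0 invf_gt1.
have He m : m%:R * q ^+ m <= e^-1.
  have /(@bernoulli_le e m) : -1 <= e by rewrite (le_trans _ (ltW e0))// lerN10.
  rewrite [1 + e](_ : _ = q^-1); last by rewrite /e; ring.
  rewrite exprVn => H; have qm : 0 < q ^+ m by exact: exprn_gt0.
  rewrite -[leRHS]mul1r ler_pdivlMr// mulrAC -ler_pdivlMr// div1r.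
  by apply: le_trans H; rewrite lerDr.
apply: (@squeeze_cvgr _ _ _ _ (cst 0) (geometric e^-1 q)).
- apply: nearW => m; apply/andP; split.
    by rewrite /= mulr_ge0// exprn_ge0// ltW.
  by rewrite rq -exprM mulnC exprM expr2 mulrA ler_wpM2r ?exprn_ge0 ?He// ltW.
- exact: cvg_cst.
- by apply: cvg_geometric; rewrite gtr0_norm.
Qed.

(** The polynomials (1 - t^m)^(m 2^m) take values in [0, 1] on [0, 1]; they
    tend to 1 at t < 1/2 because m 2^m t^m tends to 0, and to 0 at t >= 1/2,
    the factor m in the exponent being what makes the limit 0 at t = 1/2. *)
Definition step_poly (m : nat) (t : R) := (1 - t ^+ m) ^+ (m * 2 ^ m).

Lemma step_poly_itv m t : 0 <= t <= 1 -> 0 <= step_poly m t <= 1.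
Proof.
move=> /andP[t0 t1]; have := exprn_ge0 m t0; have := exprn_ile1 m t0 t1 => H1 H2.
by rewrite exprn_ge0 ?exprn_ile1//; lra.
Qed.

Lemma cvg_step_poly_lt t : 0 <= t < 2^-1 -> step_poly m t @[m --> \oo] --> (1 : R).
Proof.
move=> /andP[t0 t1].
apply: (@squeeze_cvgr _ _ _ _ (fun m => 1 - m%:R * (2 * t) ^+ m) (cst 1)).
- apply: nearW => m; have /(step_poly_itv m)/andP[_ ->] : 0 <= t <= 1 by lra.
  rewrite andbT; have : -1 <= - t ^+ m.
    by rewrite lerN2 exprn_ile1//; lra.
  move/(@bernoulli_le _ (m * 2 ^ m)); apply: le_trans.
  by rewrite exprMn natrM natrX mulrN mulrA.
- rewrite -[X in _ --> X]subr0; apply: cvgB; first exact: cvg_cst.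
  by apply: cvg_nat_geometric; lra.
- exact: cvg_cst.
Qed.

Lemma cvg_step_poly_ge t : 2^-1 <= t <= 1 -> step_poly m t @[m --> \oo] --> (0 : R).
Proof.
move=> /andP[t0 t1].
apply: (@squeeze_cvgr _ _ _ _ (cst 0) (fun m => m.+1%:R^-1)).
- apply: nearW => m; have /(step_poly_itv m)/andP[-> _] : 0 <= t <= 1 by lra.
  rewrite /= -[leRHS]mul1r ler_pdivlMr//.
  have tm : t ^+ m <= 1 by rewrite exprn_ile1//; lra.
  have tm0 : 0 <= t ^+ m by rewrite exprn_ge0//; lra.
  have : m.+1%:R <= (1 + t ^+ m) ^+ (m * 2 ^ m).
    apply: le_trans (bernoulli_le _ _); last lra.
    rewrite -natr1 addrC lerD2l natrM natrX -mulrA ler_peMr//.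
    by rewrite -exprMn exprn_ege1//; lra.
  move=> H; apply: (@le_trans _ _ (step_poly m t * (1 + t ^+ m) ^+ (m * 2 ^ m))).
    by rewrite ler_wpM2l//; rewrite exprn_ge0; lra.
  rewrite /step_poly -exprMn exprn_ile1//; nra.
- exact: cvg_cst.
- exact: cvg_harmonic.
Qed.

End moments.

Section moment_problem.
Context d (T : measurableType d) (R : realType) (mu : {measure set T -> \bar R}).

Lemma RintegrableZl (D : set T) (k : R) (f : T -> R) : measurable D ->
  mu.-integrable D (EFin \o f) -> mu.-integrable D (EFin \o (fun x => k * f x)).
Proof.
move=> mD fi; have := integrableZl mD k fi.
by apply: eq_integrable => // x _; rewrite /= EFinM.
Qed.

Lemma RintegrableD (D : set T) (f g : T -> R) : measurable D ->
  mu.-integrable D (EFin \o f) -> mu.-integrable D (EFin \o g) ->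
  mu.-integrable D (EFin \o (fun x => f x + g x)).
Proof.
move=> mD fi gi; have := integrableD mD fi gi.
by apply: eq_integrable => // x _; rewrite /= EFinD.
Qed.

Lemma RintegrableB (D : set T) (f g : T -> R) : measurable D ->
  mu.-integrable D (EFin \o f) -> mu.-integrable D (EFin \o g) ->
  mu.-integrable D (EFin \o (fun x => f x - g x)).
Proof.
move=> mD fi gi; have := integrableB mD fi gi.
by apply: eq_integrable => // x _; rewrite /= EFinB.
Qed.

Lemma integrable_mul_bounded (w g : T -> R) (C : R) :
  mu.-integrable setT (EFin \o w) -> measurable_fun setT g ->
  (forall x, w x != 0 -> `|g x| <= C) ->
  mu.-integrable setT (EFin \o (fun x => w x * g x)).
Proof.
move=> iw mg gC.
have mw : measurable_fun setT w by case/integrableP : iw => /measurable_EFinP.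
apply: (@integrable_dominated _ _ _ _ _ (fun x => C * `|w x|)); first exact: measurable_funM.
  by apply: RintegrableZl => //; exact: integrable_norm.
move=> x; rewrite normrM mulrC.
by have [->|w0] := eqVneq (w x) 0; [rewrite normr0 !mulr0|rewrite ler_wpM2r// gC].
Qed.

Lemma Rintegral_sum (I : Type) (r : seq I) (F : I -> T -> R) :
  (forall i, mu.-integrable setT (EFin \o F i)) ->
  \int[mu]_x (\sum_(i <- r) F i x) = \sum_(i <- r) \int[mu]_x F i x.
Proof.
move=> iF; have iS s : mu.-integrable setT (EFin \o (fun x => \sum_(i <- s) F i x)).
  have := @integrable_sum _ _ _ mu setT measurableT _ s xpredT (fun i => EFin \o F i) (fun i _ => iF i).
  by apply: eq_integrable => // x _; rewrite /= sumEFin.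
elim: r => [|i r IH].
  rewrite big_nil; under eq_Rintegral do rewrite big_nil.
  by rewrite Rintegral_cst// mul0r.
rewrite big_cons -IH -RintegralD//.
by apply: eq_Rintegral => x _; rewrite big_cons.
Qed.

Variable n : nat.
Local Notation Rn := 'rV[R]_n.

(** A compactly supported finite signed measure (the image under [Z] of the
    density [w]) is determined by its moments: products of the step polynomials
    converge boundedly to indicators of orthants. *)
Lemma moment_unique (w : T -> R) (Z : T -> Rn) (M : R) (B : set Rn) :
  mu.-integrable setT (EFin \o w) -> measurable_fun setT Z ->
  (forall x, w x != 0 -> forall i, `|Z x ord0 i| <= M) ->
  (forall a : 'I_n -> nat, \int[mu]_x (w x * \prod_i Z x ord0 i ^+ a i) = 0) ->
  measurable B -> \int[mu]_x (w x * \1_B (Z x)) = 0.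
Proof.
move=> iw mZ ZM w0; apply: orthant_unique => // c.
have mw : measurable_fun setT w by case/integrableP : iw => /measurable_EFinP.
have mZi i : measurable_fun setT (fun x => Z x ord0 i).
  exact: measurableT_comp (borel_measurable_coord i) mZ.
have polyE (P : 'I_n -> {poly R}) : \int[mu]_x (w x * \prod_i (P i).[Z x ord0 i]) = 0.
  pose N := (\max_i size (P i))%N.
  transitivity (\int[mu]_x (\sum_(f : {ffun 'I_n -> 'I_N})
      (\prod_i (P i)`_(f i)) * (w x * \prod_i Z x ord0 i ^+ f i))).
    apply: eq_Rintegral => x _.
    under eq_bigr => i _ do rewrite (horner_coef_wide _ (leq_bigmax i : size (P i) <= N)%N).
    rewrite bigA_distr_bigA mulr_sumr; apply: eq_bigr => f _.
    by rewrite big_split/= mulrCA.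
  have iwf (f : {ffun 'I_n -> 'I_N}) : mu.-integrable setT
      (EFin \o (fun x => w x * \prod_i Z x ord0 i ^+ f i)).
    apply: (@integrable_mul_bounded _ _ (\prod_(i < n) (M ^+ f i))) => //.
      by apply: measurable_prod => i _; exact: measurable_funX.
    move=> x wx; rewrite normr_prod; apply: ler_prod => i _.
    by rewrite normrX exprn_ge0//= lerXn2r ?nnegrE//; [exact: le_trans (ZM _ wx i)|exact: ZM].
  rewrite Rintegral_sum.
    rewrite big1// => f _; rewrite RintegralZl//.
    by rewrite (w0 (fun i => f i)) mulr0.
  by move=> f; exact: RintegrableZl.
(* [s i] maps [-M, M] into [0, 1] affinely and sends [c i] to the threshold 1/2. *)
pose L i := 2 * (`|M| + `|c ord0 i| + 1).
pose s i (t : R) := (t - c ord0 i) / L i + 2^-1.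
have L0 i : 0 < L i by rewrite /L; have := normr_ge0 M; have := normr_ge0 (c ord0 i); lra.
have s01 i t : `|t| <= M -> 0 <= s i t <= 1.
  move=> tM; have : `|(t - c ord0 i) / L i| <= 2^-1.
    rewrite normrM normfV (gtr0_norm (L0 i)) ler_pdivrMr// /L mulrA mulVf// mul1r.
    rewrite (le_trans (ler_normB _ _))//; have := ler_norm M; lra.
  by rewrite ler_norml /s; lra.
have s_lt i t : (s i t < 2^-1) = (t < c ord0 i).
  by rewrite /s -subr_lt0 addrK pmulr_llt0 ?invr_gt0// subr_lt0.
apply: (@Rdominated_cvg0 _ _ _ mu
  (fun m x => w x * \prod_i step_poly m (s i (Z x ord0 i))) _ (fun x => `|w x|)).
- move=> m; apply: measurable_funM => //; apply: measurable_prod => i _.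
  apply: measurable_funX; apply: measurable_funB => //; apply: measurable_funX.
  by apply: measurable_funD => //; apply: measurable_funM => //; exact: measurable_funB.
- apply: measurable_funM => //; apply: measurableT_comp => //; apply: measurable_indic.
  rewrite (_ : orthant c =
      \bigcap_(i in [set: 'I_n]) ((fun x : Rn => x ord0 i) @^-1` `]-oo, c ord0 i[)); last first.
    by apply/seteqP; split=> x H' i; have := H' i; rewrite /= ?in_itv//=; exact.
  apply: fin_bigcap_measurable => // i _; rewrite -[X in measurable X]setTI.
  exact: borel_measurable_coord.
- move=> x; have [wx|wx] := eqVneq (w x) 0.
    by under eq_fun do rewrite wx mul0r; rewrite wx mul0r; exact: cvg_cst.
  apply: cvgM; first exact: cvg_cst.
  rewrite (_ : \1_(orthant c) (Z x) = \prod_i (Z x ord0 i < c ord0 i)%R%:R :> R); last first.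
    rewrite indicE; have [/set_mem Ho|/negP nO] := boolP (Z x \in orthant c).
      by rewrite big1// => i _; rewrite Ho.
    have [i /negP Hi] : exists i, ~ (Z x ord0 i < c ord0 i).
      by apply/existsNP => H; apply: nO; rewrite inE.
    by rewrite (bigD1 i)//= (negbTE Hi) mul0r.
  apply: cvg_big => [|i _]; first exact: mul_continuous.
  have := s01 i _ (ZM _ wx i); rewrite -s_lt; case: ltP => [|] H1 /andP[H2 H3].
    by apply: cvg_step_poly_lt; rewrite H2.
  by apply: cvg_step_poly_ge; rewrite H1.
- exact: integrable_norm.
- move=> m x; have [->|wx] := eqVneq (w x) 0; first by rewrite mul0r normr0.
  rewrite normrM -[leRHS]mulr1 ler_wpM2l// normr_prod.
  apply: prodr_ile1 => i _.
  rewrite normr_ge0/=; have /andP[H1 H2] := step_poly_itv m (s01 i _ (ZM _ wx i)).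
  by rewrite ger0_norm.
- move=> m; rewrite -[RHS](polyE (fun i => (1 - ((L i)^-1 *: 'X + (2^-1 - c ord0 i / L i)%:P) ^+ m) ^+ (m * 2 ^ m))).
  apply: eq_Rintegral => x _; congr (_ * _); apply: eq_bigr => i _.
  rewrite /step_poly horner_exp hornerD hornerN horner_exp hornerD hornerZ hornerX.
  rewrite !hornerC /s mulrBl [in RHS]addrCA [in RHS]addrC.
  by rewrite [(L i)^-1 * _]mulrC.
Qed.

End moment_problem.

(** A class of sets containing a hull of every set of finite measure is enough to
    test a density: the hull of [{w > 0}] exceeds it by a null set only. *)
Section hull_density.
Context d (T : measurableType d) (R : realType) (mu : {sigma_finite_measure set T -> \bar R}).
Variable C : set (set T).
Hypothesis mC : C `<=` measurable.
Hypothesis hullC : forall A, measurable A -> (mu A < +oo)%E ->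
  exists B, [/\ C B, A `<=` B & mu B = mu A].

Let integrable_wI (w : T -> R) (A : set T) : mu.-integrable setT (EFin \o w) ->
  measurable A -> mu.-integrable setT (EFin \o (fun x => w x * \1_A x)).
Proof.
move=> iw mA; apply: (@integrable_mul_bounded _ _ _ _ _ _ 1) => //.
by move=> x _; rewrite indicE; case: (_ \in _); rewrite ?normr0 ?normr1.
Qed.

Lemma hull_density_le0 (w : T -> R) : mu.-integrable setT (EFin \o w) ->
  (forall A, C A -> \int[mu]_x (w x * \1_A x) = 0) ->
  {ae mu, forall x, w x <= 0}.
Proof.
move=> iw w0.
have mw : measurable_fun setT w by case/integrableP : iw => /measurable_EFinP.
have [F FT Foo] := sigma_finiteT mu.
pose P k := [set x | 0 < w x] `&` F k.
have mP k : measurable (P k).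
  apply: measurableI; last by case: (Foo k).
  by rewrite -[X in measurable X]setTI (_ : [set x | _] = w @^-1` `]0, +oo[)//;
    [exact: mw|apply/seteqP; split => x /=; rewrite in_itv/= andbT].
have P0 k : mu (P k) = 0%E.
  have Poo : (mu (P k) < +oo)%E.
    have [mF] := Foo k; apply: le_lt_trans; apply: le_measure; rewrite ?inE//.
    exact: subIsetr.
  have [B [CB PB muB]] := hullC (mP k) Poo.
  have mB := mC CB.
  have BP0 : mu (B `\` P k) = 0%E.
    rewrite measureD//=; last by rewrite muB.
    by rewrite (setIidr PB) muB subee// ge0_fin_numE.
  have iwP := integrable_wI iw (mP k).
  have iwB := integrable_wI iw mB.
  have wP_ge0 x : 0 <= w x * \1_(P k) x.
    rewrite indicE; have [[w_gt0 _]|xP] := pselect (P k x).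
      by rewrite mulr_ge0// ltW.
    by rewrite memNset// mulr0.
  have wP0 : \int[mu]_x (w x * \1_(P k) x) = 0.
    rewrite -[RHS](w0 _ CB) /Rintegral; congr (fine _); apply: ae_eq_integral => //.
    - by case/integrableP : iwP.
    - by case/integrableP : iwB.
    - exists (B `\` P k); split=> //; first exact: measurableD.
      move=> x /= /not_implyP[_ H]; apply: contrapT => nx; apply: H; congr EFin; congr (_ * _).
      rewrite !indicE; have [xP|xP] := pselect (P k x); first by rewrite !mem_set//; exact: PB.
      by rewrite memNset// memNset// => xB; exact: nx.
  have : (\int[mu]_x `|(w x * \1_(P k) x)%:E| = 0)%E.
    rewrite -[RHS]/(0%:E) -wP0 fineK; last exact: integrable_fin_num.
    by apply: eq_integral => x _; rewrite gee0_abs// lee_fin.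
  move/ae_eq_integral_abs => /(_ measurableT); case; first by case/integrableP : iwP.
  move=> N [mN N0 HN]; apply/eqP; rewrite eq_le measure_ge0 andbT -N0.
  apply: le_measure; rewrite ?inE// => x Px; apply: HN => /= /(_ Logic.I) [].
  by rewrite indicE mem_set// mulr1 => w00; case: Px => /=; rewrite w00 ltxx.
exists (\bigcup_k P k); split.
- exact: bigcupT_measurable.
- apply/eqP; rewrite eq_le measure_ge0 andbT.
  apply: le_trans (measure_sigma_subadditive _ _ _ _) _ => //; first exact: bigcupT_measurable.
  by rewrite eseries0// => k _ _; exact: P0.
- move=> x /= /negP; rewrite -ltNge => wx.
  have [k _ Fk] : (\bigcup_k F k) x by rewrite -FT.
  by exists k.
Qed.

Lemma hull_density_eq0 (w : T -> R) : mu.-integrable setT (EFin \o w) ->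
  (forall A, C A -> \int[mu]_x (w x * \1_A x) = 0) ->
  {ae mu, forall x, w x = 0}.
Proof.
move=> iw w0.
have iNw : mu.-integrable setT (EFin \o (fun x => - w x)).
  by have := RintegrableZl (-1) measurableT iw; apply: eq_integrable => // x _; rewrite /= mulN1r.
have H1 := hull_density_le0 iw w0.
have H2 : {ae mu, forall x, - w x <= 0}.
  apply: hull_density_le0 => // A CA.
  transitivity (\int[mu]_x (-1 * (w x * \1_A x))).
    by apply: eq_Rintegral => x _; rewrite mulN1r mulNr.
  by rewrite RintegralZl ?w0 ?mulr0//; apply: integrable_wI => //; exact: mC.
move: H1 H2; apply: filterS2 => x H1 H2.
by apply/eqP; rewrite eq_le H1 -oppr_le0 H2.
Qed.

End hull_density.

Section borel_density.
Context (R : realType) (n : nat).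
Local Notation Rn := 'rV[R]_n.
Local Notation LRn := (caratheodory_type (@lebesgue_borel R n)^*%mu).
Local Notation mu := (@lebesgue_rV R n).

(** If [Z] has a Borel left inverse then every Borel set is the preimage of a
    Borel set under [Z]. *)
Lemma pullback_density_eq0 (w : LRn -> R) (Z : LRn -> Rn) (Y : Rn -> Rn) :
  mu.-integrable setT (EFin \o w) -> measurable_fun setT Y -> (forall x : Rn, Y (Z x) = x) ->
  (forall A : set Rn, measurable A -> \int[mu]_x (w x * \1_A (Z x)) = 0) ->
  {ae mu, forall x, w x = 0}.
Proof.
move=> iw mY ZK w0.
apply: (@hull_density_eq0 _ LRn _ mu [set A : set LRn | measurable (A : set Rn)]) => //.
- exact: borel_Lmeasurable.
- move=> A _ Aoo; exact: borel_hull.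
- move=> A mA.
  have mYA : measurable (Y @^-1` A) by rewrite -[X in measurable X]setTI; exact: mY.
  have H := w0 _ mYA; transitivity (\int[mu]_x (w x * \1_(Y @^-1` A) (Z x))) => //.
  apply: eq_Rintegral => x _; congr (_ * _).
  by rewrite -{1}(ZK x).
Qed.
End borel_density.

(** * The kernel and its normalizing constant *)

Section kernel_measurable.
Context (R : realType) (n : nat).
Local Notation Rn := 'rV[R]_n.
Local Notation LRn := (caratheodory_type (@lebesgue_borel R n)^*%mu).
Local Notation mu := (@lebesgue_rV R n).

Lemma measurable_row d (T : measurableType d) (f : T -> Rn) :
  (forall i, measurable_fun setT (fun t => f t ord0 i)) -> measurable_fun setT f.
Proof.
move=> mf; pose g t : n.-tuple (measurableTypeR R) := [tuple f t ord0 i | i < n].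
have mg : measurable_fun setT g.
  by apply/measurable_fun_tnthP => i; rewrite /g /comp; under eq_fun do rewrite tnth_mktuple; exact: mf.
rewrite (_ : f = @row_of_tuple R n \o g).
  by apply: measurableT_comp mg; exact: measurable_row_of_tuple.
by apply/funext => t; apply/rowP => i; rewrite mxE tnth_mktuple.
Qed.

Definition sqn (z : Rn) : R := \sum_i z ord0 i ^+ 2.

Lemma sqn_ge0 z : 0 <= sqn z. Proof. by apply: sumr_ge0 => i _; exact: sqr_ge0. Qed.

Lemma kernelE (s : R) (x y : Rn) : kernel s x y = sqn (x - y) `^ (- ((n%:R + 2 * s) / 2)).
Proof.
by rewrite /kernel /enorm -/(sqn _) -powR12_sqrt ?sqn_ge0// -powRrM powRN mulrC.
Qed.

Lemma kernel_ge0 s (x y : Rn) : 0 <= kernel s x y. Proof. by rewrite kernelE powR_ge0. Qed.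

Lemma kernelC s (x y : Rn) : kernel s x y = kernel s y x.
Proof.
by rewrite !kernelE; congr (_ `^ _); apply: eq_bigr => i _; rewrite !mxE -sqrrN opprB.
Qed.

Context d (T : measurableType d).
Implicit Types f g : T -> LRn.

Lemma measurable_sqnB f g : measurable_fun setT f -> measurable_fun setT g ->
  measurable_fun setT (fun t => sqn ((f t : Rn) - (g t : Rn))).
Proof.
move=> mf mg; apply: measurable_sum => i; apply: measurable_funX.
under eq_fun do rewrite !mxE.
by apply: measurable_funB; apply: measurableT_comp (measurable_coord i) _.
Qed.

Lemma measurable_kernel s f g : measurable_fun setT f -> measurable_fun setT g ->
  measurable_fun setT (fun t => kernel s (f t) (g t)).
Proof.
move=> mf mg; under eq_fun do rewrite kernelE.
apply: (measurableT_comp (@measurable_powR R _)); exact: measurable_sqnB.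
Qed.

End kernel_measurable.

Section norms.
Context (R : realType) (n : nat).
Implicit Types (z : 'rV[R]_n).

Lemma norm_leP z (r : R) : 0 <= r -> `|z| <= r <-> forall i, `|z ord0 i| <= r.
Proof.
move=> r0; have -> : (`|z| <= r) = (mx_norm z <= r) by [].
rewrite mx_normE -[r]/((NngNum r0)%:num) num_le.
split=> [/bigmax_leP[_ H] i|H]; first by have := H (ord0, i) isT; rewrite -num_le.
by apply/bigmax_leP; split => //= -[i j] _ /=; rewrite ord1 -num_le; exact: H.
Qed.

Lemma coord_le_norm z i : `|z ord0 i| <= `|z|.
Proof. by move: i; apply/norm_leP. Qed.

Lemma norm_le_sqn z : `|z| ^+ 2 <= sqn z.
Proof.
have : `|z| <= Num.sqrt (sqn z).
  apply/norm_leP; first exact: sqrtr_ge0.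
  move=> i; rewrite -sqrtr_sqr ler_wsqrtr// /sqn (bigD1 i)//= lerDl.
  by apply: sumr_ge0 => j _; exact: sqr_ge0.
by move=> H; rewrite -[leRHS]sqr_sqrtr ?sqn_ge0// lerXn2r ?nnegrE ?sqrtr_ge0.
Qed.

Lemma sqn_le_norm z : sqn z <= n%:R * `|z| ^+ 2.
Proof.
rewrite /sqn mulr_natl -[X in _ *+ X]card_ord -sumr_const; apply: ler_sum => i _.
by rewrite -real_normK ?num_real// lerXn2r ?nnegrE// coord_le_norm.
Qed.

End norms.

Section kernel_bounds.
Context (R : realType) (n : nat) (s : R).
Hypothesis s0 : 0 < s.
Local Notation Rn := 'rV[R]_n.
Local Notation LRn := (caratheodory_type (@lebesgue_borel R n)^*%mu).
Local Notation mu := (@lebesgue_rV R n).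
Local Notation alpha := (n%:R + 2 * s).

Lemma alpha_gt0 : 0 < alpha :> R.
Proof. by rewrite ltr_wpDl// mulr_gt0. Qed.

Lemma norm_le_enorm (z : Rn) : `|z| <= enorm z.
Proof.
rewrite -[leLHS]ger0_norm// -sqrtr_sqr ler_wsqrtr//; exact: norm_le_sqn.
Qed.

Lemma kernel_le (r : R) (x y : Rn) : 0 < r -> r <= `|x - y| ->
  kernel s x y <= (r `^ alpha)^-1.
Proof.
move=> r0 rxy; rewrite /Defs.kernel lef_pV2 ?posrE ?powR_gt0//; last first.
  by rewrite (lt_le_trans r0)// (le_trans rxy)// norm_le_enorm.
apply: ge0_ler_powR; rewrite ?nnegrE ?sqrtr_ge0 ?(ltW alpha_gt0) ?(ltW r0)//.
exact: le_trans rxy (norm_le_enorm _).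
Qed.

Lemma enorm_le (z : Rn) (r : R) : `|z| <= r -> enorm z <= n%:R * r.
Proof.
move=> zr; have r0 : 0 <= r by exact: le_trans zr.
have H : 0 <= n%:R * r by rewrite mulr_ge0.
rewrite -[leRHS]ger0_norm// -sqrtr_sqr ler_wsqrtr// (le_trans (sqn_le_norm _))//.
case: n z zr H => [|m] z zr H; first by rewrite !mul0r expr0n.
rewrite exprMn ler_pM// ?ler_eXnr ?sqr_ge0 ?lerXn2r ?nnegrE//.
by rewrite ler1n.
Qed.

Lemma kernel_ge (r : R) (x y : Rn) : x != y -> `|x - y| <= r ->
  ((n%:R * r) `^ alpha)^-1 <= kernel s x y.
Proof.
move=> xy xyr; have z0 : 0 < enorm (x - y).
  by apply: lt_le_trans (norm_le_enorm _); rewrite normr_gt0 subr_eq0.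
have := enorm_le xyr => H; have H0 := lt_le_trans z0 H.
rewrite /Defs.kernel lef_pV2 ?posrE ?powR_gt0//.
by apply: ge0_ler_powR; rewrite ?nnegrE ?(ltW alpha_gt0) ?(ltW z0) ?(ltW H0).
Qed.

Lemma kernelxx (x : Rn) : kernel s x x = 0.
Proof.
rewrite /Defs.kernel subrr (_ : enorm 0 = 0) ?powR0 ?invr0 ?gt_eqF ?alpha_gt0//.
by rewrite /enorm big1 ?sqrtr0// => i _; rewrite mxE expr0n.
Qed.

End kernel_bounds.

Section series_bound.
Context d (T : measurableType d) (R : realType) (mu : {measure set T -> \bar R}).

Lemma integral_indic2 (a b : R) (A B : set T) : 0 <= a -> 0 <= b ->
  measurable A -> measurable B ->
  (\int[mu]_y (a * \1_A y + b * \1_B y)%:E = a%:E * mu A + b%:E * mu B)%E.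
Proof.
move=> a0 b0 mA mB; under eq_integral do rewrite EFinD !EFinM.
rewrite ge0_integralD//.
- rewrite !ge0_integralZl_EFin//; try exact/measurable_EFinP/measurable_indic.
  by rewrite !integral_indic// !setIT.
- by move=> y _; rewrite -EFinM lee_fin mulr_ge0.
- by apply/measurable_EFinP; apply: measurable_funM => //; exact: measurable_indic.
- by move=> y _; rewrite -EFinM lee_fin mulr_ge0.
- by apply/measurable_EFinP; apply: measurable_funM => //; exact: measurable_indic.
Qed.

Lemma integral_le_series (f : T -> R) (g : nat -> T -> R) (c : nat -> R) (C : R) :
  (forall y, 0 <= f y) -> measurable_fun setT f ->
  (forall j y, 0 <= g j y) -> (forall j, measurable_fun setT (g j)) ->
  (forall y, exists j, f y <= g j y) ->
  (forall j, (\int[mu]_y (g j y)%:E = (c j)%:E)%E) ->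
  (forall m, \sum_(0 <= j < m) c j <= C) ->
  (\int[mu]_y (f y)%:E <= C%:E)%E.
Proof.
move=> f0 mf g0 mg fg gc cC.
apply: (@le_trans _ _ (\int[mu]_y \sum_(0 <= j <oo) (g j y)%:E)%E).
  apply: ge0_le_integral => //.
  - by move=> y _; rewrite lee_fin.
  - exact/measurable_EFinP.
  - by apply: ge0_emeasurable_sum => [j y _ _|j _]; [rewrite lee_fin|exact/measurable_EFinP].
  - move=> y _; have [j xyj] := fg y.
    apply: le_trans (@nneseries_lim_ge _ _ xpredT 0%N j.+1 _) => [|i _ _]; last by rewrite lee_fin.
    rewrite big_nat_recr//= -[leLHS]add0e leeD ?lee_fin//.
    by apply: sume_ge0 => i _; rewrite lee_fin.
rewrite integral_nneseries//; last 2 first.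
- by move=> j; exact/measurable_EFinP.
- by move=> j y _; rewrite lee_fin.
apply: lime_le; first by apply: is_cvg_nneseries => j _ _; apply: integral_ge0 => y _; rewrite lee_fin.
by apply: nearW => m; under eq_bigr do rewrite gc; rewrite sumEFin lee_fin.
Qed.

End series_bound.

Section kernel_integral.
Context (R : realType) (n : nat) (s : R).
Hypothesis s01 : 0 < s < 1.
Local Notation Rn := 'rV[R]_n.
Local Notation LRn := (caratheodory_type (@lebesgue_borel R n)^*%mu).
Local Notation mu := (@lebesgue_rV R n).
Local Notation alpha := (n%:R + 2 * s).

Let s0 : 0 < s. Proof. by case/andP: s01. Qed.

(** The kernel tamed by the quadratic factor that squared increments of bounded
    Lipschitz functions provide; it has finite mass when [0 < s < 1]. *)
Definition trunc_kernel (x y : Rn) : R := Num.min 1 (sqn (x - y)) * kernel s x y.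

Lemma trunc_kernel_ge0 x y : 0 <= trunc_kernel x y.
Proof. by rewrite mulr_ge0 ?kernel_ge0// le_min ler01 sqn_ge0. Qed.

Lemma measurable_trunc_kernel d (T : measurableType d) (f g : T -> LRn) :
  measurable_fun setT f -> measurable_fun setT g ->
  measurable_fun setT (fun t => trunc_kernel (f t) (g t)).
Proof.
move=> mf mg; apply: measurable_funM; last exact: measurable_kernel.
by apply: measurable_minr => //; exact: measurable_sqnB.
Qed.

Let Q : R := 2 `^ alpha.
Let t : R := 2 `^ (2 * s).

Let QE : Q = 2 ^+ n * t.
Proof. by rewrite /Q powRD ?powR_mulrn//; apply/implyP => _; rewrite pnatr_eq0. Qed.

Let t1 : 1 < t.
Proof. by rewrite /t /powR pnatr_eq0/= expR_gt1 mulr_gt0 ?ln_gt0 ?ltr1n// mulr_gt0. Qed.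

Let t4 : t < 4.
Proof.
have -> : 4 = 2 `^ 2 :> R by rewrite -[X in _ `^ X]/(2%:R) powR_mulrn// -natrX.
rewrite /t /powR pnatr_eq0/= ltr_expR ltr_pM2r ?ln_gt0 ?ltr1n//.
by case/andP: s01 => _ H; lra.
Qed.

Let Q0 : 0 < Q. Proof. exact: powR_gt0. Qed.

Let powRX (a : R) m : 0 <= a -> (a ^+ m) `^ alpha = (a `^ alpha) ^+ m.
Proof. by move=> a0; rewrite -powR_mulrn// -powRrM mulrC powRrM powR_mulrn// powR_ge0. Qed.

Let A j : R := n%:R * (4^-1) ^+ j * Q ^+ j.+1.
Let B j : R := (Q^-1) ^+ j.

Let A0 j : 0 <= A j.
Proof. by rewrite !mulr_ge0 ?exprn_ge0// ltW. Qed.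

Let B0 j : 0 <= B j.
Proof. by rewrite exprn_ge0 ?invr_ge0 ?ltW. Qed.

Let shell (x y : Rn) (j : nat) : R :=
  A j * \1_(ball x (2^-1 ^+ j)) y + B j * \1_(ball x (2 ^+ j.+1)) y.

Let ballP (x y : Rn) (r : R) : ball x r y = (`|x - y| < r) :> Prop.
Proof. by rewrite -ball_normE. Qed.

Let indic_ball (x y : Rn) (r : R) : `|x - y| < r -> \1_(ball x r) y = 1 :> R.
Proof. by move=> xyr; rewrite indicE mem_set// ballP. Qed.

(** Dyadic shells: on [2^-(j+1) <= |x - y| < 2^-j] the tamed kernel is bounded by
    [A j], and on [2^j <= |x - y| < 2^(j+1)] by [B j]. *)
Let trunc_kernel_le_shell x y : exists j, trunc_kernel x y <= shell x y j.
Proof.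
have [->|xy] := eqVneq x y.
  exists 0%N; rewrite /trunc_kernel kernelxx// mulr0 addr_ge0// mulr_ge0// indicE//.
have r0 : 0 < `|x - y| by rewrite normr_gt0 subr_eq0.
have sq2 : sqn (x - y) <= n%:R * `|x - y| ^+ 2 by exact: sqn_le_norm.
have [r1|r1] := ltP `|x - y| 1.
- have exj : exists j, 2^-1 ^+ j.+1 <= `|x - y|.
    have : (geometric 1 (2^-1 : R)) @ \oo --> (0 : R).
      by apply: cvg_geometric; rewrite gtr0_norm ?invr_gt0// invf_lt1// ltr1n.
    move/cvgrPdist_lt => /(_ _ r0)[j _ /(_ j.+1 (leqnSn _))].
    rewrite sub0r normrN /= mul1r => H; exists j; apply/ltW/(le_lt_trans _ H).
    by rewrite ler_norm.
  case: (ex_minnP exj) => j jr jmin; exists j.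
  have rj : `|x - y| < 2^-1 ^+ j.
    case: j jr jmin => [|j] jr jmin; first by rewrite expr0.
    by rewrite ltNge; apply/negP => /jmin; rewrite ltnn.
  rewrite /shell (indic_ball rj) mulr1.
  apply: (@le_trans _ _ (A j)); last by rewrite lerDl mulr_ge0.
  apply: ler_pM; rewrite ?kernel_ge0 ?le_min ?ler01 ?sqn_ge0//.
    rewrite ge_min; apply/orP; right; apply: le_trans sq2 _.
    rewrite ler_wpM2l// (_ : 4^-1 ^+ j = (2^-1 ^+ j) ^+ 2).
      by rewrite lerXn2r ?nnegrE ?exprn_ge0 ?invr_ge0// ltW.
    by rewrite -exprM mulnC exprM expr2 -invfM -natrM.
  apply: le_trans (kernel_le s0 _ jr) _; first by rewrite exprn_gt0// invr_gt0.
  by rewrite powRX ?invr_ge0// -exprVn -powRN -powR_inv1// -powRrM mulN1r opprK.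
- have exj : exists j, `|x - y| < 2 ^+ j.+1.
    exists (Num.bound `|x - y|); apply: lt_trans (archi_boundP _) _ => //.
    by rewrite -natrX ltr_nat (ltn_trans (ltn_expl _ (ltnSn 1)))// ltn_exp2l.
  case: (ex_minnP exj) => j jr jmin; exists j.
  have rj : 2 ^+ j <= `|x - y|.
    case: j jr jmin => [|j] jr jmin; first by rewrite expr0.
    by rewrite leNgt; apply/negP => /jmin; rewrite ltnn.
  rewrite /shell (indic_ball jr) mulr1.
  apply: (@le_trans _ _ (B j)); last by rewrite lerDr mulr_ge0.
  rewrite -[leRHS]mul1r; apply: ler_pM; rewrite ?kernel_ge0 ?le_min ?ler01 ?sqn_ge0 ?ge_min ?lexx//.
  apply: le_trans (kernel_le s0 _ rj) _; first by rewrite exprn_gt0.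
  by rewrite powRX// /B exprVn.
Qed.

(** The sums of the two geometric series of ratios [2^(2s) / 4] and [2^(-2s)]
    given by the small and the large shells. *)
Definition trunc_kernel_cst : R := n%:R * 2 ^+ n * Q / (1 - t / 4) + 4 ^+ n / (1 - t^-1).

Let int_shell x j : (\int[mu]_y (shell x y j)%:E =
  (geometric (n%:R * 2 ^+ n * Q) (t / 4) j + geometric (4 ^+ n) (t^-1) j)%:E)%E.
Proof.
have mB (r : R) : measurable (ball x r : set LRn).
  by apply: borel_Lmeasurable; apply: open_measurable_rV; exact: ball_open.
rewrite /shell integral_indic2//.
have r1 : 0 < 2^-1 ^+ j :> R by rewrite exprn_gt0// invr_gt0.
have r2 : 0 < 2 ^+ j.+1 :> R by rewrite exprn_gt0.
transitivity ((A j)%:E * ((2 * 2^-1 ^+ j) ^+ n)%:E + (B j)%:E * ((2 * 2 ^+ j.+1) ^+ n)%:E)%E.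
  by congr (_ * _ + _ * _)%E; exact: lebesgue_ball.
rewrite -!EFinM -EFinD; congr EFin.
have nt : t != 0 by rewrite gt_eqF// (lt_trans _ t1).
have n2 (m : nat) : 2 ^+ m != 0 :> R by rewrite gt_eqF// exprn_gt0.
congr (_ + _); rewrite /A /B /geometric/=.
  rewrite QE exprS !exprMn !exprVn -!exprM (mulnC n j).
  have n4 : 4 ^+ j != 0 :> R by rewrite gt_eqF// exprn_gt0.
  have := n2 (j * n)%N; move: (2 ^+ n) (2 ^+ (j * n)) (4 ^+ j) n4 => a b c a0 b0; field.
  by rewrite b0 a0.
rewrite QE exprS mulrA -natrM exprMn -exprM !exprVn exprMn -exprM (mulnC n j).
have tj : t ^+ j != 0 by rewrite expf_neq0.
by field; rewrite tj n2.
Qed.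

Lemma trunc_kernel_int x : (\int[mu]_y (trunc_kernel x y)%:E <= trunc_kernel_cst%:E)%E.
Proof.
have mB (r : R) : measurable (ball x r : set LRn).
  by apply: borel_Lmeasurable; apply: open_measurable_rV; exact: ball_open.
apply: (@integral_le_series _ LRn _ mu _ (fun j y => shell x y j) _ _ _ _ _ _ _ (int_shell x)).
- by move=> y; exact: trunc_kernel_ge0.
- by apply: measurable_trunc_kernel; [exact: measurable_cst|exact: measurable_id].
- by move=> j y; rewrite addr_ge0// mulr_ge0// indicE.
- move=> j; apply: measurable_funD; apply: measurable_funM; first exact: measurable_cst.
  + exact: measurable_indic.
  + exact: measurable_cst.
  + exact: measurable_indic.
- by move=> y; exact: trunc_kernel_le_shell.
move=> m; rewrite big_split/=.
have geo (a z : R) : 0 <= a -> 0 <= z < 1 -> \sum_(0 <= j < m) geometric a z j <= a / (1 - z).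
  move=> a0 /andP[z0 z1]; have := @geometric_seriesE R a z.
  rewrite lt_eqF// => /(_ isT) /(congr1 (fun f => f m)); rewrite /series/= => ->.
  rewrite ler_wpM2r ?invr_ge0 ?subr_ge0 ?(ltW z1)// ler_piMr// gerBl exprn_ge0//.
have t0 : 0 < t by exact: lt_trans t1.
rewrite /trunc_kernel_cst lerD// geo//.
- by rewrite !mulr_ge0 ?exprn_ge0// ltW.
- by rewrite divr_ge0 ?(ltW t0)//= ltr_pdivrMr// mul1r.
- by rewrite invr_ge0 (ltW t0) invf_lt1.
Qed.

End kernel_integral.

Section integral_lower_bound.
Context d (T : measurableType d) (R : realType) (mu : {measure set T -> \bar R}).

Lemma measurable_funZ (D : set T) (f : T -> R) (k : R) : measurable_fun D f ->
  measurable_fun D (fun x => k * f x).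
Proof. by move=> mf; apply: measurable_funM. Qed.

Lemma integral_ge_cst (f : T -> R) (A : set T) (c : R) : measurable A ->
  measurable_fun setT f -> (forall y, 0 <= f y) -> 0 <= c -> (forall y, A y -> c <= f y) ->
  (c%:E * mu A <= \int[mu]_y (f y)%:E)%E.
Proof.
move=> mA mf f0 c0 cf; rewrite -(setIT A) -(integral_indic mu measurableT mA).
rewrite -ge0_integralZl_EFin//; last exact/measurable_EFinP/measurable_indic.
apply: ge0_le_integral => //.
- by move=> x _; rewrite mule_ge0// lee_fin.
- by apply: measurable_funeM; exact/measurable_EFinP/measurable_indic.
- exact/measurable_EFinP.
- move=> x _; rewrite -EFinM lee_fin indicE.
  have [Ax|Ax] := pselect (A x); first by rewrite mem_set// mulr1 cf.
  by rewrite memNset// mulr0.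
Qed.

Lemma ge0_le_integral_fin (f g : T -> R) : measurable_fun setT f -> measurable_fun setT g ->
  (forall y, 0 <= f y) -> (forall y, f y <= g y) ->
  (\int[mu]_y (f y)%:E <= \int[mu]_y (g y)%:E)%E.
Proof.
move=> mf mg f0 fg; apply: ge0_le_integral => //.
- by move=> y _; rewrite lee_fin.
- exact/measurable_EFinP.
- exact/measurable_EFinP.
- by move=> y _; rewrite lee_fin.
Qed.

Lemma ge0_integralZ_fin (f : T -> R) (k : R) : measurable_fun setT f ->
  (forall y, 0 <= f y) -> 0 <= k ->
  (\int[mu]_y (k * f y)%:E = k%:E * \int[mu]_y (f y)%:E)%E.
Proof.
move=> mf f0 k0; under eq_integral do rewrite EFinM.
rewrite ge0_integralZl_EFin//; first by move=> y _; rewrite lee_fin.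
exact/measurable_EFinP.
Qed.

Lemma integral_le_scaled (f g : T -> R) (k c : R) : measurable_fun setT f ->
  measurable_fun setT g -> (forall y, 0 <= f y) -> (forall y, 0 <= g y) -> 0 <= k ->
  (forall y, f y <= k * g y) ->
  (\int[mu]_y (g y)%:E <= c%:E -> \int[mu]_y (f y)%:E <= (k * c)%:E)%E.
Proof.
move=> mf mg f0 g0 k0 fg gc.
apply: (@le_trans _ _ (\int[mu]_y (k * g y)%:E)%E).
  by apply: ge0_le_integral_fin => //; exact: measurable_funZ.
by rewrite ge0_integralZ_fin// EFinM lee_wpmul2l// lee_fin.
Qed.

Lemma integrable_ge0 (f : T -> R) : measurable_fun setT f -> (forall y, 0 <= f y) ->
  (\int[mu]_y (f y)%:E < +oo)%E -> mu.-integrable setT (EFin \o f).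
Proof.
move=> mf f0 foo; apply/integrableP; split; first exact/measurable_EFinP.
rewrite (eq_integral (fun y => (f y)%:E))// => y _.
by rewrite gee0_abs// lee_fin.
Qed.

End integral_lower_bound.

Section cns.
Context (R : realType) (n : nat) (s : R).
Hypothesis s01 : 0 < s < 1.
Local Notation Rn := 'rV[R]_n.
Local Notation LRn := (caratheodory_type (@lebesgue_borel R n)^*%mu).
Local Notation mu := (@lebesgue_rV R n).

Lemma sin_le_norm (t : R) : `|sin t| <= `|t|.
Proof.
wlog t0 : t / 0 <= t => [H|].
  have [/H//|/ltW t0] := leP 0 t.
  by rewrite -normrN -sinN -[leRHS]normrN H// oppr_ge0.
have [x _] := @MVT_segment R sin cos 0 t t0 (fun x _ => is_derive_sin x)
   (continuous_subspaceT (@continuous_sin R)).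
by rewrite sin0 !subr0 => ->; rewrite normrM ler_piMl// cos_max.
Qed.

Lemma subr_cos_le (t : R) : 0 <= 1 - cos t <= 2 * Num.min 1 (t ^+ 2).
Proof.
rewrite subr_ge0 cos_le1/= minEle; case: ifP => _; rewrite ?mulr1.
  by have := cos_geN1 t; lra.
have -> : t = (t / 2) *+ 2 by rewrite -mulr_natr divfK// pnatr_eq0.
rewrite cos_mulr2n cos2sin2; have := sin_le_norm (t / 2).
rewrite -(@ler_pXn2r _ 2)// ?nnegrE// !real_normK ?num_real//.
set a := sin _ ^+ 2; set b := t / 2; have := sqr_ge0 b.
have -> : (b *+ 2) ^+ 2 = 4 * b ^+ 2 by ring.
by rewrite mulr2n; lra.
Qed.

(** The defining integral is finite since [1 - cos t <= 2 min(1, t^2)], and it is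
    positive since its integrand is bounded below on a ball. *)
Lemma cns_gt0 : (0 < n)%N -> 0 < @cns R n s.
Proof.
move=> n0; have s0 : 0 < s by case/andP: s01.
rewrite /cns invr_gt0.
pose f (z : LRn) : R := (1 - cos (coord1 z)) * kernel s z 0.
pose i0 : 'I_n := Ordinal n0.
have c1 (z : Rn) : coord1 z = z ord0 i0.
  rewrite /coord1 (bigD1 i0)//= big1 ?addr0// => i /andP[/eqP vi /eqP ni].
  by exfalso; apply: ni; apply/val_inj.
have f0 z : 0 <= f z.
  by rewrite mulr_ge0 ?kernel_ge0//; have /andP[] := subr_cos_le (coord1 z).
have mc1 : measurable_fun (setT : set LRn) (@coord1 R n).
  by rewrite (_ : @coord1 R n = (fun z : Rn => z ord0 i0)); [exact: measurable_coord|exact/funext].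
have mf : measurable_fun setT f.
  apply: measurable_funM; last by apply: measurable_kernel; [exact: measurable_id|exact: measurable_cst].
  apply: measurable_funB; first exact: measurable_cst.
  by apply: measurableT_comp mc1; apply: continuous_measurable_fun; exact: continuous_cos.
have fle z : f z <= 2 * trunc_kernel s 0 z.
  rewrite /f /trunc_kernel mulrA kernelC; apply: ler_wpM2r; first exact: kernel_ge0.
  have /andP[_] := subr_cos_le (coord1 z); move/le_trans; apply.
  rewrite ler_wpM2l// le_min ge_min lexx/= ge_min; apply/orP; right.
  rewrite c1 /sqn (bigD1 i0)//= sub0r [in leRHS]mxE sqrrN lerDl.
  by apply: sumr_ge0 => i _; exact: sqr_ge0.
have mtk : measurable_fun (setT : set LRn) (fun z : LRn => trunc_kernel s 0 z).
  by apply: measurable_trunc_kernel; [exact: measurable_cst|exact: measurable_id].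
have foo : (\int[mu]_z (f z)%:E < +oo)%E.
  apply: (le_lt_trans _ (ltry (2 * trunc_kernel_cst n s))).
  exact: (@integral_le_scaled _ LRn _ mu f (fun z => trunc_kernel s 0 z) 2 _ mf mtk f0
    (fun z => trunc_kernel_ge0 s 0 z) (ler0n R 2) fle (trunc_kernel_int s01 0)).
apply: fine_gt0; rewrite foo andbT.
pose z1 : Rn := const_mx 1.
pose c := (1 - cos 2^-1) * ((n%:R * (3 / 2)) `^ (n%:R + 2 * s))^-1 : R.
have pi2 : 2 <= (pi : R) by exact: pi_ge2.
have c0 : 0 < c.
  rewrite mulr_gt0// ?invr_gt0 ?powR_gt0 ?mulr_gt0 ?ltr0n//.
  by rewrite subr_gt0 -[ltRHS]cos0 ltr_cos ?in_itv/= ?lexx//; lra.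
have H := @integral_ge_cst _ LRn _ mu f (ball z1 2^-1) c _ mf f0 (ltW c0) _.
apply: lt_le_trans (H _ _).
- have h0 : 0 < 2^-1 :> R by rewrite invr_gt0.
  rewrite [ltRHS](congr1 (fun X => c%:E * X)%E (@lebesgue_ball R n z1 _ h0)).
  by rewrite -EFinM lte_fin mulr_gt0// exprn_gt0// mulr_gt0.
- by apply: borel_Lmeasurable; apply: open_measurable_rV; exact: ball_open.
- move=> y [_ yz]; have {}yz i : 2^-1 < y ord0 i < 3 / 2.
    have := yz ord0 i; rewrite /ball/= mxE ltr_distlC; lra.
  have y0 := yz i0.
  rewrite /c /f ler_pM//.
  + by rewrite lerD2l lerN2 c1; apply/ltW; rewrite ltr_cos ?in_itv/=; lra.
  + apply: kernel_ge => //.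
      apply/eqP => y00; have := y0; rewrite y00 mxE; lra.
    rewrite subr0; apply/norm_leP => // i; have := yz i.
    by rewrite ler_norml; lra.
Qed.

End cns.

(** * Riesz potentials and unique continuation *)

Section riesz_kernels.
Context (R : realType) (n : nat).
Local Notation Rn := 'rV[R]_n.
Implicit Types (a : 'I_n -> nat) (b : R) (z x y : Rn) (i j : 'I_n).

(** The monomial of exponent [a] times the power [- 2 b] of the Euclidean norm;
    the class of these functions is stable under partial derivatives. *)
Definition riesz b a z : R := (\prod_i z ord0 i ^+ a i) * sqn z `^ (- b).

Definition setexp a i (m : nat) : 'I_n -> nat := fun j => if j == i then m else a j.

Definition deg a : nat := (\sum_i a i)%N.

Lemma deg_setexp a i m : (deg (setexp a i m) + a i = deg a + m)%N.
Proof.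
rewrite /deg (bigD1 i)//= [in RHS](bigD1 i)//= /setexp eqxx.
rewrite (eq_bigr a); first lia.
by move=> j /negbTE ->.
Qed.

Lemma prod_setexp a i m z : \prod_j z ord0 j ^+ setexp a i m j =
  z ord0 i ^+ m * \prod_(j | j != i) z ord0 j ^+ a j.
Proof.
rewrite (bigD1 i)//= /setexp eqxx; congr (_ * _).
by apply: eq_bigr => j /negbTE ->.
Qed.

Lemma setexp_id a i : setexp a i (a i) = a.
Proof. by apply/funext => j; rewrite /setexp; case: eqP => [->|]. Qed.

Lemma sqn_gt0 z : z != 0 -> 0 < sqn z.
Proof.
by move=> z0; apply: lt_le_trans (norm_le_sqn z); rewrite exprn_gt0// normr_gt0.
Qed.

(** The partial derivative of [riesz b a] in direction [i]. *)
Definition riesz' b a i z : R :=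
  (a i)%:R * riesz b (setexp a i (a i).-1) z -
  2 * b * riesz (b + 1) (setexp a i (a i).+1) z.

Lemma is_derive_riesz b a i z t : z + t *: delta_mx ord0 i != 0 ->
  is_derive t 1 (fun t : R => riesz b a (z + t *: delta_mx ord0 i))
    (riesz' b a i (z + t *: delta_mx ord0 i)).
Proof.
set e : Rn := delta_mx ord0 i.
pose c := \prod_(j | j != i) z ord0 j ^+ a j.
pose rho := \sum_(j | j != i) z ord0 j ^+ 2.
have zi u : (z + u *: e) ord0 i = z ord0 i + u by rewrite !mxE !eqxx mulr1.
have zj u j : j != i -> (z + u *: e) ord0 j = z ord0 j.
  by move=> /negbTE ji; rewrite !mxE ji andbF mulr0 addr0.
have sqE u : sqn (z + u *: e) = rho + (z ord0 i + u) ^+ 2.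
  rewrite /sqn (bigD1 i)//= zi addrC; congr (_ + _).
  by apply: eq_bigr => j ji; rewrite zj.
have cE u : \prod_(j | j != i) (z + u *: e) ord0 j ^+ a j = c.
  by apply: eq_bigr => j ji; rewrite zj.
have rE b' m u : riesz b' (setexp a i m) (z + u *: e) =
    c * ((z ord0 i + u) ^+ m * (rho + (z ord0 i + u) ^+ 2) `^ (- b')).
  by rewrite /riesz prod_setexp cE sqE zi mulrCA mulrA.
move=> /sqn_gt0; rewrite sqE => q0.
rewrite (_ : (fun u => _) = (fun u => c * ((z ord0 i + u) ^+ a i *
   (rho + (z ord0 i + u) ^+ 2) `^ (- b)))); last first.
  by apply/funext => u; rewrite -[in LHS](setexp_id a i) rE.
rewrite /riesz' !rE.
set tau := z ord0 i + t in q0 *.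
have D1 : is_derive t 1 (fun u : R => z ord0 i + u) 1.
  by apply: (is_derive_eq (is_deriveD (is_derive_cst (z ord0 i) t 1) (is_derive_id t 1))); rewrite add0r.
have D2 m : is_derive t 1 (fun u : R => (z ord0 i + u) ^+ m) (m%:R * tau ^+ m.-1).
  have := @is_deriveX _ _ (fun u : R => z ord0 i + u) m t 1 1 D1.
  by rewrite exprfctE => H; apply: (is_derive_eq H); rewrite /GRing.scale/= mulr1.
have D3 : is_derive t 1 (fun u : R => rho + (z ord0 i + u) ^+ 2) (2 * tau).
  have := D2 2%N; rewrite /= expr1 => D2'.
  by apply: (is_derive_eq (is_deriveD (is_derive_cst rho t 1) D2')); rewrite add0r.
have D4 : is_derive t 1 (fun u : R => (rho + (z ord0 i + u) ^+ 2) `^ (- b))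
    (- b * (rho + tau ^+ 2) `^ (- b - 1) * (2 * tau)).
  have D5 := @is_derive1_powR R (- b) _ q0.
  have := @is_derive1_comp R (fun q => q `^ (- b)) (fun u : R => rho + (z ord0 i + u) ^+ 2) t _ _ D5 D3.
  by rewrite mulrC.
have D6 := is_deriveM (D2 (a i)) D4.
have D7 := is_deriveM (is_derive_cst c t 1) D6.
apply: (is_derive_eq D7); rewrite /GRing.scale/= opprD.
rewrite -/tau; case: (a i) => [|m] /=; rewrite ?mul0r ?expr0 ?exprSr; ring.
Qed.

End riesz_kernels.

Section riesz_potential.
Context d (T : measurableType d) (R : realType) (mu : {measure set T -> \bar R}) (n : nat).
Local Notation Rn := 'rV[R]_n.
Variables (e : T -> Rn) (v : T -> R) (x0 : Rn) (r gam : R).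
Hypotheses (me : forall i, measurable_fun setT (fun y => e y ord0 i)).
Hypothesis r0 : 0 < r.
Hypothesis gam0 : 0 < gam.
Hypothesis hv : forall y, v y != 0 -> 2 * r <= `|x0 - e y|.
Hypothesis mv : measurable_fun setT v.
Hypothesis iv : mu.-integrable setT (EFin \o (fun y => v y * sqn (x0 - e y) `^ (- gam))).
Implicit Types (a : 'I_n -> nat) (b : R) (z x : Rn) (i : 'I_n).

Let norm_prod_le a z : `|\prod_i z ord0 i ^+ a i| <= sqn z `^ ((deg a)%:R / 2).
Proof.
have -> : sqn z `^ ((deg a)%:R / 2) = \prod_i (enorm z ^+ a i).
  rewrite prodrXr -/(deg a) mulrC powRrM powR12_sqrt ?sqn_ge0// powR_mulrn// sqrtr_ge0.
rewrite normr_prod; apply: ler_prod => i _; rewrite normr_ge0/= normrX.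
rewrite lerXn2r ?nnegrE ?sqrtr_ge0//; apply: le_trans (norm_le_enorm z).
exact: coord_le_norm.
Qed.

Let far x y : ball x0 r x -> v y != 0 ->
  r <= `|x - e y| /\ `|x0 - e y| <= 2 * `|x - e y|.
Proof.
rewrite -ball_normE/= => xr vy; have := hv vy.
have : `|x0 - e y| <= `|x0 - x| + `|x - e y| by exact: ler_distD.
by move: xr; lra.
Qed.

(** As seen from the ball, the support of [v] is far and [|x - y|] is comparable
    to [|x0 - y|], so a single integrability hypothesis dominates all the kernels
    that decay at least as fast as [|z|^(-2 gam)]. *)
Lemma riesz_bound b a : gam + (deg a)%:R / 2 <= b ->
  exists C, forall x y, ball x0 r x -> v y != 0 ->
    `|riesz b a (x - e y)| <= C * sqn (x0 - e y) `^ (- gam).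
Proof.
move=> ab; pose k := b - gam - (deg a)%:R / 2; pose N : R := 4 * n.+1%:R.
have N0 : 0 < N by rewrite mulr_gt0.
exists ((r ^+ 2) `^ (- k) * N `^ gam) => x y xr vy.
have [rxy xy2] := far xr vy.
set z := x - e y in rxy xy2 *; set z0 := x0 - e y in xy2 *.
have r20 : 0 < r ^+ 2 by rewrite exprn_gt0.
have rq : r ^+ 2 <= sqn z.
  by apply: le_trans (norm_le_sqn z); rewrite lerXn2r ?nnegrE// ltW.
have q0 : 0 < sqn z by exact: lt_le_trans rq.
have qN : sqn z0 <= N * sqn z.
  apply: le_trans (sqn_le_norm z0) _.
  apply: (@le_trans _ _ (n.+1%:R * (2 * `|z|) ^+ 2)).
    by rewrite ler_pM ?sqr_ge0// ?ler_nat// lerXn2r ?nnegrE ?mulr_ge0.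
  rewrite /N exprMn mulrA [n.+1%:R * _]mulrC -natrX -/(4%N)%:R.
  by rewrite ler_pM2l ?mulr_gt0// norm_le_sqn.
have z0q : 0 < sqn z0.
  apply: sqn_gt0; rewrite -normr_gt0; apply: lt_le_trans (hv vy).
  by rewrite mulr_gt0.
have HN : sqn z `^ (- gam) <= N `^ gam * sqn z0 `^ (- gam).
  rewrite !powRN -ler_pdivrMr ?invr_gt0 ?powR_gt0// invrK mulrC.
  rewrite ler_pdivrMr ?powR_gt0// -powRM ?(ltW N0) ?(ltW q0)//.
  by apply: ge0_ler_powR; rewrite ?nnegrE ?(ltW gam0) ?(ltW z0q)// ltW// mulr_gt0.
have Hk : sqn z `^ (- k) <= (r ^+ 2) `^ (- k).
  rewrite !powRN lef_pV2 ?posrE ?powR_gt0//.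
  by apply: ge0_ler_powR; rewrite ?nnegrE ?(ltW r20) ?(ltW q0)// /k; lra.
rewrite /riesz normrM (ger0_norm (powR_ge0 _ _)).
apply: le_trans (ler_wpM2r (powR_ge0 _ _) (norm_prod_le a z)) _.
rewrite -powRD; last by apply/implyP => _; rewrite gt_eqF.
have -> : (deg a)%:R / 2 - b = - k + - gam by rewrite /k; ring.
rewrite powRD; last by apply/implyP => _; rewrite gt_eqF.
by rewrite -mulrA; apply: ler_pM => //; exact: powR_ge0.
Qed.

Let me_sub x i : measurable_fun setT (fun y => (x - e y) ord0 i).
Proof. by under eq_fun do rewrite !mxE; exact: measurable_funB. Qed.

Lemma measurable_riesz b a x : measurable_fun setT (fun y => riesz b a (x - e y)).
Proof.
apply: measurable_funM.
  by apply: measurable_prod => i _; exact: measurable_funX.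
apply: (measurableT_comp (@measurable_powR R _)).
by apply: measurable_sum => i; exact: measurable_funX.
Qed.

Lemma integrable_riesz b a x : ball x0 r x -> gam + (deg a)%:R / 2 <= b ->
  mu.-integrable setT (EFin \o (fun y => v y * riesz b a (x - e y))).
Proof.
move=> xr /riesz_bound[C HC].
apply: (@integrable_dominated _ _ _ _ _
   (fun y => `|C| * `|v y * sqn (x0 - e y) `^ (- gam)|)).
- by apply: measurable_funM => //; exact: measurable_riesz.
- by apply: RintegrableZl => //; exact: integrable_norm.
move=> y; have [->|vy] := eqVneq (v y) 0; first by rewrite !mul0r normr0 mulr0.
rewrite [leLHS]normrM [X in _ <= _ * X]normrM mulrCA ler_wpM2l//.
apply: le_trans (HC _ _ xr vy) _; rewrite (ger0_norm (powR_ge0 _ _)).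
by rewrite ler_wpM2r ?powR_ge0// ler_norm.
Qed.

(** The potential of [v] for the kernel [riesz b a]; the measure space is abstract
    and [e] embeds it into row vectors. *)
Definition pot b a x : R := \int[mu]_y (v y * riesz b a (x - e y)).

(** Differentiating a constant potential under the integral in direction [i]. *)
Lemma pot_const_derive b a c : gam + (deg a)%:R / 2 <= b ->
  (forall x, ball x0 r x -> pot b a x = c) ->
  forall i x, ball x0 r x ->
    (a i)%:R * pot b (setexp a i (a i).-1) x = 2 * b * pot (b + 1) (setexp a i (a i).+1) x.
Proof.
move=> ab cE i x xr.
pose ei : Rn := delta_mx ord0 i.
have a1 : gam + (deg (setexp a i (a i).-1))%:R / 2 <= b.
  apply: le_trans ab; rewrite lerD2l ler_pM2r// ler_nat.
  have := deg_setexp a i (a i).-1; lia.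
have a2 : gam + (deg (setexp a i (a i).+1))%:R / 2 <= b + 1.
  have -> : deg (setexp a i (a i).+1) = (deg a).+1 by have := deg_setexp a i (a i).+1; lia.
  by rewrite -natr1; move: ab; lra.
have [C1 HC1] := riesz_bound a1; have [C2 HC2] := riesz_bound a2.
have [del del0 xdel] : exists2 del : R, 0 < del & forall t : R, `|t| < del -> ball x0 r (x + t *: ei).
  move: (xr); rewrite -ball_normE/= => xr'; exists (r - `|x0 - x|); first by rewrite subr_gt0.
  move=> t tr; rewrite opprD addrA.
  apply: le_lt_trans (ler_normB _ _) _; rewrite normrZ.
  have -> : `|ei| = 1 :> R.
    apply/eqP; rewrite eq_le; apply/andP; split.
      by apply/norm_leP => // j; rewrite mxE; case: andP; rewrite ?normr1 ?normr0.
    by rewrite -[leLHS](@normr1 R); have := coord_le_norm ei i; rewrite mxE !eqxx.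
  by rewrite mulr1; move: tr; lra.
pose f (t : R) y := v y * riesz b a (x + t *: ei - e y).
pose df (t : R) y := v y * riesz' b a i (x + t *: ei - e y).
have shift (t : R) y : x + t *: ei - e y = x - e y + t *: ei by rewrite addrAC.
have fD (t : R) y : `|t| < del -> is_derive t 1 (f^~ y) (df t y).
  move=> tdel; rewrite /f /df; have [->|vy] := eqVneq (v y) 0.
    rewrite mul0r (_ : (fun u => _) = cst 0); first exact: is_derive_cst.
    by apply/funext => u; rewrite mul0r.
  have nz : x - e y + t *: ei != 0.
    have [H _] := far (xdel _ tdel) vy.
    by rewrite -normr_gt0 -shift (lt_le_trans r0 H).
  have D := is_derive_riesz b a nz.
  have D7 := is_deriveM (is_derive_cst (v y) t 1) D.
  rewrite (_ : (fun u => _) = cst (v y) * (fun u : R => riesz b a (x - e y + u *: ei))); last first.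
    by apply/funext => u; rewrite shift.
  by apply: (is_derive_eq D7); rewrite /GRing.scale/= mulr0 addr0 shift.
pose G y := (`|(a i)%:R * C1| + `|2 * b * C2|) * `|v y * sqn (x0 - e y) `^ (- gam)|.
have dfG (t : R) y : `|t| < del -> `|df t y| <= G y.
  move=> tdel; rewrite /df /G; have [->|vy] := eqVneq (v y) 0.
    by rewrite !mul0r normr0 mulr0.
  rewrite [leLHS]normrM [X in _ <= _ * X]normrM mulrCA ler_wpM2l// (ger0_norm (powR_ge0 _ _)).
  have xt := xdel _ tdel; rewrite /riesz'.
  apply: le_trans (ler_normB _ _) _; rewrite [leRHS]mulrDl; apply: lerD.
    rewrite [leLHS]normrM [X in _ <= X * _]normrM -mulrA ler_wpM2l//; apply: le_trans (HC1 _ _ xt vy) _.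
    by rewrite ler_wpM2r ?powR_ge0// ler_norm.
  rewrite [leLHS]normrM [X in _ <= X * _]normrM -mulrA ler_wpM2l//; apply: le_trans (HC2 _ _ xt vy) _.
  by rewrite ler_wpM2r ?powR_ge0// ler_norm.
have itv (t : R) : `](- del), del[%classic t -> `|t| < del by rewrite /= in_itv/= ltr_norml.
have d0 : `](- del), del[%classic (0 : R) by rewrite /= in_itv/= del0 oppr_lt0 del0.
have p1 (t : R) y : `|t| < del -> partial1of2 f t y = df t y.
  by move=> tdel; have := fD t y tdel; rewrite /partial1of2 derive1E => /@derive_val.
have iG : mu.-integrable setT (EFin \o G).
  by apply: RintegrableZl => //; exact: integrable_norm.
have G0 y : 0 <= G y by rewrite mulr_ge0// addr_ge0.
have if_ (t : R) : `](- del), del[%classic t -> mu.-integrable setT (EFin \o f t).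
  by move=> /itv tdel; apply: integrable_riesz => //; exact: xdel.
have D (t : R) y : `](- del), del[%classic t -> setT y -> derivable (f^~ y) t 1.
  by move=> /itv tdel _; have [] := fD t y tdel.
have HG (t : R) y : `](- del), del[%classic t -> setT y -> `|partial1of2 f t y| <= G y.
  by move=> /itv tdel _; rewrite p1//; exact: dfG.
have := @cvg_differentiation_under_integral R _ T mu f setT measurableT 0 (- del) del d0
  if_ D G G0 iG HG.
have -> : \int[mu]_(y in setT) partial1of2 f 0 y =
    (a i)%:R * pot b (setexp a i (a i).-1) x - 2 * b * pot (b + 1) (setexp a i (a i).+1) x.
  transitivity (\int[mu]_y ((a i)%:R * (v y * riesz b (setexp a i (a i).-1) (x - e y)) -
     2 * b * (v y * riesz (b + 1) (setexp a i (a i).+1) (x - e y)))).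
    apply: eq_Rintegral => y _; rewrite p1 ?normr0// /df /riesz' scale0r addr0; ring.
  rewrite RintegralB//; last 2 first.
  - by apply: RintegrableZl => //; exact: integrable_riesz.
  - by apply: RintegrableZl => //; exact: integrable_riesz.
  by rewrite !RintegralZl//; exact: integrable_riesz.
have Ef (h : R) : `|h| < del -> \int[mu]_y f h y = c by move=> /xdel/cE.
move=> H; apply/eqP; rewrite -subr_eq0; apply/eqP.
apply: (cvg_unique (@Rhausdorff R) H).
apply: cvg_near_cst; apply: (@filterS _ _ _ (fun h => `|h| < del)).
  move=> h hdel; rewrite addr0 /=.
  transitivity (h^-1 *: (c - c)); last by rewrite subrr scaler0.
  by congr (_ *: (_ - _)); [exact: Ef|apply: Ef; rewrite normr0].
have : \forall h \near (0 : R), `|h| < del.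
  by exists del => //= h; rewrite /= sub0r normrN.
by apply: cvg_within.
Qed.


Lemma deg0 : @deg n (fun=> 0%N) = 0%N.
Proof. by rewrite /deg big1. Qed.

(** The Laplacian of [|z|^(-2b)] is [2b (2b + 2 - n) |z|^(-2b-2)]. *)
Lemma pot_laplacian b c : n%:R < 2 * gam + 2 -> gam <= b ->
  (forall x, ball x0 r x -> pot b (fun=> 0%N) x = c) ->
  forall x, ball x0 r x -> pot (b + 1) (fun=> 0%N) x = 0.
Proof.
move=> ngam gb cE x xr.
pose a0 : 'I_n -> nat := fun=> 0%N.
have D1 i : forall x', ball x0 r x' -> pot (b + 1) (setexp a0 i 1) x' = 0.
  move=> x' xr'; have := @pot_const_derive b a0 c _ cE i x' xr'.
  rewrite deg0 mul0r addr0 mul0r => /(_ gb)/esym/eqP.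
  rewrite !mulf_eq0 pnatr_eq0/= => /orP[|/eqP//].
  by move=> /eqP b0; move: gb; rewrite b0 leNgt gam0.
have D2 i : pot (b + 1) a0 x = 2 * (b + 1) * pot (b + 2) (setexp a0 i 2) x.
  have di : deg (setexp a0 i 1) = 1%N.
    by have := deg_setexp a0 i 1; rewrite /a0 deg0 addn0 add0n.
  have := @pot_const_derive (b + 1) (setexp a0 i 1) 0 _ (D1 i) i x xr.
  have -> : b + 1 + 1 = b + 2 by ring.
  have -> : setexp (setexp a0 i 1) i (setexp a0 i 1 i).-1 = a0.
    by apply/funext => j; rewrite /setexp eqxx; case: eqP.
  have -> : setexp (setexp a0 i 1) i (setexp a0 i 1 i).+1 = setexp a0 i 2.
    by apply/funext => j; rewrite /setexp eqxx; case: eqP.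
  have -> : setexp a0 i 1 i = 1%N by rewrite /setexp eqxx.
  by rewrite di !mul1r; apply; lra.
have S : \sum_i pot (b + 2) (setexp a0 i 2) x = pot (b + 1) a0 x.
  rewrite /pot -Rintegral_sum; last first.
    move=> i; apply: integrable_riesz => //.
    have -> : deg (setexp a0 i 2) = 2%N by have := deg_setexp a0 i 2; rewrite /a0 deg0 addn0 add0n.
    lra.
  apply: eq_Rintegral => y _; rewrite -mulr_sumr.
  have [->|vy] := eqVneq (v y) 0; first by rewrite !mul0r.
  have [rxy _] := far xr vy; set z := x - e y.
  have q0 : 0 < sqn z by apply: sqn_gt0; rewrite -normr_gt0; exact: lt_le_trans rxy.
  congr (_ * _); rewrite /riesz -mulr_suml.
  rewrite (eq_bigr (fun i => z ord0 i ^+ 2)); last first.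
    by move=> i _; rewrite prod_setexp big1 ?mulr1// => j _; rewrite expr0.
  rewrite -/(sqn z) big1 ?mul1r; last by move=> j _; rewrite expr0.
  rewrite -[X in X * _](powRr1 (ltW q0)) -powRD; last by apply/implyP => _; rewrite gt_eqF.
  by congr (_ `^ _); ring.
have : n%:R * pot (b + 1) a0 x = 2 * (b + 1) * pot (b + 1) a0 x.
  rewrite -{2}S mulr_sumr -(eq_bigr _ (fun i _ => D2 i)) sumr_const card_ord.
  by rewrite mulr_natl.
move/eqP; rewrite -subr_eq0 -mulrBl mulf_eq0 => /orP[|/eqP//].
by move=> /eqP H; exfalso; lra.
Qed.

(** Iterating the Laplacian raises the exponent while keeping the potential equal
    to 0; the monomials are then obtained one factor at a time by differentiating
    those vanishing potentials. *)
Lemma pot_eq0 c : n%:R < 2 * gam + 2 ->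
  (forall x, ball x0 r x -> pot gam (fun=> 0%N) x = c) ->
  forall m a k, deg a = m -> (m <= k)%N ->
  forall x, ball x0 r x -> pot (gam + 1 + k%:R) a x = 0.
Proof.
move=> ngam cE.
have P0 k : forall x, ball x0 r x -> pot (gam + 1 + k%:R) (fun=> 0%N) x = 0.
  elim: k => [|k IH] x xr.
    by rewrite addr0; apply: (pot_laplacian _ _ cE).
  rewrite -natr1 addrA; apply: (pot_laplacian _ _ IH) => //.
  by have : 0 <= k%:R :> R by []; lra.
elim/ltn_ind => -[|m] IH a k am mk x xr.
  have -> : a = (fun=> 0%N).
    apply/funext => i; apply/eqP; rewrite -leqn0 -am.
    by rewrite /deg (bigD1 i)//= leq_addr.
  exact: P0.
have [i ai] : exists i, (0 < a i)%N.
  apply/existsP; rewrite -[X in is_true X]negbK negb_exists; apply/negP => /forallP H.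
  by move: am; rewrite /deg big1// => i _; have := H i; rewrite lt0n negbK => /eqP.
case: k mk => // k mk.
pose a' := setexp a i (a i).-1.
have da' : deg a' = m by have := deg_setexp a i (a i).-1; rewrite -/a'; lia.
have aE : a = setexp a' i (a' i).+1.
  apply/funext => j; rewrite /a' /setexp eqxx; case: eqP => [->|//].
  by rewrite prednK.
have H1 : gam + (deg a')%:R / 2 <= gam + 1 + k%:R.
  have : m%:R <= k%:R :> R by rewrite ler_nat.
  have : 0 <= m%:R :> R by [].
  by rewrite da'; lra.
have := @pot_const_derive (gam + 1 + k%:R) a' 0 H1 (IH m (leqnn _) a' k da' mk) i x xr.
rewrite -aE -[k.+1%:R]natr1 addrA.
have -> : (a' i)%:R * pot (gam + 1 + k%:R) (setexp a' i (a' i).-1) x = 0.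
  have [->|a'i] := eqVneq (a' i) 0%N; first by rewrite mul0r.
  have d2 : deg (setexp a' i (a' i).-1) = m.-1.
    by have := deg_setexp a' i (a' i).-1; rewrite da'; lia.
  rewrite (IH m.-1 _ _ k d2) ?mulr0//; first by lia.
  by rewrite (leq_trans (leq_pred m)).
move=> /esym/eqP; rewrite !mulf_eq0 pnatr_eq0/= => /orP[|/eqP//].
by rewrite gt_eqF// ltr_wpDr// addr_gt0.
Qed.

Definition inversion (z : Rn) : Rn := (sqn z)^-1 *: z.

(** With [w = z / |z|^2] one has [w^a = z^a |z|^(-2|a|)], so the vanishing
    potentials at [x0] are the moments of the image measure, whose support lies in
    the ball of radius [1/r]. *)
Lemma potential_moments c : n%:R < 2 * gam + 2 ->
  (forall x, ball x0 r x -> pot gam (fun=> 0%N) x = c) ->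
  forall B : set Rn, measurable B ->
  \int[mu]_y (v y * sqn (x0 - e y) `^ (- (gam + 1)) * \1_B (inversion (x0 - e y))) = 0.
Proof.
move=> ngam cE B mB.
have x0r : ball x0 r x0 by exact: ballxx.
apply: (@moment_unique _ _ _ _ _ _ (fun y => inversion (x0 - e y)) r^-1) => //.
- have := @integrable_riesz (gam + 1) (fun=> 0%N) x0 x0r.
  rewrite deg0 => /(_ ltac:(lra)); apply: eq_integrable => // y _ /=.
  by rewrite /riesz big1 ?mul1r// => i _; rewrite expr0.
- apply: measurable_row => i; rewrite /inversion.
  under eq_fun do rewrite mxE -powR_inv1 ?sqn_ge0//.
  apply: measurable_funM => //; apply: (measurableT_comp (@measurable_powR R _)).
  by apply: measurable_sum => j; exact: measurable_funX.
- move=> y; rewrite mulf_eq0 negb_or => /andP[vy _] i.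
  have [rxy _] := far x0r vy; set z := x0 - e y in rxy *.
  have z0 : 0 < `|z| by exact: lt_le_trans rxy.
  rewrite mxE normrM normfV (ger0_norm (sqn_ge0 z)).
  apply: (@le_trans _ _ ((`|z| ^+ 2)^-1 * `|z|)).
    apply: ler_pM; rewrite ?invr_ge0 ?sqn_ge0 ?coord_le_norm//.
    by rewrite lef_pV2 ?posrE ?norm_le_sqn ?exprn_gt0// sqn_gt0// -normr_gt0.
  by rewrite expr2 invfM mulrVK ?unitfE ?gt_eqF// lef_pV2 ?posrE.
- move=> a; have := @pot_eq0 c ngam cE (deg a) a (deg a) erefl (leqnn _) x0 x0r.
  move=> <-; apply: eq_Rintegral => y _; rewrite -mulrA.
  have [->|vy] := eqVneq (v y) 0; first by rewrite !mul0r.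
  have [rxy _] := far x0r vy; set z := x0 - e y in rxy *.
  have q0 : 0 < sqn z by apply: sqn_gt0; rewrite -normr_gt0; exact: lt_le_trans rxy.
  congr (_ * _); rewrite /riesz.
  under eq_bigr do rewrite mxE exprMn.
  rewrite big_split/= prodrXr -/(deg a) mulrA mulrC; congr (_ * _).
  rewrite -powR_inv1 ?sqn_ge0// -powR_mulrn ?powR_ge0// -powRrM -powRD; last first.
    by apply/implyP => _; rewrite gt_eqF.
  by congr (_ `^ _); ring.
Qed.

End riesz_potential.

Section unique_continuation.
Context (R : realType) (n : nat) (s : R).
Hypothesis s01 : 0 < s < 1.
Local Notation Rn := 'rV[R]_n.
Local Notation LRn := (caratheodory_type (@lebesgue_borel R n)^*%mu).
Local Notation mu := (@lebesgue_rV R n).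

Lemma sqnZ (c : R) (z : Rn) : sqn (c *: z) = c ^+ 2 * sqn z.
Proof. by rewrite /sqn mulr_sumr; apply: eq_bigr => i _; rewrite mxE exprMn. Qed.

Lemma inversionK : involutive (@inversion R n).
Proof.
move=> z; have [->|z0] := eqVneq z 0; first by rewrite /inversion !scaler0.
have q0 := sqn_gt0 z0; rewrite /inversion sqnZ scalerA.
rewrite (_ : _ * _ = 1) ?scale1r//; field.
by rewrite gt_eqF.
Qed.

Lemma borel_measurable_inversion (x0 : Rn) :
  measurable_fun setT (fun z : Rn => x0 - inversion z).
Proof.
apply: measurable_row => i; under eq_fun do rewrite !mxE.
apply: measurable_funB; first exact: measurable_cst.
apply: measurable_funM; last exact: borel_measurable_coord.
under eq_fun do rewrite -powR_inv1 ?sqn_ge0//.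
apply: (measurableT_comp (@measurable_powR R _)).
by apply: measurable_sum => j; apply: measurable_funX; exact: borel_measurable_coord.
Qed.

(** The inverted measure has vanishing moments, and inversion is Borel and
    involutive, so its density, hence [v], vanishes. *)
Theorem unique_continuation (v : LRn -> R) (x0 : Rn) (r c : R) : 0 < r ->
  measurable_fun setT v ->
  (forall y : Rn, ball x0 (2 * r) y -> v y = 0) ->
  mu.-integrable setT (EFin \o (fun y : LRn => v y * kernel s x0 y)) ->
  (forall x, ball x0 r x -> \int[mu]_y (v y * kernel s x y) = c) ->
  {ae mu, forall y, v y = 0}.
Proof.
move=> r0 mv v0 iv cv.
pose gam : R := (n%:R + 2 * s) / 2.
have gam0 : 0 < gam by rewrite divr_gt0// alpha_gt0//; case/andP: s01.
have hv y : v y != 0 -> 2 * r <= `|x0 - y|.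
  by apply: contra_neqT; rewrite -ltNge => H; apply: v0; rewrite -ball_normE.
have ngam : n%:R < 2 * gam + 2.
  by rewrite /gam mulrCA divff ?pnatr_eq0// mulr1; case/andP: s01 => s0 _; lra.
have iv' : mu.-integrable setT (EFin \o (fun y : LRn => v y * sqn (x0 - y) `^ (- gam))).
  by move: iv; apply: eq_integrable => // y _; rewrite /= kernelE.
have cv' x : ball x0 r x -> pot mu (fun y : LRn => y : Rn) v gam (fun=> 0%N) x = c.
  move=> xr; rewrite -(cv x xr); apply: eq_Rintegral => y _.
  by rewrite kernelE /riesz big1 ?mul1r// => i _; rewrite expr0.
have H := @potential_moments _ LRn R mu n (fun y : LRn => y : Rn) v x0 r gam
  (@measurable_coord R n) r0 gam0 hv mv iv' c ngam cv'.
have iw : mu.-integrable setT (EFin \o (fun y : LRn => v y * sqn (x0 - y) `^ (- (gam + 1)))).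
  have := @integrable_riesz _ LRn R mu n (fun y : LRn => y : Rn) v x0 r gam
    (@measurable_coord R n) r0 gam0 hv mv iv' (gam + 1) (fun=> 0%N) x0 (ballxx _ r0).
  rewrite deg0 mul0r addr0 => /(_ ltac:(by rewrite lerDl)); apply: eq_integrable => // y _ /=.
  by rewrite /riesz big1 ?mul1r// => i _; rewrite expr0.
have := @pullback_density_eq0 R n _ (fun y : LRn => inversion (x0 - y)) _ iw
  (borel_measurable_inversion x0) _ H.
move=> /(_ (fun x => _)) K.
apply: filterS (K _) => [y|y]; last by rewrite inversionK opprB addrC subrK.
move/eqP; rewrite mulf_eq0 powR_eq0 => /orP[/eqP//|/andP[sq0 _]].
apply: v0; rewrite -ball_normE/=; have [->|nz] := eqVneq (x0 - y) 0.
  by rewrite normr0 mulr_gt0.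
by have := sqn_gt0 nz; rewrite (eqP sq0) ltxx.
Qed.

End unique_continuation.

(** * Smooth bumps *)

Section flat_functions.
Context (R : realType).

(** The functions [t^-m exp(-1/t)] on the half line; the family is stable under
    differentiation, which makes its members smooth. *)
Definition flat (m : nat) (t : R) : R :=
  if 0 < t then t ^- m * expR (- t^-1) else 0.

Lemma flat_ge0 m t : 0 <= flat m t.
Proof.
by rewrite /flat; case: ifP => // t0; rewrite mulr_ge0 ?expR_ge0// invr_ge0 exprn_ge0// ltW.
Qed.

Lemma flat_le0 m t : t <= 0 -> flat m t = 0.
Proof. by rewrite /flat => /le_gtF ->. Qed.

Lemma flat0_gt0 t : 0 < t -> 0 < flat 0 t.
Proof. by rewrite /flat => ->; rewrite expr0 invr1 mul1r expR_gt0. Qed.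

Lemma flat0_le1 t : flat 0 t <= 1.
Proof.
rewrite /flat; case: ifP => // t0; rewrite expr0 invr1 mul1r -expR0 ler_expR.
by rewrite oppr_le0 invr_ge0 ltW.
Qed.

Lemma exprn_le_expR (N : nat) (y : R) : 0 <= y -> y ^+ N.+1 <= N.+1%:R ^+ N.+1 * expR y.
Proof.
move=> y0; have -> : expR y = expR (y / N.+1%:R) ^+ N.+1.
  by rewrite -expRM_natl mulrC divfK// pnatr_eq0.
rewrite -exprMn lerXn2r ?nnegrE ?mulr_ge0 ?expR_ge0//.
rewrite -ler_pdivrMl// mulrC; apply: le_trans (expR_ge1Dx _).
by rewrite lerDr.
Qed.

Lemma flat_sqr m : exists2 C, 0 <= C & forall t, flat m t <= C * t ^+ 2.
Proof.
exists (m.+2%:R ^+ m.+2); first by rewrite exprn_ge0.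
move=> t; rewrite /flat; case: ifP => t0; last by rewrite mulr_ge0 ?sqr_ge0// exprn_ge0.
have y0 : 0 <= t^-1 by rewrite invr_ge0 ltW.
have := exprn_le_expR m.+1 y0; rewrite expRN => H.
rewrite ler_pdivrMr ?expR_gt0// mulrAC; move: H.
rewrite -(@ler_pM2r _ (t ^+ 2)) ?exprn_gt0//; apply: le_trans.
rewrite exprVn -[m.+2]addn2 exprD invfM -mulrA mulVf ?mulr1//.
by rewrite expf_neq0// gt_eqF.
Qed.

Lemma is_derive_flat (m : nat) (t : R) : is_derive t 1 (flat m) (flat m.+2 t - m%:R * flat m.+1 t).
Proof.
have [t0|t0|<-] := ltgtP 0 t.
- apply: (@near_eq_is_derive _ _ _ (fun u : R => u ^- m * expR (- u^-1))).
    have : \forall u \near t, 0 < u by exact: lt_nbhsr.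
    by apply: filterS => u u0; rewrite /flat u0.
  have tn : t != 0 by rewrite gt_eqF.
  have D1 := @is_deriveX _ _ (fun u : R => u) m t 1 1 (is_derive_id t 1).
  rewrite exprfctE in D1.
  have D2 := @is_deriveV R (fun u : R => u ^+ m) t _ 1 (expf_neq0 _ tn) D1.
  have D3 := is_deriveN (@is_deriveV R (fun u : R => u) t _ 1 tn (is_derive_id t 1)).
  have D4 := @is_derive1_comp R expR _ t _ _ (is_derive_expR _) D3.
  apply: (is_derive_eq (is_deriveM D2 D4)).
  rewrite /flat t0 /GRing.scale/= !mulr1.
  case: m {D1 D2} => [|m] /=.
    by rewrite !mul0r !mulr0 addr0 subr0 expr0 invr1 mul1r opprK mulrC.
  rewrite opprK !exprS; field.
  by rewrite expf_neq0.
- apply: (@near_eq_is_derive _ _ _ (cst 0)).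
    have : \forall u \near t, u < 0 by exact: lt_nbhsl.
    by apply: filterS => u /ltW u0; rewrite flat_le0.
  by rewrite !flat_le0 ?(ltW t0)// mulr0 subr0; exact: is_derive_cst.
- rewrite !flat_le0// mulr0 subr0.
  have [C C0 HC] := flat_sqr m.
  have H : h^-1 *: (flat m (h *: (1 : R) + 0) - flat m 0) @[h --> (0:R)^'] --> (0 : R).
    apply/cvgrPdist_le => e e0.
    near=> h; rewrite sub0r normrN addr0 (flat_le0 m (lexx _)) subr0 normrZ.
    rewrite /GRing.scale/= mulr1 (ger0_norm (flat_ge0 _ _)).
    have hn : h != 0 by near: h; exact: nbhs_dnbhs_neq.
    have h0 : 0 < `|h| by rewrite normr_gt0.
    rewrite normfV ler_pdivrMl//; apply: le_trans (HC h) _.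
    rewrite -real_normK ?num_real// expr2 mulrA [leRHS]mulrC ler_wpM2r//.
    rewrite (@le_trans _ _ ((C + 1) * `|h|))// ?ler_wpM2r ?lerDl//.
    rewrite -ler_pdivlMl ?ltr_wpDl// mulrC; near: h.
    apply: (@cvg_within _ (nbhs (0:R))); exists (e / (C + 1)) => /=.
      by rewrite divr_gt0// ltr_wpDl.
    by move=> h /=; rewrite sub0r normrN => /ltW.
  by apply: DeriveDef; [apply/cvg_ex; exists 0|exact: (cvg_lim (@Rhausdorff R) H)].
Unshelve. all: by end_near.
Qed.

Lemma continuous_flat m : continuous (flat m).
Proof.
move=> t; apply: differentiable_continuous; apply/derivable1_diffP.
by have [] := is_derive_flat m t.
Qed.

Lemma flat0_lipschitz (t u : R) : `|flat 0 t - flat 0 u| <= 4 * `|t - u|.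
Proof.
have H (a b : R) : a <= b -> `|flat 0 b - flat 0 a| <= 4 * (b - a).
  move=> ab.
  have [c _ ->] := @MVT_segment R (flat 0) (fun t => flat 2 t - 0%:R * flat 1 t) a b ab
    (fun x _ => is_derive_flat 0 x) (continuous_subspaceT (@continuous_flat 0)).
  rewrite mul0r subr0 normrM (ger0_norm (flat_ge0 _ _)) [`|b - a|]ger0_norm ?subr_ge0//.
  rewrite ler_wpM2r ?subr_ge0// /flat; case: ifP => // c0.
  have y0 : 0 <= c^-1 by rewrite invr_ge0 ltW.
  have H := exprn_le_expR 1 y0; rewrite expRN -exprVn ler_pdivrMr ?expR_gt0//.
  by apply: le_trans H _; rewrite -natrX.
have [tu|/ltW ut] := leP t u; last by rewrite (ger0_norm (_ : 0 <= t - u)) ?subr_ge0// H.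
by rewrite distrC [`|t - u|]distrC [`|u - t|]ger0_norm ?subr_ge0// H.
Qed.

End flat_functions.

Section bumps.
Context (R : realType) (n : nat).
Local Notation Rn := 'rV[R]_n.
Implicit Types (f g : Rn -> R) (x z a c : Rn) (p q : 'I_n -> nat).

Lemma is_derive_line f x (v : Rn) (df : R) :
  is_derive (0 : R) 1 (fun t : R => f (x + t *: v)) df -> is_derive x v f df.
Proof.
move=> [D1 D2].
have E : (fun h : R => h^-1 *: ((fun t : R => f (x + t *: v)) (h *: (1:R) + 0) -
      (fun t : R => f (x + t *: v)) 0)) =
    (fun h : R => h^-1 *: (f (h *: v + x) - f x)).
  by apply/funext => h; rewrite scale0r addr0 addr0 /GRing.scale/= mulr1 [x + _]addrC.
by split; [move: D1; rewrite /derivable E|move: D2; rewrite /derive E].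
Qed.

Lemma partialE f (i : 'I_n) (df : Rn -> R) :
  (forall x, is_derive x (delta_mx ord0 i) f (df x)) -> partial i f = df.
Proof. by move=> H; apply/funext => x; rewrite /partial; have [_] := H x. Qed.

Lemma Ck_add k f g : Ck k f -> Ck k g -> Ck k (fun x => f x + g x).
Proof.
elim: k f g => [|k IH] f g /=; first by move=> cf cg x; exact: continuousD (cf x) (cg x).
move=> [cf df pf] [cg dg pg]; split.
- by move=> x; exact: continuousD (cf x) (cg x).
- by move=> i x; apply: derivableD; [exact: df|exact: dg].
move=> i; rewrite (_ : partial i _ = (fun x => partial i f x + partial i g x)); first exact: IH.
apply: partialE => x; apply: (@is_deriveD _ _ _ f g); exact: DeriveDef.
Qed.

Lemma Ck_scale k (b : R) f : Ck k f -> Ck k (fun x => b * f x).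
Proof.
elim: k f => [|k IH] f /=; first by move=> cf x; exact: continuousM (cvg_cst b) (cf x).
move=> [cf df pf]; split.
- by move=> x; exact: continuousM (cvg_cst b) (cf x).
- by move=> i x; apply: (@derivableZ _ _ _ f); exact: df.
move=> i; rewrite (_ : partial i _ = (fun x => b * partial i f x)); first exact: IH.
by apply: partialE => x; apply: (@is_deriveZ _ _ _ f); exact: DeriveDef.
Qed.

Variables (kap : R) (a c : Rn).

(** The family of products of [flat] functions spanned by the partial derivatives
    of [bump]. *)
Definition bump_term p q z : R :=
  \prod_i (flat (p i) (kap * (z ord0 i - a ord0 i)) * flat (q i) (kap * (c ord0 i - z ord0 i))).

Lemma continuous_coord (i : 'I_n) : continuous (fun z : Rn => z ord0 i).
Proof. exact: coord_continuous. Qed.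

Lemma continuous_bump_term p q : continuous (bump_term p q).
Proof.
move=> z; apply: (cvg_big mul_continuous (nbhs_filter z)) => i _.
apply: cvgM.
  apply: (@continuous_comp _ _ _ (fun z : Rn => kap * (z ord0 i - a ord0 i)) (flat (p i))).
    apply: (@continuousM _ _ (fun=> kap) (fun z : Rn => z ord0 i - a ord0 i)).
      exact: cst_continuous.
    by apply: (@continuousB _ _ _ (fun z : Rn => z ord0 i) (fun=> a ord0 i));
      [exact: continuous_coord|exact: cst_continuous].
  exact: continuous_flat.
apply: (@continuous_comp _ _ _ (fun z : Rn => kap * (c ord0 i - z ord0 i)) (flat (q i))).
  apply: (@continuousM _ _ (fun=> kap) (fun z : Rn => c ord0 i - z ord0 i)).
    exact: cst_continuous.
  by apply: (@continuousB _ _ _ (fun=> c ord0 i) (fun z : Rn => z ord0 i));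
    [exact: cst_continuous|exact: continuous_coord].
exact: continuous_flat.
Qed.

Definition bump_term' p q (i : 'I_n) z : R :=
  kap * (bump_term (setexp p i (p i).+2) q z + (- (p i)%:R) * bump_term (setexp p i (p i).+1) q z
  + ((-1) * bump_term p (setexp q i (q i).+2) z + (q i)%:R * bump_term p (setexp q i (q i).+1) z)).

Lemma is_derive_bump_term p q i x :
  is_derive x (delta_mx ord0 i) (bump_term p q) (bump_term' p q i x).
Proof.
apply: is_derive_line.
set e : Rn := delta_mx ord0 i.
have zi u : (x + u *: e) ord0 i = x ord0 i + u by rewrite !mxE !eqxx mulr1.
have zj u j : j != i -> (x + u *: e) ord0 j = x ord0 j.
  by move=> /negbTE ji; rewrite !mxE ji andbF mulr0 addr0.
pose C := \prod_(j | j != i)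
  (flat (p j) (kap * (x ord0 j - a ord0 j)) * flat (q j) (kap * (c ord0 j - x ord0 j))).
have E m l u : bump_term (setexp p i m) (setexp q i l) (x + u *: e) =
    C * (flat m (kap * (x ord0 i + u - a ord0 i)) * flat l (kap * (c ord0 i - (x ord0 i + u)))).
  rewrite /bump_term (bigD1 i)//= zi mulrC /setexp eqxx; congr (_ * _).
  by apply: eq_bigr => j ji; rewrite zj// (negbTE ji).
have E0 m l : bump_term (setexp p i m) (setexp q i l) x =
    C * (flat m (kap * (x ord0 i - a ord0 i)) * flat l (kap * (c ord0 i - x ord0 i))).
  by have := E m l 0; rewrite scale0r !addr0.
rewrite (_ : (fun t => _) = (fun u => C * (flat (p i) (kap * (x ord0 i + u - a ord0 i)) *
   flat (q i) (kap * (c ord0 i - (x ord0 i + u)))))); last first.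
  by apply/funext => u; rewrite -[in LHS](setexp_id p i) -[in LHS](setexp_id q i) E.
rewrite /bump_term'.
have -> : bump_term (setexp p i (p i).+2) q x = bump_term (setexp p i (p i).+2) (setexp q i (q i)) x by rewrite setexp_id.
have -> : bump_term (setexp p i (p i).+1) q x = bump_term (setexp p i (p i).+1) (setexp q i (q i)) x by rewrite setexp_id.
have -> : bump_term p (setexp q i (q i).+2) x = bump_term (setexp p i (p i)) (setexp q i (q i).+2) x by rewrite setexp_id.
have -> : bump_term p (setexp q i (q i).+1) x = bump_term (setexp p i (p i)) (setexp q i (q i).+1) x by rewrite setexp_id.
rewrite !E0.
set t0 := x ord0 i.
have L1 : is_derive (0 : R) 1 (fun u : R => kap * (t0 + u - a ord0 i)) kap.
  have := is_deriveM (is_derive_cst kap (0:R) 1) (is_deriveB (is_deriveD (is_derive_cst t0 (0:R) 1) (is_derive_id (0:R) 1)) (is_derive_cst (a ord0 i) (0:R) 1)).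
  by move=> H; apply: (is_derive_eq H); rewrite /GRing.scale/= mulr0 addr0 add0r subr0 mulr1.
have L2 : is_derive (0 : R) 1 (fun u : R => kap * (c ord0 i - (t0 + u))) (- kap).
  have := is_deriveM (is_derive_cst kap (0:R) 1) (is_deriveB (is_derive_cst (c ord0 i) (0:R) 1) (is_deriveD (is_derive_cst t0 (0:R) 1) (is_derive_id (0:R) 1))).
  by move=> H; apply: (is_derive_eq H); rewrite /GRing.scale/=; ring.
have F1 := @is_derive1_comp R (flat (p i)) _ 0 _ _ (is_derive_flat (p i) _) L1.
have F2 := @is_derive1_comp R (flat (q i)) _ 0 _ _ (is_derive_flat (q i) _) L2.
have F3 := is_deriveM (is_derive_cst C (0:R) 1) (is_deriveM F1 F2).
apply: (is_derive_eq F3); rewrite /GRing.scale/= mulr0 !addr0; ring.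
Qed.

(** Partial derivatives of the terms are combinations of terms of the same family. *)
Lemma Ck_bump_term k p q : Ck k (bump_term p q).
Proof.
elim: k p q => [|k IH] p q; first exact: continuous_bump_term.
split.
- exact: continuous_bump_term.
- by move=> i x; have [] := is_derive_bump_term p q i x.
move=> i; rewrite (partialE (is_derive_bump_term p q i)).
by apply: Ck_scale; apply: Ck_add; apply: Ck_add; try exact: Ck_scale; exact: IH.
Qed.

(** A smooth function positive exactly on the open box; [kap] is its steepness. *)
Definition bump z : R := bump_term (fun=> 0%N) (fun=> 0%N) z.

Definition cbox : set Rn := [set z | forall i, a ord0 i <= z ord0 i <= c ord0 i].

Lemma bump_ge0 z : 0 <= bump z.
Proof. by apply: prodr_ge0 => i _; rewrite mulr_ge0// flat_ge0. Qed.

Lemma bump_le1 z : bump z <= 1.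
Proof. by apply: prodr_ile1 => i _; rewrite mulr_ge0 ?flat_ge0//= mulr_ile1 ?flat_ge0 ?flat0_le1. Qed.

Hypothesis kap0 : 0 < kap.

Lemma bump_gt0 z : box a c z -> 0 < bump z.
Proof.
move=> zb; apply: prodr_gt0 => i _; have /andP[H1 H2] := zb i.
by rewrite mulr_gt0// flat0_gt0// mulr_gt0// subr_gt0.
Qed.

Lemma bump_eq0 z : ~ box a c z -> bump z = 0.
Proof.
move=> /existsNP[i /negP]; rewrite negb_and -!leNgt => H.
rewrite /bump /bump_term (bigD1 i)//=; apply/eqP; rewrite mulf_eq0; apply/orP; left.
by case/orP: H => H; rewrite mulf_eq0; apply/orP; [left|right];
  rewrite flat_le0// pmulr_rle0// subr_le0.
Qed.

Lemma bump_eq0_cbox z : ~ cbox z -> bump z = 0.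
Proof.
move=> zb; apply: bump_eq0 => zb'; apply: zb => i.
by have /andP[H1 H2] := zb' i; rewrite !ltW.
Qed.

Lemma closed_cbox : closed cbox.
Proof.
rewrite (_ : cbox = \bigcap_(i in [set: 'I_n]) ((fun z : Rn => z ord0 i) @^-1` `[a ord0 i, c ord0 i])); last first.
  by apply/seteqP; split=> x H i; have := H i; rewrite /= ?in_itv//=; exact.
apply: closed_bigI => i _; apply: (closed_comp (f := fun z : Rn => z ord0 i)); last exact: itv_closed.
by move=> x _; exact: continuous_coord.
Qed.

Lemma compact_cbox : compact cbox.
Proof.
apply: bounded_closed_compact; last exact: closed_cbox.
exists (`|a| + `|c|); split; first exact: num_real.
move=> M HM z zb; apply/norm_leP; first by rewrite ltW// (le_lt_trans _ HM)// addr_ge0.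
move=> i; apply: le_trans (ltW HM); have := zb i.
have := coord_le_norm a i; have := coord_le_norm c i; rewrite !ler_norml; lra.
Qed.

Lemma supp_bump : supp bump `<=` cbox.
Proof.
rewrite [X in _ `<=` X](closure_id cbox).1; last exact: closed_cbox.
apply: closureS => z /= zb i; apply: contrapT => H; move/eqP: zb; apply.
by apply: bump_eq0_cbox => /(_ i)/H.
Qed.

Lemma test_bump (U : set Rn) : cbox `<=` U -> test U bump.
Proof.
move=> bU k; split; first exact: Ck_bump_term.
- apply: subclosed_compact supp_bump; [exact: closed_closure|exact: compact_cbox].
- exact: subset_trans supp_bump bU.
Qed.

Lemma bump_lipschitz x z : `|bump x - bump z| <= 8 * kap * n%:R * `|x - z|.
Proof.
pose F (y : Rn) (i : 'I_n) := flat 0 (kap * (y ord0 i - a ord0 i)) * flat 0 (kap * (c ord0 i - y ord0 i)).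
have F01 y i : 0 <= F y i <= 1.
  by rewrite /F mulr_ge0 ?flat_ge0//= mulr_ile1 ?flat_ge0 ?flat0_le1.
have prodB (I : seq 'I_n) : `|\prod_(i <- I) F x i - \prod_(i <- I) F z i| <= \sum_(i <- I) `|F x i - F z i|.
  elim: I => [|i I IH]; first by rewrite !big_nil subrr normr0.
  rewrite !big_cons.
  have -> : F x i * \prod_(j <- I) F x j - F z i * \prod_(j <- I) F z j =
    (F x i - F z i) * \prod_(j <- I) F x j + F z i * (\prod_(j <- I) F x j - \prod_(j <- I) F z j) by ring.
  apply: le_trans (ler_normD _ _) _; rewrite [X in X + _]normrM [X in _ + X]normrM; apply: lerD.
    rewrite ler_piMr// ger0_norm; first by apply: prodr_ile1 => j _; exact: F01.
    by apply: prodr_ge0 => j _; case/andP: (F01 x j).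
  apply: le_trans IH; have /andP[f0 f1] := F01 z i.
  by rewrite ler_piMl// ger0_norm.
apply: le_trans (prodB _) _.
have -> : 8 * kap * n%:R * `|x - z| = \sum_(i < n) (8 * (kap * `|x - z|)).
  by rewrite sumr_const card_ord -mulr_natr; ring.
apply: ler_sum => i _.
set u := kap * (x ord0 i - a ord0 i); set u' := kap * (z ord0 i - a ord0 i).
set w := kap * (c ord0 i - x ord0 i); set w' := kap * (c ord0 i - z ord0 i).
have -> : F x i - F z i = (flat 0 u - flat 0 u') * flat 0 w + flat 0 u' * (flat 0 w - flat 0 w').
  by rewrite /F -/u -/u' -/w -/w'; ring.
have xz : `|x ord0 i - z ord0 i| <= `|x - z|.
  by have := coord_le_norm (x - z) i; rewrite !mxE.
apply: le_trans (ler_normD _ _) _; rewrite !normrM.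
have H1 : `|flat 0 u - flat 0 u'| <= 4 * (kap * `|x - z|).
  apply: le_trans (flat0_lipschitz _ _) _; rewrite ler_wpM2l//.
  by rewrite /u /u' -mulrBr opprB addrA subrK normrM (gtr0_norm kap0) ler_wpM2l// ltW.
have H2 : `|flat 0 w - flat 0 w'| <= 4 * (kap * `|x - z|).
  apply: le_trans (flat0_lipschitz _ _) _; rewrite ler_wpM2l//.
  have -> : w - w' = kap * - (x ord0 i - z ord0 i) by rewrite /w /w'; ring.
  by rewrite normrM normrN (gtr0_norm kap0) ler_wpM2l// ltW.
have N0 : `|flat 0 w| <= 1 by rewrite ger0_norm ?flat_ge0 ?flat0_le1.
have N1 : `|flat 0 u'| <= 1 by rewrite ger0_norm ?flat_ge0 ?flat0_le1.
apply: (@le_trans _ _ (`|flat 0 u - flat 0 u'| + `|flat 0 w - flat 0 w'|)).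
  by apply: lerD; [rewrite ler_piMr|rewrite ler_piMl].
apply: le_trans (lerD H1 H2) _; rewrite le_eqVlt; apply/orP; left; apply/eqP; ring.
Qed.

End bumps.

(** * Nonlocal quadratic forms *)

Section nonlocal_form.
Context d (T : measurableType d) (R : realType) (mu : {sigma_finite_measure set T -> \bar R}).
Variables (k : T -> T -> R) (Om : set T).
Hypothesis mk : measurable_fun [set: T * T] (fun p => k p.1 p.2).
Hypothesis k0 : forall x y, 0 <= k x y.
Hypothesis mOm : measurable Om.
Implicit Types (A B : set T) (F : T -> T -> R) (u v phi : T -> R).
Local Notation pm := (mu \x mu)%E.

Let jmeas F := measurable_fun [set: T * T] (fun p => F p.1 p.2).

Definition dint A B F : \bar R := (\int[mu]_(x in A) \int[mu]_(y in B) (F x y)%:E)%E.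

(** The energy integrates over [Om x Om] once and over [Om x ~Om] twice; [wt]
    carries these multiplicities, so that all forms become integrals over the
    product space. *)
Definition wt (x y : T) : R := \1_Om x * (\1_Om y + 2 * \1_(~` Om) y).

Definition two_fold F : \bar R := (dint Om Om F + 2%:E * dint Om (~` Om) F)%E.

Let indic01 A x : 0 <= (\1_A x : R) <= 1.
Proof. by rewrite indicE; case: (_ \in _); rewrite ?lexx ?ler01. Qed.

Lemma wt_ge0 x y : 0 <= wt x y.
Proof.
by rewrite mulr_ge0 ?addr_ge0 ?mulr_ge0//; have /andP[] := indic01 Om x; have /andP[] := indic01 Om y; have /andP[] := indic01 (~` Om) y.
Qed.

Let mindic1 A : measurable A -> measurable_fun [set: T * T] (fun p => \1_A p.1 : R).
Proof. by move=> mA; apply: measurableT_comp => //; exact: measurable_indic. Qed.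

Let mindic2 A : measurable A -> measurable_fun [set: T * T] (fun p => \1_A p.2 : R).
Proof. by move=> mA; apply: measurableT_comp => //; exact: measurable_indic. Qed.

Let mOmC : measurable (~` Om). Proof. exact: measurableC. Qed.

Lemma measurable_wt : jmeas wt.
Proof.
apply: measurable_funM; first exact: mindic1.
by apply: measurable_funD; [exact: mindic2|apply: measurable_funZ; exact: mindic2].
Qed.

Lemma dint_mkcond A B F :
  dint A B F = (\int[mu]_x \int[mu]_y (F x y * (\1_A x * \1_B y))%:E)%E.
Proof.
rewrite /dint integral_mkcond; apply: eq_integral => x _; rewrite patchE indicE.
have [xA|xA] := boolP (x \in A); last first.
  by rewrite integral0_eq// => y _; rewrite mul0r mulr0.
rewrite integral_mkcond; apply: eq_integral => y _; rewrite patchE indicE mul1r.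
by case: (_ \in _); rewrite ?mulr1 ?mulr0.
Qed.

Let dint_prod A B F : jmeas F -> measurable A -> measurable B ->
  jmeas (fun x y => F x y * (\1_A x * \1_B y)).
Proof.
by move=> mF mA mB; apply: measurable_funM => //; apply: measurable_funM; [exact: mindic1|exact: mindic2].
Qed.

Let wtE F x y : F x y * wt x y =
  F x y * (\1_Om x * \1_Om y) + 2 * (F x y * (\1_Om x * \1_(~` Om) y)).
Proof. by rewrite /wt; ring. Qed.

Lemma two_fold_ge0 F : jmeas F -> (forall x y, 0 <= F x y) ->
  two_fold F = (\int[pm]_p (F p.1 p.2 * wt p.1 p.2)%:E)%E.
Proof.
move=> mF F0.
have H A B : measurable A -> measurable B ->
    dint A B F = (\int[pm]_p (F p.1 p.2 * (\1_A p.1 * \1_B p.2))%:E)%E.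
  move=> mA mB; rewrite dint_mkcond.
  rewrite (@fubini_tonelli1 _ _ _ _ _ mu mu (fun p => (F p.1 p.2 * (\1_A p.1 * \1_B p.2))%:E))//.
    by apply/measurable_EFinP; exact: dint_prod.
  by move=> p; rewrite lee_fin !mulr_ge0// indicE.
rewrite /two_fold !H//.
under [RHS]eq_integral do rewrite wtE EFinD.
rewrite ge0_integralD//.
- by rewrite ge0_integralZ_fin//; [exact: dint_prod|move=> p; rewrite !mulr_ge0// indicE].
- by move=> p _; rewrite lee_fin !mulr_ge0// indicE.
- by apply/measurable_EFinP; exact: dint_prod.
- by move=> p _; rewrite lee_fin !mulr_ge0// indicE.
- by apply/measurable_EFinP; apply: measurable_funZ; exact: dint_prod.
Qed.

Lemma two_fold_int F : jmeas F ->
  pm.-integrable setT (fun p => (F p.1 p.2 * wt p.1 p.2)%:E) ->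
  two_fold F = (\int[pm]_p (F p.1 p.2 * wt p.1 p.2)%:E)%E.
Proof.
move=> mF iF.
have iH A B : measurable A -> measurable B -> (forall x y, \1_A x * \1_B y <= wt x y) ->
    pm.-integrable setT (EFin \o (fun p => F p.1 p.2 * (\1_A p.1 * \1_B p.2))).
  move=> mA mB ABw.
  apply: (@integrable_dominated _ _ _ _ _ (fun p => `|F p.1 p.2 * wt p.1 p.2|)).
  - exact: dint_prod.
  - by apply: (@integrable_norm _ _ _ _ _ (fun p => F p.1 p.2 * wt p.1 p.2)).
  - move=> p; rewrite [leLHS]normrM [leRHS]normrM ler_wpM2l// [leRHS]ger0_norm ?wt_ge0//.
    by rewrite ger0_norm// mulr_ge0// indicE.
have w1 x y : \1_Om x * \1_Om y <= wt x y.
  apply: ler_wpM2l; first by have /andP[] := indic01 Om x.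
  by have := indic01 (~` Om) y; lra.
have w2 x y : \1_Om x * \1_(~` Om) y <= wt x y.
  apply: ler_wpM2l; first by have /andP[] := indic01 Om x.
  by have := indic01 (~` Om) y; have := indic01 Om y; lra.
have H A B : measurable A -> measurable B -> (forall x y, \1_A x * \1_B y <= wt x y) ->
    dint A B F = (\int[pm]_p (F p.1 p.2 * (\1_A p.1 * \1_B p.2))%:E)%E.
  move=> mA mB ABw; rewrite dint_mkcond.
  by rewrite -(@integral12_prod_meas1 _ _ _ _ _ mu mu (fun p => (F p.1 p.2 * (\1_A p.1 * \1_B p.2))%:E)) //; exact: iH.
rewrite /two_fold !H//.
under [RHS]eq_integral do rewrite wtE EFinD.
rewrite integralD//.
- under [X in _ = (_ + X)%E]eq_integral do rewrite EFinM.
  by rewrite integralZl//; exact: iH.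
- exact: iH.
- by have := RintegrableZl 2 measurableT (iH _ _ mOm mOmC w2); apply: eq_integrable.
Qed.

Lemma measurable_diff u : measurable_fun setT u ->
  measurable_fun [set: T * T] (fun p => u p.1 - u p.2).
Proof. by move=> mu_; apply: measurable_funB; apply: measurableT_comp. Qed.

Definition qform u (p : T * T) : R := (u p.1 - u p.2) ^+ 2 * k p.1 p.2 * wt p.1 p.2.

Definition bform u phi (p : T * T) : R :=
  (u p.1 - u p.2) * (phi p.1 - phi p.2) * k p.1 p.2 * wt p.1 p.2.

Definition finite_energy u := measurable_fun setT u /\ pm.-integrable setT (EFin \o qform u).

Let mqform u : measurable_fun setT u -> jmeas (fun x y => (u x - u y) ^+ 2 * k x y).
Proof. by move=> mu_; apply: measurable_funM => //; apply: measurable_funX; exact: measurable_diff. Qed.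

Let mbform u phi : measurable_fun setT u -> measurable_fun setT phi ->
  jmeas (fun x y => (u x - u y) * (phi x - phi y) * k x y).
Proof.
by move=> mu_ mphi; apply: measurable_funM => //; apply: measurable_funM; exact: measurable_diff.
Qed.

Lemma qform_ge0 u p : 0 <= qform u p.
Proof. by apply: mulr_ge0; [apply: mulr_ge0 => //; exact: sqr_ge0|exact: wt_ge0]. Qed.

Lemma two_fold_qform u : measurable_fun setT u ->
  two_fold (fun x y => (u x - u y) ^+ 2 * k x y) = (\int[pm]_p (qform u p)%:E)%E.
Proof.
by move=> mu_; rewrite two_fold_ge0//; [exact: mqform|move=> x y; rewrite mulr_ge0 ?sqr_ge0].
Qed.

Lemma finite_energyP u : measurable_fun setT u ->
  (two_fold (fun x y => ((u x - u y) ^+ 2 * k x y)%R) < +oo)%E -> finite_energy u.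
Proof.
move=> mu_; rewrite two_fold_qform// => H; split=> //.
apply: integrable_ge0 => //; last exact: qform_ge0.
by apply: measurable_funM; [exact: mqform|exact: measurable_wt].
Qed.

(** [|2 a b| <= a^2 + b^2]. *)
Lemma bform_integrable u phi : finite_energy u -> finite_energy phi ->
  pm.-integrable setT (EFin \o bform u phi).
Proof.
move=> [mu_ iu] [mphi iphi].
apply: (@integrable_dominated _ _ _ _ _ (fun p => qform u p + qform phi p)).
- by apply: measurable_funM; [exact: mbform|exact: measurable_wt].
- exact: RintegrableD.
- move=> p; rewrite /bform /qform -!mulrDl [leLHS]normrM [X in X * _ <= _]normrM.
  rewrite (ger0_norm (k0 _ _)) (ger0_norm (wt_ge0 _ _)) ler_wpM2r ?wt_ge0// ler_wpM2r//.
  rewrite ler_norml; set a := u _ - _; set b := phi _ - _.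
  have := sqr_ge0 (a + b); have := sqr_ge0 (a - b); have := sqr_ge0 a; have := sqr_ge0 b.
  by rewrite !expr2; nra.
Qed.

Lemma two_fold_bform u phi : finite_energy u -> finite_energy phi ->
  fine (two_fold (fun x y => (u x - u y) * (phi x - phi y) * k x y)) = \int[pm]_p bform u phi p.
Proof.
move=> fu fphi; rewrite two_fold_int//; last exact: bform_integrable.
by apply: mbform; [case: fu|case: fphi].
Qed.

Lemma finite_energy_lin u v (t : R) : finite_energy u -> finite_energy v ->
  finite_energy (fun x => u x + t * v x).
Proof.
move=> [mu_ iu] [mv iv].
have mw : measurable_fun setT (fun x => u x + t * v x).
  by apply: measurable_funD => //; exact: measurable_funZ.
split=> //.
apply: (@integrable_dominated _ _ _ _ _ (fun p => 2 * qform u p + 2 * t ^+ 2 * qform v p)).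
- exact: measurable_funM (mqform mw) measurable_wt.
- by apply: RintegrableD => //; exact: RintegrableZl.
- move=> p; rewrite ger0_norm ?qform_ge0// /qform.
  set a := u p.1 - u p.2; set b := v p.1 - v p.2.
  have -> : u p.1 + t * v p.1 - (u p.2 + t * v p.2) = a + t * b by rewrite /a /b; ring.
  have -> : 2 * (a ^+ 2 * k p.1 p.2 * wt p.1 p.2) + 2 * t ^+ 2 * (b ^+ 2 * k p.1 p.2 * wt p.1 p.2)
    = (2 * a ^+ 2 + 2 * (t * b) ^+ 2) * k p.1 p.2 * wt p.1 p.2 by ring.
  rewrite ler_wpM2r ?wt_ge0// ler_wpM2r//.
  by have := sqr_ge0 (a - t * b); rewrite !expr2; nra.
Qed.

Lemma int_qform_lin u v (t : R) : finite_energy u -> finite_energy v ->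
  \int[pm]_p qform (fun x => u x + t * v x) p =
  \int[pm]_p qform u p + t * (2 * \int[pm]_p bform u v p) + t ^+ 2 * \int[pm]_p qform v p.
Proof.
move=> fu fv; have [mu_ iu] := fu; have [mv iv] := fv; have ib := bform_integrable fu fv.
transitivity (\int[pm]_p (qform u p + (2 * t) * bform u v p + t ^+ 2 * qform v p)).
  by apply: eq_Rintegral => p _; rewrite /qform /bform; ring.
rewrite RintegralD//; last 2 first.
- by apply: RintegrableD => //; exact: RintegrableZl.
- exact: RintegrableZl.
rewrite RintegralD//; last exact: RintegrableZl.
by rewrite !RintegralZl//; ring.
Qed.

Lemma int_bformB u v phi : finite_energy u -> finite_energy v -> finite_energy phi ->
  \int[pm]_p bform (fun x => u x - v x) phi p =
  \int[pm]_p bform u phi p - \int[pm]_p bform v phi p.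
Proof.
move=> fu fv fphi; rewrite -RintegralB//; [|exact: bform_integrable|exact: bform_integrable].
by apply: eq_Rintegral => p _; rewrite /bform; ring.
Qed.

Lemma finite_energyB u v : finite_energy u -> finite_energy v ->
  finite_energy (fun x => u x - v x).
Proof.
move=> fu fv; have := finite_energy_lin (-1) fu fv.
by under [X in finite_energy X -> _]eq_fun do rewrite mulN1r.
Qed.

End nonlocal_form.

Section product_facts.
Context d (T : measurableType d) (R : realType) (mu : {sigma_finite_measure set T -> \bar R}).
Local Notation pm := (mu \x mu)%E.

Lemma ae_product (P : T -> Prop) : {ae mu, forall x, P x} ->
  {ae pm, forall p, P p.1 /\ P p.2}.
Proof.
move=> [N [mN N0 NP]]; exists ((N `*` setT) `|` (setT `*` N)); split.
- by apply: measurableU; exact: measurableX.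
- apply/eqP; rewrite eq_le measure_ge0 andbT.
  apply: le_trans (measureU2 _ _ _) _; try exact: measurableX.
  rewrite [X in (X + _)%E](product_measure1E mu mu mN measurableT).
  rewrite [X in (_ + X)%E](product_measure1E mu mu measurableT mN).
  by rewrite /= N0 mul0e mule0 adde0.
- move=> p /= /not_andP[H|H]; [left|right]; split => //; exact: NP.
Qed.

Lemma integral_swap (f : T * T -> R) : pm.-integrable setT (EFin \o f) ->
  pm.-integrable setT (EFin \o (fun p => f (p.2, p.1))) /\
  \int[pm]_p f (p.2, p.1) = \int[pm]_p f p.
Proof.
move=> fi; have mf : measurable_fun setT f by case/integrableP : fi => /measurable_EFinP.
have mswap : measurable_fun [set: T * T] (fun p : T * T => (p.2, p.1)).
  by apply: measurable_fun_pair.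
have mfs : measurable_fun [set: T * T] (fun p => f (p.2, p.1)) by exact: measurableT_comp mf mswap.
have si : pm.-integrable setT (EFin \o (fun p => f (p.2, p.1))).
  apply/(@integrable21ltyP _ _ _ _ _ mu mu); first exact/measurable_EFinP.
  by move/(@integrable12ltyP _ _ _ _ _ mu mu) : fi; apply; exact/measurable_EFinP.
split=> //; rewrite /Rintegral; congr fine.
rewrite -(@integral12_prod_meas1 _ _ _ _ _ mu mu (EFin \o f) fi).
by rewrite -(@integral21_prod_meas1 _ _ _ _ _ mu mu _ si).
Qed.

End product_facts.

Section nonlocal_form_disjoint.
Context d (T : measurableType d) (R : realType) (mu : {sigma_finite_measure set T -> \bar R}).
Variables (k : T -> T -> R) (Om : set T).
Hypothesis mk : measurable_fun [set: T * T] (fun p => k p.1 p.2).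
Hypothesis k0 : forall x y, 0 <= k x y.
Hypothesis kC : forall x y, k x y = k y x.
Hypothesis mOm : measurable Om.
Implicit Types (u v phi : T -> R).
Local Notation pm := (mu \x mu)%E.
Local Notation finite_energy := (finite_energy mu k Om).
Local Notation bform := (bform k Om).
Local Notation qform := (qform k Om).

Lemma bform_ae0 v phi : finite_energy v -> finite_energy phi ->
  {ae mu, forall x, v x = 0} -> \int[pm]_p bform v phi p = 0.
Proof.
move=> fv fphi v0; have ib := bform_integrable mk k0 mOm fv fphi.
transitivity (\int[pm]_p (0 : R)); last by rewrite Rintegral_cst// mul0r.
rewrite /Rintegral; congr fine; apply: ae_eq_integral => //.
  by case/integrableP : ib.
have := ae_product v0; apply: filterS => p [H1 H2] _ /=.
by rewrite /bform H1 H2 subrr !mul0r.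
Qed.

Lemma qform_ae u v : measurable_fun setT u -> measurable_fun setT v ->
  {ae mu, forall x, u x = v x} ->
  (\int[pm]_p (qform u p)%:E = \int[pm]_p (qform v p)%:E)%E.
Proof.
move=> mu_ mv uv; apply: ae_eq_integral => //.
- apply/measurable_EFinP; apply: measurable_funM; last exact: measurable_wt.
  by apply: measurable_funM => //; apply: measurable_funX; exact: measurable_diff.
- apply/measurable_EFinP; apply: measurable_funM; last exact: measurable_wt.
  by apply: measurable_funM => //; apply: measurable_funX; exact: measurable_diff.
have := ae_product uv; apply: filterS => p [H1 H2] _ /=.
by rewrite /qform H1 H2.
Qed.

Lemma bform_ae u v phi : finite_energy u -> finite_energy v -> finite_energy phi ->
  {ae mu, forall x, u x = v x} -> \int[pm]_p bform u phi p = \int[pm]_p bform v phi p.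
Proof.
move=> fu fv fphi uv; apply/eqP; rewrite -subr_eq0 -int_bformB//; apply/eqP.
apply: bform_ae0 => //; first exact: finite_energyB.
by apply: filterS uv => x ->; rewrite subrr.
Qed.

Section disjoint_supports.
Variables (v phi : T -> R).
Hypotheses (fv : finite_energy v) (fphi : finite_energy phi).
Hypothesis phiv : forall x, phi x * v x = 0.
Hypothesis phiOm : forall x, phi x != 0 -> Om x.

Let G (p : T * T) : R := phi p.1 * v p.2 * k p.1 p.2.

Let mG : measurable_fun setT G.
Proof.
case: fv => mv _; case: fphi => mphi _.
by apply: measurable_funM => //; apply: measurable_funM; apply: measurableT_comp.
Qed.

(** As [phi v = 0], where [phi x v y] is nonzero the form reduces to this single
    cross term up to the weight, which is at least 1. *)
Lemma cross_integrable : pm.-integrable setT (EFin \o G).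
Proof.
have ib := bform_integrable mk k0 mOm fv fphi.
apply: (integrable_dominated mG (integrable_norm ib)) => p.
have [p1|p1] := eqVneq (phi p.1) 0; first by rewrite /G p1 !mul0r normr0 /= normr_ge0.
have [p2|p2] := eqVneq (v p.2) 0; first by rewrite /G p2 mulr0 mul0r normr0 /= normr_ge0.
have v1 : v p.1 = 0 by have /eqP := phiv p.1; rewrite mulf_eq0 (negbTE p1) => /eqP.
have f2 : phi p.2 = 0 by have /eqP := phiv p.2; rewrite mulf_eq0 (negbTE p2) orbF => /eqP.
rewrite /= /bform v1 f2 sub0r subr0 [leRHS]normrM.
have -> : `|- v p.2 * phi p.1 * k p.1 p.2| = `|G p| by rewrite /G !normrM normrN [`|v _| * _]mulrC.
rewrite ler_peMr// ger0_norm ?wt_ge0// /wt indicE mem_set ?mul1r; last exact: phiOm.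
by rewrite !indicE in_setC; case: (_ \in Om) => /=; rewrite ?mulr0 ?mulr1 ?addr0 ?add0r// ?ler1n.
Qed.

(** Of the product [(v x - v y) (phi x - phi y)] only the two cross terms remain;
    by symmetry of the kernel they integrate to the same value, the weights over
    [Om] and its complement adding up to 2. *)
Lemma int_bform_disjoint : \int[pm]_p bform v phi p = - (2 * \int[pm]_p G p).
Proof.
have iG := cross_integrable.
pose c2 y : R := \1_Om y + 2 * \1_(~` Om) y.
have mi A : measurable A -> measurable_fun [set: T * T] (fun p => \1_A p.2 : R).
  by move=> mA; apply: measurableT_comp => //; exact: measurable_indic.
have iGA A : measurable A -> pm.-integrable setT (EFin \o (fun p => G p * \1_A p.2)).
  move=> mA; apply: (@integrable_mul_bounded _ _ _ _ _ _ 1) => //; first exact: mi.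
  by move=> p _; rewrite indicE; case: (_ \in _); rewrite ?normr0 ?normr1.
have [iS ES] := integral_swap (iGA _ mOm).
have mOmC : measurable (~` Om) by exact: measurableC.
transitivity (\int[pm]_p (- 1 * ((G p * \1_Om p.2 + 2 * (G p * \1_(~` Om) p.2)) +
    G (p.2, p.1) * \1_Om p.1))).
  apply: eq_Rintegral => p _; rewrite /bform /wt /G /= (kC p.2 p.1).
  have E1 : phi p.1 = phi p.1 * \1_Om p.1.
    have [->|/phiOm p1] := eqVneq (phi p.1) 0; first by rewrite mul0r.
    by rewrite indicE mem_set// mulr1.
  have E2 : phi p.2 = phi p.2 * (\1_Om p.2 + 2 * \1_(~` Om) p.2).
    have [->|/phiOm p1] := eqVneq (phi p.2) 0; first by rewrite mul0r.
    by rewrite !indicE in_setC mem_set// mulr0 addr0 mulr1.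
  have H1 := phiv p.1; have H2 := phiv p.2.
  transitivity (- ((phi p.1 * \1_Om p.1) * v p.2 * k p.1 p.2 * c2 p.2 +
     (phi p.2 * c2 p.2) * v p.1 * k p.1 p.2 * \1_Om p.1)).
    rewrite -/(c2 p.2).
    have -> : (v p.1 - v p.2) * (phi p.1 - phi p.2) = - (phi p.1 * v p.2 + phi p.2 * v p.1).
      transitivity (phi p.1 * v p.1 + phi p.2 * v p.2 - (phi p.1 * v p.2 + phi p.2 * v p.1)); first by ring.
      by rewrite H1 H2 addr0 sub0r.
    by ring.
  by rewrite -E1 -[phi p.2 * c2 _]E2 /c2; ring.
rewrite RintegralZl//; last first.
  apply: RintegrableD => //; apply: RintegrableD => //; first exact: iGA.
  by apply: RintegrableZl => //; exact: iGA.
rewrite RintegralD//; last first.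
  by apply: RintegrableD => //; [exact: iGA|apply: RintegrableZl => //; exact: iGA].
rewrite [X in _ * (_ + X)]ES RintegralD//; last 2 first.
- exact: iGA.
- by apply: RintegrableZl => //; exact: iGA.
rewrite RintegralZl//; last exact: iGA.
have -> : \int[pm]_p G p = \int[pm]_p (G p * \1_Om p.2) + \int[pm]_p (G p * \1_(~` Om) p.2).
  rewrite -RintegralD//; [|exact: iGA|exact: iGA].
  apply: eq_Rintegral => p _; rewrite -mulrDr !indicE in_setC.
  by case: (_ \in Om); rewrite /= ?addr0 ?add0r mulr1.
by ring.
Qed.

(** Fubini gives the potential of [v] a meaning at almost every point of the
    support of [phi]. *)
Lemma cross_ae_integrable :
  {ae mu, forall x, phi x != 0 -> mu.-integrable setT (EFin \o (fun y => v y * k x y))}.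
Proof.
have := @ae_integrable1 _ _ _ _ _ mu mu _ cross_integrable.
apply: filterS => x H phix.
have := RintegrableZl (phi x)^-1 measurableT H; apply: eq_integrable => // y _ /=.
by rewrite /G /= -mulrA mulKf.
Qed.

Lemma int_bform_potential :
  (forall x, phi x != 0 -> mu.-integrable setT (EFin \o (fun y => v y * k x y))) ->
  mu.-integrable setT (EFin \o (fun x => phi x * \int[mu]_y (v y * k x y))) /\
  \int[pm]_p bform v phi p = - (2 * \int[mu]_x (phi x * \int[mu]_y (v y * k x y))).
Proof.
move=> ivk.
have E x : (\int[mu]_y (EFin \o G) (x, y) = (phi x * \int[mu]_y (v y * k x y))%:E)%E.
  rewrite /G/=; have [->|px] := eqVneq (phi x) 0.
    by rewrite mul0r integral0_eq// => y _; rewrite !mul0r.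
  under eq_integral do rewrite -mulrA EFinM.
  rewrite integralZl//; last exact: ivk.
  by rewrite EFinM fineK//; apply: integrable_fin_num => //; exact: ivk.
have := @integral12_prod_meas1 _ _ _ _ _ mu mu _ cross_integrable.
have := @integrable_fubini_F _ _ _ _ _ mu mu _ cross_integrable.
under [X in _.-integrable _ X]eq_fun do rewrite E.
under [X in (X = _)%E -> _]eq_integral do rewrite /fubini_F E.
move=> iF EF; split=> //.
by rewrite int_bform_disjoint /Rintegral -EF.
Qed.

End disjoint_supports.

End nonlocal_form_disjoint.

(** * The energy space of the fractional Laplacian *)

Section energy_criteria.
Context d (T : measurableType d) (R : realType) (mu : {sigma_finite_measure set T -> \bar R}).
Variable k : T -> T -> R.
Hypothesis mk : measurable_fun [set: T * T] (fun p => k p.1 p.2).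
Hypothesis k0 : forall x y, 0 <= k x y.
Implicit Types (u v phi : T -> R).
Local Notation pm := (mu \x mu)%E.

Let mdiff u : measurable_fun setT u ->
  measurable_fun [set: T * T] (fun p => (u p.1 - u p.2) ^+ 2 * k p.1 p.2).
Proof. by move=> mu_; apply: measurable_funM => //; apply: measurable_funX; exact: measurable_diff. Qed.

Let q0 u x y : 0 <= (u x - u y) ^+ 2 * k x y.
Proof. by apply: mulr_ge0 => //; exact: sqr_ge0. Qed.

Lemma dint_setT u : measurable_fun setT u ->
  dint mu setT setT (fun x y => ((u x - u y) ^+ 2 * k x y)%R) =
  (\int[pm]_p ((u p.1 - u p.2) ^+ 2 * k p.1 p.2)%:E)%E.
Proof.
move=> mu_.
rewrite (@fubini_tonelli1 _ _ _ _ _ mu mu (fun p => ((u p.1 - u p.2) ^+ 2 * k p.1 p.2)%:E))//.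
- by apply/measurable_EFinP; exact: mdiff.
- by move=> p; rewrite lee_fin q0.
Qed.

Lemma finite_energy_dint Om u : measurable Om -> measurable_fun setT u ->
  (dint mu setT setT (fun x y => ((u x - u y) ^+ 2 * k x y)%R) < +oo)%E ->
  finite_energy mu k Om u.
Proof.
move=> mOm mu_; rewrite dint_setT// => fin; split=> //.
have i0 : pm.-integrable setT (EFin \o (fun p => (u p.1 - u p.2) ^+ 2 * k p.1 p.2)).
  by apply: integrable_ge0 => //; exact: mdiff.
apply: (integrable_dominated _ (RintegrableZl 2 measurableT i0)).
- by apply: measurable_funM; [exact: mdiff|exact: measurable_wt].
- move=> p; rewrite ger0_norm ?qform_ge0// /qform mulrC ler_wpM2r ?q0//.
  rewrite /wt !indicE in_setC; case: (_ \in Om); case: (_ \in Om);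
  by rewrite /= ?(mulr0, mul0r, mul1r, mulr1, addr0, add0r)// ler1n.
Qed.

Variables (tk : T -> T -> R) (M : R).
Hypothesis mtk : measurable_fun [set: T * T] (fun p => tk p.1 p.2).
Hypothesis tk0 : forall x y, 0 <= tk x y.
Hypothesis tkC : forall x y, tk x y = tk y x.
Hypothesis tkM : forall x, (\int[mu]_y (tk x y)%:E <= M%:E)%E.

(** Off the product of the zero set of [phi] with itself the integrand is
    controlled by [C * tk], and one of the two variables stays in a set of
    finite measure, over which [tk] has bounded mass in the other variable. *)
Lemma dint_truncated_lt_pinfty phi (A : set T) (C : R) : measurable_fun setT phi ->
  measurable A -> (mu A < +oo)%E -> (forall x, ~ A x -> phi x = 0) ->
  (forall x y, (phi x - phi y) ^+ 2 * k x y <= C * tk x y) ->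
  (dint mu setT setT (fun x y => ((phi x - phi y) ^+ 2 * k x y)%R) < +oo)%E.
Proof.
move=> mphi mA finA phiA phik.
have mg : measurable_fun [set: T * T] (fun p => \1_A p.1 * tk p.1 p.2).
  apply: measurable_funM => //; apply: measurableT_comp => //; exact: measurable_indic.
have g0 x y : 0 <= (\1_A x : R) * tk x y by rewrite mulr_ge0// indicE.
have ig : pm.-integrable setT (EFin \o (fun p => \1_A p.1 * tk p.1 p.2)).
  apply/(@integrable12ltyP _ _ _ _ _ mu mu); first exact/measurable_EFinP.
  apply: (@le_lt_trans _ _ (\int[mu]_x (`|M| * \1_A x)%:E)%E).
    apply: ge0_le_integral => //.
    - by move=> x _; exact: integral_ge0.
    - have := @measurable_fun_fubini_tonelli_F _ _ _ _ _ mu (fun p : T * T => `|(\1_A p.1 * tk p.1 p.2)%:E|%E).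
      apply; last by move=> p; exact: abse_ge0.
      by apply: measurableT_comp => //; apply/measurable_EFinP.
    - by apply/measurable_EFinP; apply: measurable_funZ; exact: measurable_indic.
    - move=> x _ /=; rewrite indicE; case: (x \in A); last first.
        by rewrite integral0_eq ?mulr0// => y _; rewrite mul0r normr0.
      under eq_integral do rewrite mul1r ger0_norm//.
      by rewrite mulr1; apply: le_trans (tkM x) _; rewrite lee_fin ler_norm.
  rewrite ge0_integralZ_fin//.
  rewrite integral_indic// setIT lte_mul_pinfty//.
rewrite dint_setT//.
have [ig' _] := integral_swap ig.
have isum := RintegrableZl `|C| measurableT (RintegrableD measurableT ig ig').
have : pm.-integrable setT (EFin \o (fun p => (phi p.1 - phi p.2) ^+ 2 * k p.1 p.2)).
  apply: (integrable_dominated _ isum); first exact: mdiff.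
  move=> p /=; rewrite ger0_norm ?q0// (tkC p.2 p.1) -mulrDl.
  have [A1|A1] := pselect (A p.1); last have [A2|A2] := pselect (A p.2).
  - apply: le_trans (phik _ _) _; apply: le_trans (_ : `|C| * tk p.1 p.2 <= _).
      by rewrite ler_wpM2r// ler_norm.
    by rewrite ler_wpM2l// ler_peMl// [X in X + _]indicE mem_set//= lerDl indicE.
  - apply: le_trans (phik _ _) _; apply: le_trans (_ : `|C| * tk p.1 p.2 <= _).
      by rewrite ler_wpM2r// ler_norm.
    by rewrite ler_wpM2l// ler_peMl// [X in _ + X]indicE (mem_set A2)//= lerDr indicE.
  - by rewrite !phiA// subrr expr0n mul0r mulr_ge0// mulr_ge0// addr_ge0// indicE.
case/integrableP => _; under eq_integral do rewrite gee0_abs ?lee_fin ?q0//.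
by [].
Qed.

End energy_criteria.

Section fractional_forms.
Context (R : realType) (n : nat) (s : R).
Hypothesis s01 : 0 < s < 1.
Local Notation Rn := 'rV[R]_n.
Local Notation mu := (@lebesgue_rV R n).
Local Notation LRn := (caratheodory_type (@lebesgue_borel R n)^*%mu).
Local Notation pm := (mu \x mu)%E.
Implicit Types (Om : set Rn) (u v g phi : Rn -> R).

Lemma measurable_kernel_pair :
  measurable_fun [set: LRn * LRn] (fun p => kernel s (p.1 : Rn) (p.2 : Rn)).
Proof.
exact: (@measurable_kernel R n _ (LRn * LRn)%type s (fun p => p.1) (fun p => p.2) measurable_fst measurable_snd).
Qed.

Let kge0 (x y : LRn) : 0 <= kernel s (x : Rn) (y : Rn). Proof. exact: kernel_ge0. Qed.

Definition fin_energy Om u := @finite_energy _ LRn R mu (kernel s) Om u.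

Definition bint Om u phi : R := \int[pm]_p @bform _ LRn R (kernel s) Om u phi p.

Definition qint Om u : R := \int[pm]_p @qform _ LRn R (kernel s) Om u p.

Lemma frac_lap_bint Om u phi : Lmeasurable Om -> fin_energy Om u -> fin_energy Om phi ->
  frac_lap s Om u phi = cns n s / 2 * bint Om u phi.
Proof.
move=> mOm fu fphi; congr (_ * _).
exact: (@two_fold_bform _ LRn R mu _ Om measurable_kernel_pair kge0 mOm u phi fu fphi).
Qed.

Lemma energy_qint Om u : Lmeasurable Om -> fin_energy Om u ->
  energy s u Om = (cns n s / 4 * qint Om u)%:E.
Proof.
move=> mOm fu; have [mu_ iu] := fu.
transitivity ((cns n s / 4)%:E * \int[pm]_p (@qform _ LRn R (kernel s) Om u p)%:E)%E.
  congr (_ * _)%E.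
  exact: (@two_fold_qform _ LRn R mu _ Om measurable_kernel_pair kge0 mOm u mu_).
rewrite [RHS]EFinM; congr (_ * _)%E.
rewrite /qint /Rintegral fineK//.
exact: integrable_fin_num iu.
Qed.

Lemma energy_fin_energy Om u : (0 < n)%N -> Lmeasurable Om -> Lmeasurable_fun setT u ->
  (energy s u Om < +oo)%E -> fin_energy Om u.
Proof.
move=> n0 mOm mu_ fin.
apply: (@finite_energyP _ LRn R mu _ Om measurable_kernel_pair kge0 mOm u mu_).
have c0 : 0 < cns n s / 4 by rewrite divr_gt0// cns_gt0.
rewrite ltNge; apply/negP; rewrite leye_eq => /eqP H.
move: fin; rewrite /energy.
rewrite [X in (_ * X)%E](_ : _ = +oo)%E; last exact: H.
by rewrite gt0_muley// lte_fin.
Qed.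

Lemma Hs_fin_energy Om u : Lmeasurable Om -> Hs s u -> fin_energy Om u.
Proof.
move=> mOm [mu_ fin].
apply: (@finite_energy_dint _ LRn R mu _ measurable_kernel_pair kge0 Om u mOm mu_).
have H : (2^-1 : R) != 0 by rewrite invr_neq0.
have /= {}fin := lty_poweRy H fin.
apply: le_lt_trans fin; rewrite leeDr//.
by apply: integral_ge0 => x _; rewrite lee_fin sqr_ge0.
Qed.

Lemma Hsg_fin_energy Om g u : (0 < n)%N -> Lmeasurable Om -> Hsg s Om g u -> fin_energy Om u.
Proof.
move=> n0 mOm [[[mg _] eg] [Hu _]].
have fg := energy_fin_energy n0 mOm mg eg.
have fu := Hs_fin_energy mOm Hu.
have := @finite_energy_lin _ LRn R mu _ Om measurable_kernel_pair kge0 mOm g _ 1 fg fu.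
rewrite /fin_energy; congr finite_energy.
by apply/funext => x /=; rewrite mul1r addrC subrK.
Qed.

End fractional_forms.

Section bump_energy.
Context (R : realType) (n : nat) (s : R).
Hypothesis s01 : 0 < s < 1.
Local Notation Rn := 'rV[R]_n.
Local Notation mu := (@lebesgue_rV R n).
Local Notation LRn := (caratheodory_type (@lebesgue_borel R n)^*%mu).
Variables (kap : R) (a c : Rn).
Hypothesis kap0 : 0 < kap.
Hypothesis ac : forall i, a ord0 i <= c ord0 i.
Local Notation phi := (bump kap a c).

Lemma measurable_bump : Lmeasurable_fun setT phi.
Proof.
apply: borel_fun_Lmeasurable.
rewrite (_ : bump kap a c = fun z : Rn => \prod_(i < n) (flat 0 (kap * (z ord0 i - a ord0 i)) * flat 0 (kap * (c ord0 i - z ord0 i)))) //.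
apply: (@measurable_prod _ Rn R setT 'I_n (index_enum 'I_n) (fun i (z : Rn) => flat 0 (kap * (z ord0 i - a ord0 i)) * flat 0 (kap * (c ord0 i - z ord0 i)))) => i _.
have mf : measurable_fun setT (@flat R 0) by apply: continuous_measurable_fun; exact: continuous_flat.
have mc := @borel_measurable_coord R n i.
apply: measurable_funM; apply: (measurableT_comp mf); apply: measurable_funZ.
- by apply: measurable_funB.
- by apply: measurable_funB.
Qed.

Lemma box_finite : (mu (box a c) < +oo)%E.
Proof. by rewrite lebesgue_box// ltry. Qed.

Lemma measurable_box_indic : @measurable_fun _ _ LRn R setT \1_(box a c).
Proof. exact: (@measurable_indic _ LRn R setT (box a c) (borel_Lmeasurable (measurable_box a c))).  Qed.

Lemma bump_indic x : phi x <= \1_(box a c) x.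
Proof.
rewrite indicE; have [xb|xb] := boolP (x \in box a c); first exact: bump_le1.
by rewrite bump_eq0// => /mem_set; apply/negP.
Qed.

(** A bump is bounded and Lipschitz, hence
    [(phi x - phi y)^2 <= C min(1, |x - y|^2)]. *)
Lemma Hs_bump : Hs s phi.
Proof.
split; first exact: measurable_bump.
apply: poweR_lty; rewrite lte_add_pinfty//.
  apply: (@le_lt_trans _ _ (\int[mu]_x (\1_(box a c) x)%:E)%E).
    apply: (@ge0_le_integral_fin _ LRn R mu (fun x => phi x ^+ 2) (\1_(box a c))).
    - apply: measurable_funX; exact: measurable_bump.
    - exact: measurable_box_indic.
    - by move=> y; exact: sqr_ge0.
    - move=> y; apply: le_trans (bump_indic y).
      by rewrite expr2 ler_piMl ?bump_ge0 ?bump_le1.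
  by rewrite integral_indic ?setIT; [exact: box_finite|exact: measurableT|exact: (borel_Lmeasurable (measurable_box a c))].
pose L : R := 8 * kap * n%:R.
have mtk : measurable_fun [set: LRn * LRn] (fun p => trunc_kernel s (p.1 : Rn) (p.2 : Rn)).
  exact: (@measurable_trunc_kernel R n s _ (LRn * LRn)%type (fun p => p.1) (fun p => p.2) measurable_fst measurable_snd).
have tk0 (x y : LRn) : 0 <= trunc_kernel s (x : Rn) (y : Rn) by exact: trunc_kernel_ge0.
have tkC (x y : LRn) : trunc_kernel s (x : Rn) (y : Rn) = trunc_kernel s (y : Rn) (x : Rn).
  rewrite /trunc_kernel kernelC; congr (Num.min _ _ * _).
  by rewrite /sqn; apply: eq_bigr => i _; rewrite !mxE -sqrrN opprB.
have kk (x y : LRn) : 0 <= kernel s (x : Rn) (y : Rn) by exact: kernel_ge0.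
apply: (@dint_truncated_lt_pinfty _ LRn R mu _ (@measurable_kernel_pair R n s) kk _ _ mtk tk0 tkC (trunc_kernel_int s01) phi (box a c) (1 + L ^+ 2) measurable_bump (borel_Lmeasurable (measurable_box a c)) box_finite).
  by move=> x xb; exact: bump_eq0.
move=> x y; rewrite /trunc_kernel mulrA ler_wpM2r ?kernel_ge0//.
have H1 : (phi x - phi y) ^+ 2 <= 1.
  rewrite -[leLHS]real_normK ?num_real// expr_le1// ler_norml.
  have := bump_ge0 kap a c x; have := bump_ge0 kap a c y; have := bump_le1 kap a c x; have := bump_le1 kap a c y.
  lra.
have H2 : (phi x - phi y) ^+ 2 <= L ^+ 2 * sqn (x - y).
  apply: le_trans (_ : (L * `|x - y|) ^+ 2 <= _).
    rewrite -[leLHS]real_normK ?num_real// ler_sqr ?nnegrE ?normr_ge0//; last first.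
      by rewrite mulr_ge0// mulr_ge0// mulr_ge0// ltW.
    exact: bump_lipschitz.
  by rewrite exprMn ler_wpM2l ?sqr_ge0// norm_le_sqn.
have S0 := sqn_ge0 (x - y); have L0 := sqr_ge0 L.
case: (leP 1 (sqn (x - y))) => H; first by rewrite mulr1; lra.
by apply: le_trans H2 _; rewrite mulrDl mul1r lerDr.
Qed.

Lemma Hs_norm0 (f : Rn -> R) : (forall x, f x = 0) -> Hs_norm s f = 0%E.
Proof.
move=> f0; rewrite /Hs_norm integral0_eq; last by move=> x _; rewrite f0 expr0n.
rewrite add0e /double_integral integral0_eq ?poweR0r ?invr_neq0// => x _.
by rewrite integral0_eq// => y _; rewrite !f0 subrr expr0n mul0r.
Qed.

(** Being a test function, a bump approximates itself. *)
Lemma Htilde_bump (U : set Rn) : cbox a c `<=` U -> Htilde s U phi.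
Proof.
move=> cU; split=> [|e e0]; first exact: Hs_bump.
exists phi; first exact: test_bump.
by rewrite Hs_norm0 ?lte_fin// => x; rewrite /= subrr.
Qed.

Lemma Lp_bump (U : set Rn) (p : R) : 0 < p -> Lmeasurable U -> Lp U p%:E phi.
Proof.
move=> p0 mU; split.
  exact: (@measurable_funS _ _ LRn _ setT U phi measurableT (@subsetT _ _) measurable_bump).
rewrite /Lp_norm unlock; apply: poweR_lty.
apply: (@le_lt_trans _ _ (\int[mu]_x (\1_(box a c) x)%:E)%E); last first.
  by rewrite integral_indic ?setIT; [exact: box_finite|exact: measurableT|exact: (borel_Lmeasurable (measurable_box a c))].
rewrite [leLHS](_ : _ = \int[mu]_x ((`|(phi \_ U) x| `^ p)%:E))%E; last first.
  by apply: eq_integral => x _; rewrite -poweR_EFin.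
apply: (@ge0_le_integral_fin _ LRn R mu (fun x => `|(phi \_ U) x| `^ p) (\1_(box a c))).
- apply: (measurableT_comp (@measurable_powR R p)).
  apply: (measurableT_comp (@normr_measurable R setT)).
  apply/(measurable_restrictT _ mU).
  exact: (@measurable_funS _ _ LRn _ setT U phi measurableT (@subsetT _ _) measurable_bump).
- exact: measurable_box_indic.
- by move=> y; exact: powR_ge0.
- move=> y; rewrite patchE; case: ifP => _; last by rewrite normr0 powR0 ?gt_eqF// indicE.
  rewrite ger0_norm ?bump_ge0// indicE; have [yb|yb] := boolP (y \in box a c).
    by rewrite (_ : true%:R = 1 `^ p); [|by rewrite powR1]; rewrite ge0_ler_powR ?nnegrE ?bump_ge0 ?bump_le1 ?ler01// ltW.
  rewrite bump_eq0 ?powR0 ?gt_eqF// => H; by move/negP: yb; apply; exact/mem_set.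
Qed.

End bump_energy.

(** * First variation of the energy *)

Section taylor.
Context {R : realType}.
Implicit Types (W h : R -> R).

Lemma mean_value_le h (dh : R -> R) (C x y : R) :
  (forall z, is_derive z (1 : R) h (dh z)) ->
  (forall z, `|z - y| <= `|x - y| -> `|dh z| <= C) -> `|h x - h y| <= C * `|x - y|.
Proof.
move=> Dh dhC.
have ch z : {for z, continuous h} by apply: differentiable_continuous; apply/derivable1_diffP; case: (Dh z).
case: (ltgtP x y) => xy.
- have [z zxy E] := MVT xy (fun z _ => Dh z) (continuous_subspaceT ch).
  rewrite distrC E normrM [`|y - x|]distrC ler_wpM2r//; apply: dhC.
  by move: zxy; rewrite in_itv/= => /andP[z1 z2]; rewrite !ltr0_norm ?subr_lt0//; lra.
- have [z zxy E] := MVT xy (fun z _ => Dh z) (continuous_subspaceT ch).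
  rewrite E normrM ler_wpM2r//; apply: dhC.
  by move: zxy; rewrite in_itv/= => /andP[z1 z2]; rewrite !gtr0_norm ?subr_gt0//; lra.
- by rewrite xy !subrr normr0 mulr0.
Qed.

Lemma taylor2 W (M : R) : (forall t, derivable W t 1) ->
  (forall t, derivable (derive1 W) t 1) -> continuous (derive1n 2 W) ->
  exists2 C : R, 0 <= C & forall a h : R, `|a| <= M -> `|h| <= 1 ->
    `|W (a + h) - W a - h * derive1 W a| <= C * h ^+ 2.
Proof.
move=> D1 D2 c2.
have d1 z : is_derive z (1 : R) W (derive1 W z) by rewrite derive1E; exact: DeriveDef.
have d2 z : is_derive z (1 : R) (derive1 W) (derive1n 2 W z) by rewrite derive1nS derive1E; exact: DeriveDef.
have [C0 CH] : exists C, forall z, `|z| <= `|M| + 1 -> `|derive1n 2 W z| <= C.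
  have cc : {within `[- (`|M| + 1), `|M| + 1], continuous (fun z => `|derive1n 2 W z|)}.
    apply: continuous_subspaceT => z; apply: continuous_comp; [exact: c2|exact: norm_continuous].
  have le : - (`|M| + 1) <= `|M| + 1 by have := normr_ge0 M; lra.
  have [c _ H] := EVT_max le cc.
  by exists (`|derive1n 2 W c|) => z zM; apply: H; rewrite in_itv/= -ler_norml.
exists (`|C0|) => // a h aM h1.
have -> : W (a + h) - W a - h * derive1 W a =
  (W (a + h) - (a + h) * derive1 W a) - (W a - a * derive1 W a) by ring.
have D z : is_derive z (1 : R) (fun z => W z - z * derive1 W a) (derive1 W z - derive1 W a).
  apply: is_deriveB.
  have := is_deriveM (is_derive_id z (1:R)) (is_derive_cst (derive1 W a) z (1:R)).
  by move=> H; apply: (is_derive_eq H); rewrite scaler0 add0r /GRing.scale/= mulr1.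
have /(_ (`|C0| * `|h|) (a + h) a) := mean_value_le D.
rewrite -mulrA addrAC subrr add0r -expr2 real_normK ?num_real//; apply => z zh.
apply: le_trans (_ : `|C0| * `|z - a| <= _); last by rewrite ler_wpM2l.
apply: (mean_value_le d2) => w wz; apply: le_trans (CH _ _) (ler_norm _).
rewrite -[w](subrK a); apply: le_trans (ler_normD _ _) _.
have := ler_norm M; lra.
Qed.

Lemma is_derive_quadratic h (d C : R) :
  (forall t, `|t| <= 1 -> `|h t - h 0 - t * d| <= C * t ^+ 2) -> is_derive (0 : R) 1 h d.
Proof.
move=> H.
have cv : (fun t => t^-1 *: (h (t *: 1 + 0) - h 0)) @ 0^' --> d.
  apply/cvgrPdist_le => /= e e0; near=> t.
  have t0 : t != 0 by near: t; exact: nbhs_dnbhs_neq.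
  have t1 : `|t| <= 1.
    near: t; apply: dnbhs0_le; exact: ltr01.
  have te : `|t| <= e / (`|C| + 1).
    by near: t; apply: dnbhs0_le; rewrite divr_gt0// ltr_wpDl.
  rewrite addr0 /GRing.scale/= mulr1 distrC.
  have -> : t^-1 * (h t - h 0) - d = t^-1 * (h t - h 0 - t * d) by field.
  rewrite normrM normfV ler_pdivrMl ?normr_gt0//; apply: le_trans (H _ t1) _.
  rewrite -[t ^+ 2]real_normK ?num_real// expr2 mulrCA ler_wpM2l//.
  apply: le_trans (_ : (`|C| + 1) * `|t| <= _).
    by rewrite ler_wpM2r// (le_trans (ler_norm _))// lerDl.
  by rewrite mulrC -ler_pdivlMr// ltr_wpDl.
split; first by apply/cvg_ex; exists d.
exact: (cvg_lim (@Rhausdorff R) cv).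
Unshelve. all: by end_near.
Qed.

End taylor.

Section potential_energy.
Context d (T : measurableType d) (R : realType) (mu : {measure set T -> \bar R}).
Variables (Om S : set T) (W : R -> R) (u phi : T -> R) (M : R).
Hypothesis mOm : measurable Om.
Hypothesis mS : measurable S.
Hypothesis finS : (mu S < +oo)%E.
Hypotheses (D1 : forall t, derivable W t 1) (D2 : forall t, derivable (derive1 W) t 1).
Hypothesis c2 : continuous (derive1n 2 W).
Hypothesis W0 : forall t, 0 <= W t.
Hypothesis mu_ : measurable_fun setT u.
Hypothesis mphi : measurable_fun setT phi.
Hypothesis phi1 : forall x, `|phi x| <= 1.
Hypothesis phiS : forall x, ~ S x -> phi x = 0.
Hypothesis uM : forall x, S x -> `|u x| <= M.
Hypothesis finW : (\int[mu]_(x in Om) (W (u x))%:E < +oo)%E.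

Let cont (f : R -> R) : (forall t, derivable f t 1) -> continuous f.
Proof. by move=> Df t; apply: differentiable_continuous; apply/derivable1_diffP. Qed.

Let mW : measurable_fun setT W.
Proof. apply: continuous_measurable_fun; exact: (@cont W D1). Qed.

Let mdW : measurable_fun setT (derive1 W).
Proof. apply: continuous_measurable_fun; exact: (@cont (derive1 W) D2). Qed.

Let mind : measurable_fun setT (\1_S : T -> R). Proof. exact: measurable_indic. Qed.

Lemma finite_indic_integrable : mu.-integrable setT (EFin \o (\1_S : T -> R)).
Proof. by apply: integrable_ge0 => //; rewrite integral_indic ?setIT. Qed.

Lemma dpotential_integrable : mu.-integrable setT (EFin \o (fun x => derive1 W (u x) * phi x)).
Proof.
have le : - `|M| <= `|M| by have := normr_ge0 M; lra.
have cc : {within `[- `|M|, `|M|], continuous (fun z => `|derive1 W z|)}.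
  apply: continuous_subspaceT => z; apply: continuous_comp; [exact: (@cont (derive1 W) D2)|exact: norm_continuous].
have [c _ H] := EVT_max le cc.
apply: (integrable_dominated _ (RintegrableZl `|derive1 W c| measurableT finite_indic_integrable)).
  by apply: measurable_funM => //; exact: measurableT_comp.
move=> x /=; have [xS|xS] := pselect (S x); last first.
  by rewrite phiS// mulr0 normr0 mulr_ge0// indicE.
rewrite indicE mem_set// mulr1 normrM; apply: le_trans (ler_piMr _ (phi1 x)) _ => //.
by apply: H; rewrite in_itv/= -ler_norml (le_trans (uM xS))// ler_norm.
Qed.

(** The second order Taylor remainder of [W] is uniform on [S] since [u] is
    bounded there, and off [S] nothing varies. *)
Lemma potential_energy_quadratic : exists C : R, forall t, `|t| <= 1 ->
  exists2 w : R, (\int[mu]_(x in Om) (W (u x + t * phi x))%:E)%E = w%:E &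
  `|w - \int[mu]_(x in Om) (W (u x)) - t * \int[mu]_(x in Om) (derive1 W (u x) * phi x)| <= C * t ^+ 2.
Proof.
have [C C0 HC] := taylor2 M D1 D2 c2.
have iS := finite_indic_integrable; have iD := dpotential_integrable.
have sub A f : measurable A -> mu.-integrable setT f -> mu.-integrable A f.
  by move=> mA; apply: integrableS.
exists (C * \int[mu]_(x in Om) (\1_S x : R)) => t t1.
pose r x := W (u x + t * phi x) - W (u x) - t * phi x * derive1 W (u x).
have mr : measurable_fun setT r.
  apply: measurable_funB; last first.
    apply: measurable_funM; last exact: measurableT_comp.
    exact: measurable_funZ.
  apply: measurable_funB; last exact: measurableT_comp.
  by apply: (measurableT_comp mW); apply: measurable_funD => //; exact: measurable_funZ.
have rS x : `|r x| <= C * t ^+ 2 * \1_S x.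
  rewrite indicE /r; have [xS|xS] := boolP (x \in S).
    rewrite mulr1; apply: le_trans (HC _ _ _ _) _.
    - by apply: uM; rewrite inE in xS.
    - by rewrite normrM mulr_ile1.
    - rewrite ler_wpM2l// exprMn -[leRHS]mulr1 ler_wpM2l ?sqr_ge0//.
      by rewrite -[leLHS]real_normK ?num_real// expr_le1.
  rewrite phiS ?mulr0 ?addr0 ?mul0r ?subrr ?subr0 ?normr0//.
  by move=> H; move/negP: xS; apply; rewrite inE.
have ir : mu.-integrable setT (EFin \o r).
  by apply: (integrable_dominated mr (RintegrableZl (C * t ^+ 2) measurableT iS)).
have iW : mu.-integrable Om (EFin \o (fun x => W (u x))).
  apply/integrableP; split.
    by apply/measurable_EFinP; apply: measurable_funS measurableT (@subsetT _ _) _; exact: measurableT_comp.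
  by under eq_integral do rewrite gee0_abs ?lee_fin//.
have itD : mu.-integrable Om (EFin \o (fun x => t * (derive1 W (u x) * phi x))).
  by apply: sub => //; exact: RintegrableZl.
have irD : mu.-integrable Om (EFin \o (fun x => r x + t * (derive1 W (u x) * phi x))).
  by apply: RintegrableD => //; exact: sub.
have E x : W (u x + t * phi x) = W (u x) + (r x + t * (derive1 W (u x) * phi x)).
  by rewrite /r; ring.
exists (\int[mu]_(x in Om) W (u x + t * phi x)).
  rewrite /Rintegral fineK//; apply: integrable_fin_num => //.
  have := RintegrableD mOm iW irD; apply: eq_integrable => // x _ /=; by rewrite E.
have -> : \int[mu]_(x in Om) W (u x + t * phi x) = \int[mu]_(x in Om) W (u x) +
  (\int[mu]_(x in Om) r x + t * \int[mu]_(x in Om) (derive1 W (u x) * phi x)).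
  rewrite -RintegralZl//; last exact: sub.
  rewrite -RintegralD//; last exact: sub.
  by rewrite -RintegralD//; apply: eq_Rintegral => x _; rewrite E.
rewrite [X in `|X|](_ : _ = \int[mu]_(x in Om) r x); last by ring.
apply: le_trans (le_normr_Rintegral mOm (sub _ _ mOm ir)) _.
rewrite -mulrA [X in C * X]mulrC mulrA -RintegralZl//; last exact: sub.
apply: le_Rintegral => //.
- by apply: sub => //; exact: integrable_norm.
- by apply: sub => //; exact: RintegrableZl.
Qed.

End potential_energy.


Section rV_topology.
Context (R : realType) (n : nat).
Local Notation Rn := 'rV[R]_n.
Local Notation mu := (@lebesgue_rV R n).
Local Notation LRn := (caratheodory_type (@lebesgue_borel R n)^*%mu).

Lemma open_Lmeasurable (U : set Rn) : open U -> Lmeasurable U.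
Proof. by move=> oU; apply: borel_Lmeasurable; exact: open_measurable_rV. Qed.

Lemma closed_Lmeasurable (A : set Rn) : closed A -> Lmeasurable A.
Proof.
move=> cA; rewrite -[A]setCK; apply: (@measurableC _ LRn).
by apply: open_Lmeasurable; exact: closed_openC.
Qed.

Lemma continuous_Lmeasurable (h : Rn -> R) : continuous h -> Lmeasurable_fun setT h.
Proof.
move=> ch.
apply: (@measurability _ _ LRn _ setT h (@RGenOInfty.G R)); first exact: RGenOInfty.measurableE.
move=> _ [_ [x ->] <-]; rewrite setTI.
apply: open_Lmeasurable; apply: open_comp; last exact: interval_open.
by move=> y _; exact: ch.
Qed.

Lemma bounded_on_compact (K : set Rn) (h : Rn -> R) : compact K ->
  (forall x, K x -> {for x, continuous h}) -> exists2 M : R, 0 <= M & forall x, K x -> `|h x| <= M.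
Proof.
move=> cK ch.
have cw : {within K, continuous h}.
  by apply: continuous_in_subspaceT => x; rewrite inE; exact: ch.
have /(@compact_bounded R R)[M [_ HM]] := continuous_compact cw cK.
exists (`|M| + 1); first by rewrite addr_ge0.
move=> x Kx; apply: HM; last by exists x.
by rewrite ltr_pwDr// ler_norm.
Qed.

Lemma compact_in_ball (K : set Rn) : compact K -> exists2 r : R, 0 < r & K `<=` ball (0 : Rn) r.
Proof.
move=> /compact_bounded[M [_ HM]]; exists (`|M| + 2); first by rewrite ltr_wpDl.
move=> x Kx; rewrite -ball_normE /= sub0r normrN.
apply: (@le_lt_trans _ _ (`|M| + 1)); last by rewrite ltrD2l ltr1n.
by apply: HM => //; rewrite ltr_pwDr// ler_norm.
Qed.

Lemma Lmeasurable_ball (x : Rn) (r : R) : Lmeasurable (ball x r).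
Proof. by apply: open_Lmeasurable; exact: ball_open. Qed.

Lemma bounded_integrable (h : Rn -> R) (K : set Rn) (C : R) : Lmeasurable_fun setT h ->
  compact K -> (forall x, ~ K x -> h x = 0) -> (forall x, K x -> `|h x| <= C) ->
  mu.-integrable (setT : set LRn) (EFin \o h).
Proof.
move=> mh cK hK hC; have [r r0 Kr] := compact_in_ball cK.
have iS := @finite_indic_integrable _ LRn R mu (ball (0 : Rn) r) (@Lmeasurable_ball 0 r).
have {}iS := iS (_ : _ < +oo)%E.
have fin : (mu (ball (0 : Rn)%R r) < +oo)%E.
  by rewrite [X in (X < _)%E](@lebesgue_ball R n 0 r r0) ltry.
have {}iS := RintegrableZl `|C| (@measurableT _ LRn) (iS fin).
apply: (@integrable_dominated _ LRn R mu h _ mh iS) => x.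
have [Kx|Kx] := pselect (K x); last first.
  by rewrite hK// normr0; apply: mulr_ge0 => //; rewrite indicE.
rewrite indicE mem_set ?mulr1; last exact: Kr.
by apply: le_trans (hC _ Kx) (ler_norm _).
Qed.

End rV_topology.


Section weak_equation.
Context (R : realType) (n : nat) (s p e : R) (W : R -> R).
Local Notation Rn := 'rV[R]_n.
Local Notation mu := (@lebesgue_rV R n).
Local Notation LRn := (caratheodory_type (@lebesgue_borel R n)^*%mu).
Variables (Om : set Rn) (f g u : Rn -> R) (kap : R) (a c : Rn).
Hypothesis n0 : (0 < n)%N.
Hypothesis s01 : 0 < s < 1.
Hypothesis p0 : 0 < p.
Hypothesis e0 : 0 < e.
Hypotheses (D1 : forall t, derivable W t 1) (D2 : forall t, derivable (derive1 W) t 1).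
Hypothesis c2 : continuous (derive1n 2 W).
Hypothesis W0 : forall t, 0 <= W t.
Hypothesis oOm : open Om.
Hypothesis cf : continuous f.
Hypothesis suppf : compact (supp f).
Hypothesis suppfOm : supp f `<=` Om.
Hypothesis cu : forall x, Om x -> {for x, continuous u}.
Hypothesis weak_u : weak_solution s p e W f g Om u.
Hypothesis bounded_u : (allen_cahn s e W f u Om < +oo)%E.
Hypothesis kap0 : 0 < kap.
Hypothesis ac : forall i, a ord0 i <= c ord0 i.
Hypothesis cOm : cbox a c `<=` Om.
Local Notation phi := (bump kap a c).
Local Notation ee := ((e `^ (2 * s))^-1).

Let mOm : Lmeasurable Om. Proof. exact: open_Lmeasurable. Qed.

Let fu : fin_energy s Om u.
Proof. by case: weak_u => H _ _; exact: Hsg_fin_energy H. Qed.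

Let fphi : fin_energy s Om phi.
Proof. by apply: Hs_fin_energy => //; exact: Hs_bump. Qed.

Let mphi : Lmeasurable_fun setT phi. Proof. exact: measurable_bump. Qed.

Let mu_ : Lmeasurable_fun setT u. Proof. by case: fu. Qed.

Let mf : Lmeasurable_fun setT f. Proof. exact: continuous_Lmeasurable. Qed.

Let integrable_Om (h : Rn -> R) : mu.-integrable (setT : set LRn) (EFin \o h) ->
  mu.-integrable (Om : set LRn) (EFin \o h).
Proof. exact: (@integrableS _ LRn R mu setT Om (EFin \o h) measurableT mOm (@subsetT _ _)). Qed.

Let f0 x : ~ supp f x -> f x = 0.
Proof. by move=> H; apply: contrapT => /eqP fx; apply: H; apply: subset_closure. Qed.

Let phi0 x : ~ cbox a c x -> phi x = 0.
Proof. exact: bump_eq0_cbox. Qed.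

Let cfx x : {for x, continuous f}. Proof. exact: cf. Qed.

Let ifu : mu.-integrable (Om : set LRn) (EFin \o (fun x => f x * u x)).
Proof.
apply: integrable_Om.
have [M M0 HM] := bounded_on_compact suppf (fun x H => cu (suppfOm H)).
have [N N0 HN] := @bounded_on_compact R n (supp f) f suppf (fun x _ => @cfx x).
apply: (@bounded_integrable R n _ (supp f) (N * M) _ suppf).
- exact: (@measurable_funM _ LRn R setT f u mf mu_).
- by move=> x /f0 ->; rewrite mul0r.
- by move=> x xf; rewrite normrM; apply: ler_pM => //; [exact: HN|exact: HM].
Qed.

Let ifphi : mu.-integrable (Om : set LRn) (EFin \o (fun x => f x * phi x)).
Proof.
apply: integrable_Om.
have [N N0 HN] := @bounded_on_compact R n (supp f) f suppf (fun x _ => @cfx x).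
apply: (@bounded_integrable R n _ (supp f) N _ suppf).
- exact: (@measurable_funM _ LRn R setT f phi mf mphi).
- by move=> x /f0 ->; rewrite mul0r.
- move=> x xf; rewrite normrM; apply: le_trans (HN _ xf).
  by rewrite ler_piMr// ger0_norm ?bump_ge0 ?bump_le1.
Qed.

Let ee0 : 0 < ee. Proof. by rewrite invr_gt0 powR_gt0. Qed.

Let int_fin (h : Rn -> R) : mu.-integrable (Om : set LRn) (EFin \o h) ->
  (\int[mu]_(x in Om) (h x)%:E)%E = (\int[mu]_(x in Om) h x)%:E.
Proof. move=> ih; rewrite [RHS]fineK//.
exact: (@integrable_fin_num _ LRn R mu Om mOm _ ih). Qed.

Let finW : (\int[mu]_(x in Om) (W (u x))%:E < +oo)%E.
Proof.
move: bounded_u; rewrite /allen_cahn (energy_qint mOm fu).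
rewrite [X in (_ - X)%E](int_fin ifu).
move=> H; rewrite ltNge leye_eq; apply/negP => /eqP EW; move: H; rewrite EW.
by rewrite gt0_muley ?lte_fin// addey// addye// ltxx.
Qed.

Let cbox_finite : (mu (cbox a c) < +oo)%E.
Proof.
have [r r0 Kr] := compact_in_ball (@compact_cbox R n a c).
have H : (mu (ball (0 : Rn)%R r) < +oo)%E.
  by rewrite [X in (X < _)%E](@lebesgue_ball R n 0 r r0) ltry.
apply: le_lt_trans H; apply: le_measure => //; rewrite inE.
- by apply: closed_Lmeasurable; exact: closed_cbox.
- exact: Lmeasurable_ball.
Qed.

(** Along [u + t phi] the energy is a quadratic polynomial in [t], the source term
    is affine and the potential term has a quadratic remainder, so the derivative
    at 0 can be read off; it vanishes by the definition of weak solution. The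
    bound on the total energy makes each of the three terms finite. *)
Theorem weak_solution_frac_lap :
  frac_lap s Om u phi = pairing Om (fun x => f x - ee * derive1 W (u x)) phi.
Proof.
have [M M0 HM] := bounded_on_compact (@compact_cbox R n a c) (fun x H => cu (cOm H)).
have mcb : Lmeasurable (cbox a c).
  by apply: closed_Lmeasurable; exact: closed_cbox.
have phi1 x : `|phi x| <= 1 by rewrite ger0_norm ?bump_ge0 ?bump_le1.
have [C HC] := @potential_energy_quadratic _ LRn R mu Om (cbox a c) W u phi M mOm mcb cbox_finite
  D1 D2 c2 W0 mu_ mphi phi1 phi0 HM finW.
have iD := integrable_Om (@dpotential_integrable _ LRn R mu (cbox a c) W u phi M mcb cbox_finite
  D2 mu_ mphi phi1 phi0 HM).
set d := \int[mu]_(x in Om) (derive1 W (u x) * phi x) in HC *.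
set w0 := \int[mu]_(x in Om) (W (u x)) in HC *.
pose F t := fine (allen_cahn s e W f (fun x => u x + t * phi x) Om).
pose q := qint s Om phi; pose b := bint s Om u phi.
pose df := \int[mu]_(x in Om) (f x * phi x).
have FE t : `|t| <= 1 -> exists2 w, `|w - w0 - t * d| <= C * t ^+ 2 &
    F t = cns n s / 4 * (qint s Om u + t * (2 * b) + t ^+ 2 * q) + ee * w
      - (\int[mu]_(x in Om) (f x * u x) + t * df).
  move=> t1; have [w Ew Hw] := HC t t1; exists w => //.
  rewrite /F /allen_cahn Ew.
  have futphi : fin_energy s Om (fun x => u x + t * phi x).
    exact: (@finite_energy_lin _ LRn R mu _ Om (@measurable_kernel_pair R n s) (@kernel_ge0 R n s) mOm u phi t fu fphi).
  rewrite (energy_qint mOm futphi).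
  rewrite [qint _ _ _](@int_qform_lin _ LRn R mu _ Om (@measurable_kernel_pair R n s) (@kernel_ge0 R n s) mOm u phi t fu fphi).
  have itf := @RintegrableZl _ LRn R mu Om t _ mOm ifphi.
  have E : (\int[mu]_(x in Om) (f x * (u x + t * phi x))%:E)%E = (\int[mu]_(x in Om) (f x * u x) + t * df)%:E.
    rewrite /df -(@RintegralZl _ LRn R mu Om _ t mOm ifphi).
    rewrite -(@RintegralD _ LRn R mu Om _ _ mOm ifu itf).
    rewrite -int_fin; last exact: (@RintegrableD _ LRn R mu Om _ _ mOm ifu itf).
    by apply: eq_integral => x _; congr EFin; ring.
  by rewrite [X in (_ - X)%E]E -EFinM.
have D0 : is_derive (0 : R) 1 F 0.
  case: weak_u => _ _ H; apply: H; first exact: Htilde_bump.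
  exact: Lp_bump.
have D0' : is_derive (0 : R) 1 F (cns n s / 2 * b + ee * d - df).
  apply: (@is_derive_quadratic R F _ (`|cns n s / 4 * q| + ee * C)) => t t1.
  have [w Hw ->] := FE t t1; have [|w' Hw' ->] := FE 0; first by rewrite normr0.
  have {Hw'}-> : w' = w0.
    move: Hw'; rewrite mul0r subr0 expr0n mulr0 normr_le0 subr_eq0 => /eqP//.
  rewrite [X in `|X|](_ : _ = cns n s / 4 * q * t ^+ 2 + ee * (w - w0 - t * d)); last first.
    by move: (ee) (cns n s) (qint s Om u) => E0 c0 q0; field.
  apply: le_trans (ler_normD _ _) _; rewrite [leRHS]mulrDl; apply: lerD.
    by rewrite [leLHS]normrM (ger0_norm (sqr_ge0 t)).
  by rewrite [leLHS]normrM (gtr0_norm ee0) -mulrA ler_wpM2l// ltW.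
have E0 : cns n s / 2 * b + ee * d - df = 0.
  by rewrite -(@derive_val _ _ _ _ _ _ _ D0') (@derive_val _ _ _ _ _ _ _ D0).
rewrite (frac_lap_bint mOm fu fphi) -/b.
have -> : cns n s / 2 * b = df - ee * d by apply/eqP; rewrite -subr_eq0 -E0; apply/eqP; ring.
have ieD := @RintegrableZl _ LRn R mu Om ee _ mOm iD.
rewrite /df /d -(@RintegralZl _ LRn R mu Om _ ee mOm iD) -(@RintegralB _ LRn R mu Om _ _ mOm ifphi ieD).
by apply: eq_Rintegral => x _; ring.
Qed.

End weak_equation.

(** * Testing against bumps *)

Lemma Rintegral_eq0_ae d (T : measurableType d) (R : realType)
    (mu : {measure set T -> \bar R}) (h : T -> R) :
  mu.-integrable setT (EFin \o h) -> (forall x, 0 <= h x) -> \int[mu]_x h x = 0 ->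
  {ae mu, forall x, h x = 0}.
Proof.
move=> ih h0 int0.
have mh : measurable_fun setT (EFin \o h) by case/integrableP: ih.
have /(ae_eq_integral_abs _ measurableT mh) : (\int[mu]_x `|(EFin \o h) x| = 0)%E.
  under eq_integral do rewrite /= ger0_norm//.
  transitivity ((\int[mu]_x h x)%:E : \bar R); last by rewrite int0.
  by rewrite [RHS]fineK//; exact: integrable_fin_num ih.
by apply: filterS => x /(_ I) [].
Qed.

Section bump_tests.
Context (R : realType) (n : nat).
Local Notation Rn := 'rV[R]_n.
Local Notation mu := (@lebesgue_rV R n).
Local Notation LRn := (caratheodory_type (@lebesgue_borel R n)^*%mu).

Definition bumps_in (U : set Rn) (P : (Rn -> R) -> Prop) : Prop :=
  forall (kap : R) (a c : Rn), 0 < kap -> (forall i, a ord0 i <= c ord0 i) ->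
    cbox a c `<=` U -> P (bump kap a c).

(** Continuity along sequences, the form in which dominated convergence
    establishes it for potentials. *)
Definition seq_continuous_on (U : set Rn) (J : Rn -> R) : Prop :=
  forall (x : Rn) (x_ : nat -> Rn), U x -> (forall k, U (x_ k)) -> x_ @ \oo --> x ->
    J (x_ k) @[k --> \oo] --> J x.

Definition cube_lo (x : Rn) (r : R) : Rn := \row_i (x ord0 i - r).
Definition cube_hi (x : Rn) (r : R) : Rn := \row_i (x ord0 i + r).

Lemma cube_le (x : Rn) (r : R) : 0 <= r -> forall i, cube_lo x r ord0 i <= cube_hi x r ord0 i.
Proof. by move=> r0 i; rewrite !mxE lerD2l; lra. Qed.

Lemma cube_sub_ball (x : Rn) (r t : R) : 0 <= r < t -> cbox (cube_lo x r) (cube_hi x r) `<=` ball x t.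
Proof.
move=> /andP[r0 rt] z zb; rewrite -ball_normE /=; apply: (@le_lt_trans _ _ r) => //.
apply/norm_leP => // i; have := zb i; rewrite !mxE ler_norml; lra.
Qed.

Lemma ball_measure_gt0 (x : Rn) (r : R) : 0 < r -> (0 < mu (ball x r))%E.
Proof. by move=> r0; rewrite [X in (0 < X)%E](@lebesgue_ball R n x r r0) lte_fin exprn_gt0// mulr_gt0. Qed.

Lemma open_ae_exists (U : set Rn) (P : Rn -> Prop) : open U -> U !=set0 ->
  {ae mu, forall x, P x} -> exists2 x, U x & P x.
Proof.
move=> oU [x Ux] [N [mN N0 NP]]; apply: contrapT => H.
have [r /= r0 rU] : exists2 r : R, 0 < r & ball x r `<=` U.
  by have /nbhs_ballP[r r0 rU] := oU x Ux; exists r.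
have : (mu (ball x r) <= mu N)%E.
  apply: le_measure; rewrite ?inE//; first exact: Lmeasurable_ball.
  by move=> y yr; apply: NP => Py; apply: H; exists y => //; exact: rU.
by rewrite N0 leNgt ball_measure_gt0.
Qed.

Lemma bump_integrable (kap : R) (a c : Rn) : 0 < kap -> (forall i, a ord0 i <= c ord0 i) ->
  mu.-integrable (setT : set LRn) (EFin \o bump kap a c).
Proof.
move=> kap0 ac; apply: (@bounded_integrable R n _ (cbox a c) 1 (@measurable_bump R n kap a c) (@compact_cbox R n a c)).
- by move=> x; exact: bump_eq0_cbox.
- by move=> x _; rewrite ger0_norm ?bump_ge0 ?bump_le1.
Qed.

Let tests_le0 (J : Rn -> R) (x0 : Rn) (r : R) : 0 < r ->
  bumps_in (ball x0 r) (fun phi =>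
    mu.-integrable (setT : set LRn) (EFin \o (fun x => phi x * J x)) /\
    \int[mu]_x (phi x * J x) = 0) ->
  seq_continuous_on (ball x0 r) J -> forall x, ball x0 r x -> J x <= 0.
Proof.
move=> r0 tJ cJ x xr; rewrite leNgt; apply/negP => Jx.
have [d d0 dr] : exists2 d : R, 0 < d & ball x d `<=` ball x0 r.
  have := @ball_open R Rn x0 r; rewrite openE => /(_ x xr) /nbhs_ballP[d d0 H].
  by exists d.
have [d' d'0 Jpos] : exists2 d' : R, 0 < d' <= d & forall z, ball x d' z -> 0 < J z.
  apply: contrapT => Hn.
  have H k : exists z, ball x (d / k.+1%:R) z /\ J z <= 0.
    apply: contrapT => H; apply: Hn; exists (d / k.+1%:R).
      by rewrite divr_gt0//= ler_piMr ?invf_le1 ?ler1n// ltW.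
    by move=> z zb; rewrite ltNge; apply/negP => Jz; apply: H; exists z.
  have [z_ /all_and2[zb zJ]] := choice H.
  have zd k : ball x0 r (z_ k).
    apply: dr; apply: le_ball (zb k).
    by rewrite ler_piMr ?invf_le1 ?ler1n// ltW.
  have cz : z_ @ \oo --> x.
    apply/cvgrPdist_lt => e e0; near=> k.
    have := zb k; rewrite -ball_normE => /lt_trans; apply.
    rewrite ltr_pdivrMr// -ltr_pdivrMl//.
    rewrite mulrC (le_lt_trans _ (_ : k%:R < _))//; last by rewrite ltr_nat.
    by near: k; exact: nbhs_infty_ger.
  have /cvgrPdist_lt /(_ _ Jx) /filter_ex[k] := cJ x z_ xr zd cz.
  by have := zJ k; rewrite ltr_norml => H1 /andP[_ H2]; lra.
have /andP[d'p d'd] := d'0.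
have d20 : 0 < d' / 2 by rewrite divr_gt0.
have dd : 0 <= d' / 2 < d' by lra.
set a := cube_lo x (d' / 2); set c := cube_hi x (d' / 2).
have ac : forall i, a ord0 i <= c ord0 i by apply: cube_le; exact: ltW.
have cbd : cbox a c `<=` ball x d' by exact: cube_sub_ball.
have [iJ zJ] := tJ 1 a c ltr01 ac (subset_trans cbd (subset_trans (le_ball d'd) dr)).
have pos z : 0 <= bump 1 a c z * J z.
  have [zb|zb] := pselect (box a c z).
    rewrite mulr_ge0 ?bump_ge0//; apply: ltW; apply: Jpos; apply: cbd => i.
    by have /andP[H1 H2] := zb i; rewrite !ltW.
  by rewrite bump_eq0// mul0r.
have ae0 := @Rintegral_eq0_ae _ LRn R mu _ iJ pos zJ.
have [z zx zz] := open_ae_exists (@ball_open R Rn x (d' / 2)) (ex_intro _ x (ballxx x d20)) ae0.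
have zb : box a c z by rewrite -/(a) /a /c /cube_lo /cube_hi -ball_box.
have := bump_gt0 ltr01 zb; have : 0 < J z.
  by apply: Jpos; apply: le_ball zx; case/andP: dd => _ /ltW.
by move=> H1 H2; have := mulr_gt0 H2 H1; rewrite zz ltxx.
Unshelve. all: by end_near.
Qed.

(** The bumps are nonnegative and concentrate in arbitrarily small cubes, so a
    sequentially continuous function orthogonal to them cannot have a strict sign anywhere. *)
Lemma bump_tests_eq0 (J : Rn -> R) (x0 : Rn) (r : R) : 0 < r ->
  bumps_in (ball x0 r) (fun phi =>
    mu.-integrable (setT : set LRn) (EFin \o (fun x => phi x * J x)) /\
    \int[mu]_x (phi x * J x) = 0) ->
  seq_continuous_on (ball x0 r) J -> forall x, ball x0 r x -> J x = 0.
Proof.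
move=> r0 tJ cJ x xr; apply/eqP; rewrite eq_le (tests_le0 r0 tJ cJ)//= -oppr_le0.
apply: (@tests_le0 (fun x => - J x) x0 r) => //.
- move=> kap a c kap0 ac acU; have [iJ zJ] := tJ kap a c kap0 ac acU.
  have E z : bump kap a c z * - J z = -1 * (bump kap a c z * J z) by ring.
  split.
    have := @RintegrableZl _ LRn R mu setT (-1) _ measurableT iJ.
    by apply: eq_integrable => // z _; rewrite /= E.
  under eq_Rintegral do rewrite E.
  by rewrite (@RintegralZl _ LRn R mu setT _ (-1) measurableT iJ) zJ mulr0.
- by move=> z z_ zr z_r /(cJ _ _ zr z_r) => H; exact: cvgN.
Qed.

End bump_tests.

Lemma rV_neq_gt0 (R : realType) (m : nat) (x y : 'rV[R]_m) : x != y -> (0 < m)%N.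
Proof. by case: m x y => [|m] x y //; rewrite (thinmx0 x) (thinmx0 y) eqxx. Qed.

Section potential_continuity.
Context (R : realType) (n : nat) (s : R).
Hypothesis s01 : 0 < s < 1.
Local Notation Rn := 'rV[R]_n.
Local Notation mu := (@lebesgue_rV R n).
Local Notation LRn := (caratheodory_type (@lebesgue_borel R n)^*%mu).

Let s0 : 0 < s. Proof. by case/andP: s01. Qed.

(** [|x1 - y| <= |x - y| + 2 r <= 3 |x - y|], and the two norms differ by a factor
    at most [n]. *)
Lemma kernel_comparison (x0 x x1 y : Rn) (r : R) : 0 < r -> ball x0 r x -> ball x0 r x1 ->
  ~ ball x0 (2 * r) y ->
  kernel s x y <= (n%:R * 3) `^ (n%:R + 2 * s) * kernel s x1 y.
Proof.
move=> r0; rewrite -!ball_normE /= => xr x1r /negP; rewrite -leNgt => yr.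
set rho := `|x - y|.
have rr : r <= rho.
  have : `|x0 - y| <= `|x0 - x| + rho by exact: ler_distD.
  lra.
have rho0 : 0 < rho by exact: lt_le_trans rr.
apply: le_trans (kernel_le s0 rho0 (lexx _)) _.
have x1y : x1 != y by apply: contraTneq yr => <-; rewrite -ltNge; lra.
have H : `|x1 - y| <= 3 * rho.
  have H1 : `|x1 - y| <= `|x1 - x| + rho by exact: ler_distD.
  have H2 : `|x1 - x| <= `|x0 - x1| + `|x0 - x|.
    by rewrite (distrC x0 x1); exact: ler_distD.
  lra.
have := kernel_ge s0 x1y H; rewrite mulrA.
have n0 := rV_neq_gt0 x1y.
have n3 : 0 <= n%:R * 3 :> R by rewrite mulr_ge0.
rewrite [X in X^-1 <= _ -> _](_ : _ = (n%:R * 3) `^ (n%:R + 2 * s) * rho `^ (n%:R + 2 * s)); last first.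
  by rewrite -powRM// ltW.
have c0 : 0 < (n%:R * 3 : R) `^ (n%:R + 2 * s) by rewrite powR_gt0// mulr_gt0// ltr0n.
by rewrite invfM => H3; rewrite -ler_pdivrMl.
Qed.

Lemma kernel_cvg (x y : Rn) (x_ : nat -> Rn) : x != y -> x_ @ \oo --> x ->
  kernel s (x_ k) y @[k --> \oo] --> kernel s x y.
Proof.
move=> xy cx.
have q0 : 0 < sqn (x - y).
  apply: lt_le_trans (norm_le_sqn _); rewrite exprn_gt0// normr_gt0 subr_eq0//.
have cq : sqn (x_ k - y) @[k --> \oo] --> sqn (x - y).
  rewrite /sqn; elim: (index_enum _) => [|i I IH].
    by rewrite big_nil; under eq_fun do rewrite big_nil; exact: cvg_cst.
  rewrite big_cons; under eq_fun do rewrite big_cons; apply: cvgD IH.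
  have ci : (x_ k - y) ord0 i @[k --> \oo] --> (x - y) ord0 i.
    rewrite !mxE; under eq_fun do rewrite !mxE.
    apply: cvgB; last exact: cvg_cst.
    exact: (@cvg_comp _ _ _ x_ (fun z : Rn => z ord0 i) _ _ _ cx (@continuous_coord R n i x)).
  by rewrite expr2; under eq_fun do rewrite expr2; exact: cvgM.
rewrite kernelE /powR gt_eqF//.
apply: cvg_trans (_ : expR (- ((n%:R + 2 * s) / 2) * ln (sqn (x_ k - y))) @[k --> \oo] --> _).
  apply: near_eq_cvg; near=> k; rewrite kernelE /powR gt_eqF//.
  by near: k; exact: (cvgr_gt _ cq).
apply: (@cvg_comp _ _ _ (fun k => - ((n%:R + 2 * s) / 2) * ln (sqn (x_ k - y))) expR _ (nbhs (- ((n%:R + 2 * s) / 2) * ln (sqn (x - y))))); last exact: continuous_expR.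
apply: cvgM; [exact: cvg_cst|].
apply: (@cvg_comp _ _ _ (fun k => sqn (x_ k - y)) (@ln R) \oo (nbhs (sqn (x - y))) _ cq); exact: continuous_ln.
Unshelve. all: by end_near.
Qed.

Variables (v : Rn -> R) (x0 : Rn) (r : R).
Hypothesis r0 : 0 < r.
Hypothesis mv : Lmeasurable_fun setT v.
Hypothesis v0 : forall y, ball x0 (2 * r) y -> v y = 0.

Lemma measurable_kernel1 (x : Rn) : Lmeasurable_fun setT (kernel s x).
Proof. exact: (@measurable_kernel R n _ LRn s (fun=> x) (fun y => y) (@measurable_cst _ _ LRn LRn setT x) (@measurable_id _ LRn setT)). Qed.

Lemma measurable_potential_integrand (x : Rn) : Lmeasurable_fun setT (fun y => v y * kernel s x y).
Proof. exact: (@measurable_funM _ LRn R setT v (kernel s x) mv (measurable_kernel1 x)). Qed.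

Lemma potential_dominated (x x1 y : Rn) : ball x0 r x -> ball x0 r x1 ->
  `|v y * kernel s x y| <= (n%:R * 3) `^ (n%:R + 2 * s) * `|v y * kernel s x1 y|.
Proof.
move=> xr x1r; have [/v0 ->|yr] := pselect (ball x0 (2 * r) y); first by rewrite (mul0r (kernel s x y)) (mul0r (kernel s x1 y)) normr0 mulr0.
rewrite (normrM (v y) (kernel s x y)) (normrM (v y) (kernel s x1 y)) mulrCA.
apply: ler_wpM2l; first exact: normr_ge0.
rewrite (ger0_norm (kernel_ge0 s x y)) (ger0_norm (kernel_ge0 s x1 y)).
exact: kernel_comparison r0 xr x1r yr.
Qed.

Lemma potential_integrable (x x1 : Rn) : ball x0 r x -> ball x0 r x1 ->
  mu.-integrable (setT : set LRn) (EFin \o (fun y => v y * kernel s x1 y)) ->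
  mu.-integrable (setT : set LRn) (EFin \o (fun y => v y * kernel s x y)).
Proof.
move=> xr x1r i1.
have i2 := @RintegrableZl _ LRn R mu setT ((n%:R * 3) `^ (n%:R + 2 * s)) _ measurableT
  (@integrable_norm _ LRn R mu setT _ i1).
apply: (@integrable_dominated _ LRn R mu _ _ (measurable_potential_integrand x) i2) => y.
exact: potential_dominated.
Qed.

Lemma potential_continuous (x1 : Rn) : ball x0 r x1 ->
  mu.-integrable (setT : set LRn) (EFin \o (fun y => v y * kernel s x1 y)) ->
  seq_continuous_on (ball x0 r) (fun x => \int[mu]_y (v y * kernel s x y)).
Proof.
move=> x1r i1 x x_ xr x_r cx.
have i2 := @RintegrableZl _ LRn R mu setT ((n%:R * 3) `^ (n%:R + 2 * s)) _ measurableT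
  (@integrable_norm _ LRn R mu setT _ i1).
apply: (@Rdominated_cvg _ LRn R mu (fun k y => v y * kernel s (x_ k) y) (fun y => v y * kernel s x y) _
  (fun k => measurable_potential_integrand (x_ k)) (measurable_potential_integrand x) _ i2).
- move=> y; have [vy|vy] := eqVneq (v y) 0.
    rewrite vy mul0r (_ : (fun k => 0 * kernel s (x_ k) y) = fun=> 0); first exact: cvg_cst.
    by apply/funext => k; exact: mul0r.
  apply: cvgM; [exact: cvg_cst|]; apply: kernel_cvg => //; apply: contra_neq vy => <-.
  by apply: v0; apply: le_ball xr; rewrite ler_peMl ?ltW// ltr1n.
- by move=> k y; exact: potential_dominated.
Qed.

(** Testing against bumps supported where [v] vanishes leaves only the
    interaction of [phi] with the far field, that is the potential of [v],
    which is therefore constant; unique continuation applies to it. *)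
Theorem bint_unique_continuation (Om : set Rn) (c : R) : Lmeasurable Om ->
  ball x0 r `<=` Om -> fin_energy s Om v ->
  bumps_in (ball x0 r) (fun phi => bint s Om v phi = c * \int[mu]_x phi x) ->
  {ae mu, forall y, v y = 0}.
Proof.
move=> mOm rOm fv tv.
have fphi (kap : R) (a b : Rn) : 0 < kap -> (forall i, a ord0 i <= b ord0 i) -> fin_energy s Om (bump kap a b).
  by move=> kap0 ab; apply: Hs_fin_energy => //; exact: Hs_bump.
have bump_in (kap : R) (a b x : Rn) : 0 < kap -> cbox a b `<=` ball x0 r -> bump kap a b x != 0 -> ball x0 r x.
  by move=> kap0 abr /eqP px; apply: abr; apply: contrapT => /(bump_eq0_cbox kap0).
have rr : ball x0 r `<=` ball x0 (2 * r) by apply: le_ball; rewrite ler_peMl ?ltW// ltr1n.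
have phiv (kap : R) (a b : Rn) : 0 < kap -> cbox a b `<=` ball x0 r -> forall x, bump kap a b x * v x = 0.
  move=> kap0 abr x; have [->|px] := eqVneq (bump kap a b x) 0; first by rewrite mul0r.
  by rewrite v0 ?mulr0//; apply: rr; exact: bump_in px.
have kC (x y : LRn) : kernel s (x : Rn) (y : Rn) = kernel s (y : Rn) (x : Rn) by exact: kernelC.
have [x1 x1r i1] : exists2 x1, ball x0 r x1 &
    mu.-integrable (setT : set LRn) (EFin \o (fun y => v y * kernel s x1 y)).
  have r2 : 0 < r / 2 by rewrite divr_gt0.
  have r2r : 0 <= r / 2 < r by lra.
  set a := cube_lo x0 (r / 2); set b := cube_hi x0 (r / 2).
  have ab : forall i, a ord0 i <= b ord0 i by apply: cube_le; exact: ltW.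
  have abr : cbox a b `<=` ball x0 r by exact: cube_sub_ball.
  have := @cross_ae_integrable _ LRn R mu _ Om (@measurable_kernel_pair R n s) (@kernel_ge0 R n s) mOm
    v (bump 1 a b) fv (fphi 1 a b ltr01 ab) (phiv 1 a b ltr01 abr)
    (fun x H => rOm x (bump_in 1 a b x ltr01 abr H)).
  move=> /(open_ae_exists (@ball_open R Rn x0 (r / 2)) (ex_intro _ x0 (ballxx x0 r2)))[x xr H].
  exists x; first by apply: le_ball xr; case/andP: r2r => _ /ltW.
  apply: H; rewrite gt_eqF// bump_gt0//.
  by rewrite -/a /a /b /cube_lo /cube_hi -ball_box.
have ivk (x : Rn) : ball x0 r x -> mu.-integrable (setT : set LRn) (EFin \o (fun y => v y * kernel s x y)).
  by move=> xr; exact: potential_integrable x1r i1.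
pose J (x : Rn) := \int[mu]_y (v y * kernel s x y) + c / 2.
have J0 : forall x, ball x0 r x -> J x = 0.
  apply: (@bump_tests_eq0 R n J x0 r r0).
  - move=> kap a b kap0 ab abr.
    have := @int_bform_potential _ LRn R mu _ Om (@measurable_kernel_pair R n s) (@kernel_ge0 R n s) kC mOm
      v (bump kap a b) fv (fphi kap a b kap0 ab) (phiv kap a b kap0 abr)
      (fun x H => rOm x (bump_in kap a b x kap0 abr H)) (fun x H => ivk x (bump_in kap a b x kap0 abr H)).
    rewrite [X in _ /\ X = _ -> _](_ : _ = bint s Om v (bump kap a b))// tv// => -[iI EI].
    have ib := @RintegrableZl _ LRn R mu setT (c / 2) _ measurableT (bump_integrable kap0 ab).
    have E x : bump kap a b x * J x = bump kap a b x * \int[mu]_y (v y * kernel s x y) + c / 2 * bump kap a b x.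
      by rewrite /J; ring.
    split.
      have := @RintegrableD _ LRn R mu setT _ _ measurableT iI ib.
      by apply: eq_integrable => // x _; rewrite /= E.
    under eq_Rintegral do rewrite E.
    rewrite (@RintegralD _ LRn R mu setT _ _ measurableT iI ib).
    rewrite (@RintegralZl _ LRn R mu setT _ (c / 2) measurableT (bump_integrable kap0 ab)).
    by move: EI; lra.
  - move=> x x_ xr x_r cx; apply: cvgD; last exact: cvg_cst.
    exact: (@potential_continuous x1 x1r i1 x x_ xr x_r cx).
apply: (@unique_continuation R n s s01 v x0 r (- (c / 2)) r0 mv v0 (ivk x0 (ballxx x0 r0))).
by move=> x /J0 /eqP; rewrite /J addr_eq0 => /eqP.
Qed.

End potential_continuity.

Section local_integrable_tests.
Context (R : realType) (n : nat).
Local Notation Rn := 'rV[R]_n.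
Local Notation mu := (@lebesgue_rV R n).
Local Notation LRn := (caratheodory_type (@lebesgue_borel R n)^*%mu).

Lemma aeS (P Q : Rn -> Prop) : (forall x, P x -> Q x) ->
  {ae mu, forall x, P x} -> {ae mu, forall x, Q x}.
Proof. by move=> PQ [N [mN N0 NP]]; exists N; split=> // x /= nQ; apply: NP => /PQ. Qed.

(** Lindelof: countably many rational balls inherit the local property. *)
Lemma ae_local (U : set Rn) (P : Rn -> Prop) :
  (forall x, U x -> exists2 r : R, 0 < r & {ae mu, forall y, ball x r y -> P y}) ->
  {ae mu, forall y, U y -> P y}.
Proof.
move=> locP.
pose B (k : nat) : set Rn := if @unpickle ('rV[rat]_n * rat)%type k is Some (q, r) then
  ball (map_mx ratr q : Rn) (ratr r : R) else set0.
have H : {ae mu, forall y, forall k : nat, {ae mu, forall z, B k z -> P z} -> B k y -> P y}.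
  have Hk k : {ae mu, forall y, {ae mu, forall z, B k z -> P z} -> B k y -> P y}.
    have [Hk|Hk] := pselect {ae mu, forall z, B k z -> P z}; first by apply: aeS Hk => y By _.
    by exists set0; split => // y /=; apply: contra_notP => _ /Hk.
  exact: (@ae_foralln _ LRn R mu _ Hk).
apply: aeS H => y Hy Uy; have [r r0 Pr] := locP y Uy.
have [q [rq [yq qr]]] := rational_ball_between y r0.
apply: (Hy (pickle (q, rq))); rewrite /B pickleK//.
by apply: aeS Pr => z Hz /qr; exact: Hz.
Qed.

Lemma flat0_cvg1 (t : R) : 0 < t -> flat 0 (k.+1%:R * t) @[k --> \oo] --> (1 : R).
Proof.
move=> t0.
apply: (@squeeze_cvgr _ _ _ _ (fun k : nat => 1 - t^-1 * (k.+1%:R)^-1) (fun=> 1)).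
- apply: nearW => k; rewrite flat0_le1 andbT /flat pmulr_rgt0 ?t0// expr0 invr1 mul1r.
  by apply: le_trans (expR_ge1Dx _); rewrite invfM mulrC.
- rewrite -[X in _ --> X]subr0; apply: cvgB; first exact: cvg_cst.
  rewrite -[X in _ --> X](mulr0 t^-1); apply: cvgM; first exact: cvg_cst.
  exact: cvg_harmonic.
- exact: cvg_cst.
Qed.

Lemma bump_cvg_indic (a c x : Rn) : bump k.+1%:R a c x @[k --> \oo] --> (\1_(box a c) x : R).
Proof.
have [xb|xb] := pselect (box a c x); last first.
  rewrite indicE memNset//; under eq_fun do rewrite bump_eq0//.
  exact: cvg_cst.
rewrite indicE mem_set//= /bump /bump_term.
elim: (index_enum _) => [|i I IH].
  by under eq_fun do rewrite big_nil; exact: cvg_cst.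
have /andP[H1 H2] := xb i.
have a0 : 0 < x ord0 i - a ord0 i by rewrite subr_gt0.
have c0 : 0 < c ord0 i - x ord0 i by rewrite subr_gt0.
have := cvgM (cvgM (flat0_cvg1 a0) (flat0_cvg1 c0)) IH; rewrite !mulr1.
move=> /(_ _ _)/(fun H => cvg_trans _ H); apply; apply: near_eq_cvg; apply: nearW => k.
by rewrite big_cons.
Qed.

Variable Om : set Rn.
Hypothesis oOm : open Om.
Implicit Types (f : Rn -> R) (a c : Rn) (kap : R).

Let mrestr f : L1loc Om f -> Lmeasurable_fun setT (f \_ Om).
Proof.
by move=> [mf _]; have := (@measurable_restrictT _ _ LRn R Om f (open_Lmeasurable oOm)).1 mf.
Qed.

Lemma L1loc_cbox f a c : L1loc Om f -> cbox a c `<=` Om ->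
  mu.-integrable (setT : set LRn) (EFin \o (fun x => (f \_ Om) x * \1_(cbox a c) x)).
Proof.
move=> lf acO.
have mcb : Lmeasurable (cbox a c) by apply: closed_Lmeasurable; exact: closed_cbox.
have mind : @measurable_fun _ _ LRn R setT \1_(cbox a c) by exact: (@measurable_indic _ LRn R setT _ mcb).
apply/integrableP; split.
  by apply/measurable_EFinP; exact: (@measurable_funM _ LRn R setT _ _ (mrestr lf) mind).
have [_ /(_ _ (@compact_cbox R n a c) acO)] := lf.
rewrite [X in (X < _)%E -> _](@integral_mkcond _ LRn R mu (cbox a c)) => H; apply: le_lt_trans H.
rewrite le_eqVlt; apply/orP; left; apply/eqP; apply: eq_integral => x _ /=.
rewrite [RHS]patchE indicE; case: ifPn => xb; last by rewrite mulr0 normr0.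
by rewrite mulr1 patchE ifT// inE; apply: acO; rewrite inE in xb.
Qed.

Lemma L1loc_pairing f a c kap : 0 < kap -> L1loc Om f -> cbox a c `<=` Om ->
  mu.-integrable (setT : set LRn) (EFin \o (fun x => (f \_ Om) x * bump kap a c x)) /\
  pairing Om f (bump kap a c) = \int[mu]_x ((f \_ Om) x * bump kap a c x).
Proof.
move=> kap0 lf acO; split.
  have := @integrable_mul_bounded _ LRn R mu _ (bump kap a c) 1 (L1loc_cbox lf acO) (measurable_bump _ _ _).
  have H x : (fun x => (f \_ Om) x * \1_(cbox a c) x) x != 0 -> `|bump kap a c x| <= 1.
    by move=> _; rewrite ger0_norm ?bump_ge0 ?bump_le1.
  move=> /(_ H); apply: eq_integrable => // x _ /=; congr EFin.
  rewrite -mulrA; congr (_ * _); rewrite indicE.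
  have [xb|xb] := boolP (x \in cbox a c); first by rewrite mul1r.
  by rewrite mul0r bump_eq0_cbox// => xb'; move/negP: xb; apply; rewrite inE.
rewrite /pairing /Rintegral; congr fine; rewrite [LHS](@integral_mkcond _ LRn R mu Om).
by apply: eq_integral => x _; rewrite !patchE; case: ifP => // _; rewrite mul0r.
Qed.

(** The bumps increase to the indicator of an open box as they steepen, so the
    signed density [f1 - f2] has no mass on boxes, which determine it. *)
Lemma pairing_eq_ae f1 f2 : L1loc Om f1 -> L1loc Om f2 ->
  bumps_in Om (fun phi => pairing Om f1 phi = pairing Om f2 phi) ->
  {ae mu, forall x, Om x -> f1 x = f2 x}.
Proof.
move=> l1 l2 tf; pose h x := (f1 \_ Om) x - (f2 \_ Om) x.
have mh : Lmeasurable_fun setT h.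
  exact: (@measurable_funB _ LRn R setT _ _ (mrestr l1) (mrestr l2)).
have ih a c : cbox a c `<=` Om ->
    mu.-integrable (setT : set LRn) (EFin \o (fun x => h x * \1_(cbox a c) x)).
  move=> acO; have := @RintegrableB _ LRn R mu setT _ _ measurableT (L1loc_cbox l1 acO) (L1loc_cbox l2 acO).
  by apply: eq_integrable => // x _ /=; rewrite /h mulrBl.
have hbox a c : (forall i, a ord0 i <= c ord0 i) -> cbox a c `<=` Om ->
    \int[mu]_x (h x * \1_(box a c) x) = 0.
  move=> ac acO.
  have mbk k : Lmeasurable_fun setT (fun x => h x * bump k.+1%:R a c x).
    exact: (@measurable_funM _ LRn R setT h _ mh (measurable_bump _ _ _)).
  have mb : Lmeasurable_fun setT (fun x => h x * \1_(box a c) x).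
    exact: (@measurable_funM _ LRn R setT h _ mh (measurable_box_indic _ _)).
  have cv (x : LRn) : h x * bump k.+1%:R a c x @[k --> \oo] --> h x * \1_(box a c) x.
    by apply: cvgM; [exact: cvg_cst|exact: bump_cvg_indic].
  have dom (k : nat) (x : LRn) : `|h x * bump k.+1%:R a c x| <= `|h x * \1_(cbox a c) x|.
    rewrite (normrM (h x)) (normrM (h x)) ler_wpM2l// ger0_norm ?bump_ge0// ger0_norm ?indicE//.
    have [xb|xb] := boolP (x \in cbox a c); first exact: bump_le1.
    by rewrite bump_eq0_cbox// => xb'; move/negP: xb; apply; rewrite inE.
  have := @Rdominated_cvg _ LRn R mu _ _ _ mbk mb cv (@integrable_norm _ LRn R mu setT _ (ih a c acO)) dom.
  rewrite (_ : (fun k => _) = fun=> 0).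
    by move=> H; apply: (cvg_unique (@Rhausdorff R) H); exact: cvg_cst.
  apply/funext => k; have k0 : 0 < k.+1%:R :> R by rewrite ltr0n.
  have [i1 E1] := L1loc_pairing k0 l1 acO; have [i2 E2] := L1loc_pairing k0 l2 acO.
  have := tf k.+1%:R a c k0 ac acO; rewrite E1 E2 => E12.
  transitivity (\int[mu]_x ((f1 \_ Om) x * bump k.+1%:R a c x - (f2 \_ Om) x * bump k.+1%:R a c x)).
    by apply: eq_Rintegral => x _; rewrite /h mulrBl.
  by rewrite (@RintegralB _ LRn R mu setT _ _ measurableT i1 i2) E12 subrr.
apply: ae_local => x Ox.
have [r /= r0 rO] : exists2 r : R, 0 < r & ball x r `<=` Om.
  by have /nbhs_ballP[r r0 rU] := oOm Ox; exists r.
have r2 : 0 < r / 2 by rewrite divr_gt0.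
exists (r / 2) => //.
have r2r : 0 <= r / 2 < r by lra.
set a := cube_lo x (r / 2); set c := cube_hi x (r / 2).
have ac : forall i, a ord0 i <= c ord0 i by apply: cube_le; exact: ltW.
have acO : cbox a c `<=` Om by apply: subset_trans rO; exact: cube_sub_ball.
pose w (y : LRn) := h y * \1_(box a c) y.
have iw : mu.-integrable (setT : set LRn) (EFin \o w).
  apply: (@integrable_dominated _ LRn R mu w _ _ (@integrable_norm _ LRn R mu setT _ (ih a c acO))).
    exact: (@measurable_funM _ LRn R setT h _ mh (measurable_box_indic _ _)).
  move=> y; rewrite /w /= (normrM (h y)) (normrM (h y)) ler_wpM2l// !indicE.
  have [xb|xb] := boolP (y \in box a c); last by rewrite normr0.
  rewrite mem_set// => i; rewrite inE in xb; have /andP[H1 H2] := xb i; by rewrite !ltW.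
have worth (d : Rn) : \int[mu]_y (w y * \1_(orthant d) (y : Rn)) = 0.
  pose c' : Rn := \row_i Num.min (c ord0 i) (d ord0 i).
  have c'E i : c' ord0 i = Num.min (c ord0 i) (d ord0 i) by rewrite mxE.
  have E (y : Rn) : w y * \1_(orthant d) y = h y * \1_(box a c') y.
    rewrite /w -mulrA; congr (_ * _); rewrite !indicE -natrM mulnb; congr (nat_of_bool _)%:R.
    apply/idP/idP => [/andP[]|]; rewrite !inE.
      by move=> H1 H2 i; rewrite c'E lt_min (H2 i) andbT; exact: H1.
    move=> H; apply/andP; split; rewrite inE => i; have := H i; rewrite c'E lt_min.
      by case/and3P => -> ->.
    by case/and3P.
  under eq_Rintegral do rewrite E.
  have [ac'|ac'] := pselect (forall i, a ord0 i <= c' ord0 i).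
    apply: hbox => //; apply: subset_trans acO => z zb i; have := zb i; rewrite c'E le_min.
    by case/and3P => -> ->.
  transitivity (\int[mu]_(x in (setT : set LRn)) (0 : R)); last first.
    by rewrite (@Rintegral_cst _ LRn R mu setT measurableT) mul0r.
  apply: eq_Rintegral => y _; rewrite indicE memNset ?mulr0// => yb; apply: ac' => i.
  by have /andP[H1 H2] := yb i; rewrite ltW// (lt_trans H1).
have mid : @measurable_fun _ _ Rn Rn setT (fun y => y) by exact: measurable_id.
have := @pullback_density_eq0 R n w (fun y => y) (fun y => y) iw mid (fun=> erefl).
have mZ : @measurable_fun _ _ LRn Rn setT (fun y => y).
  exact: (@borel_fun_Lmeasurable R n _ Rn (fun y => y) mid).
move=> /(_ (fun A mA => @orthant_unique R n _ LRn mu w (fun y => y) A iw mZ worth mA)).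
apply: aeS => y wy yr.
have yb : box a c y by rewrite -/a /a /c /cube_lo /cube_hi -ball_box.
move: wy; rewrite /w indicE mem_set// mulr1 /h !patchE mem_set; last first.
  by apply: acO => i; have /andP[H1 H2] := yb i; rewrite !ltW.
by move/eqP; rewrite subr_eq0 => /eqP.
Qed.

End local_integrable_tests.

(** * Real analytic functions of one variable *)

Section analytic_identity.
Context {R : realType}.
Implicit Types (h W : R -> R) (a : nat -> R).

(** The terms are bounded at radius [rho < r], so beyond the first nonzero one
    they are dominated by a geometric series of ratio at most 1/2. *)
Lemma power_series_remainder h a (x0 r : R) : 0 < r ->
  (forall x, `|x - x0| < r -> series (fun k => a k * (x - x0) ^+ k) @ \oo --> h x) ->
  exists B rho : R, [/\ 0 <= B, 0 < rho, rho < r & forall m y, `|y| <= rho / 2 ->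
    (forall k, (k < m)%N -> a k = 0) ->
    `|h (x0 + y) - a m * y ^+ m| <= 2 * B * (`|y| / rho) ^+ m.+1].
Proof.
move=> r0 ha; pose rho := r / 2; have rho0 : 0 < rho by rewrite divr_gt0.
have rhor : rho < r by rewrite /rho; lra.
have [B B0 HB] : exists2 B : R, 0 <= B & forall k, `|a k| * rho ^+ k <= B.
  have /ha : `|x0 + rho - x0| < r by rewrite addrAC subrr add0r gtr0_norm.
  rewrite addrAC subrr add0r => /(cvgP _)/cvg_series_cvg_0/(cvgP _)/cvg_seq_bounded[M [_ HM]].
  exists (`|M| + 1); first by rewrite addr_ge0.
  move=> k; have := HM (`|M| + 1); rewrite ltr_pwDr ?ler_norm// => /(_ isT k I) /=.
  by rewrite normrM normrX (gtr0_norm rho0).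
exists B, rho; split=> // m y yrho am.
pose q := `|y| / rho.
have q0 : 0 <= q by rewrite divr_ge0// ltW.
have q2 : q <= 2^-1 by rewrite ler_pdivrMr// mulrC.
have ineq N : (m.+1 <= N)%N ->
    `|\sum_(0 <= k < N) a k * y ^+ k - a m * y ^+ m| <= 2 * B * (q ^+ m.+1 - q ^+ N).
  elim: N => // N IH; rewrite leq_eqVlt => /orP[/eqP[<-]|mN].
    rewrite big_nat_recr//= [X in X + _ - _]big1_seq ?add0r ?subrr ?normr0 ?mulr0//.
    by move=> k; rewrite mem_index_iota => /andP[_ /am ->]; rewrite mul0r.
  rewrite big_nat_recr//= addrAC; apply: le_trans (ler_normD _ _) _.
  apply: le_trans (lerD (IH mN) (_ : _ <= B * q ^+ N)) _.
    rewrite normrM normrX /q exprMn exprVn mulrA ler_pdivlMr ?exprn_gt0//.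
    by rewrite mulrAC ler_wpM2r// exprn_ge0.
  have qN : 0 <= q ^+ N by exact: exprn_ge0.
  have H1 : q ^+ N.+1 <= 2^-1 * q ^+ N by rewrite exprS ler_wpM2r.
  have := mulr_ge0 B0 qN; have := ler_wpM2l B0 H1; rewrite !mulrBr.
  move: (q ^+ N) (q ^+ N.+1) (q ^+ m.+1) => Q Q1 Qm; lra.
have /ha : `|x0 + y - x0| < r.
  rewrite addrAC subrr add0r; apply: le_lt_trans yrho _; lra.
rewrite addrAC subrr add0r => cy.
have cyn : `|series (fun k => a k * y ^+ k) N - a m * y ^+ m| @[N --> \oo] --> `|h (x0 + y) - a m * y ^+ m|.
  by apply: cvg_norm; apply: cvgB => //; exact: cvg_cst.
apply: (cvgr_to_le cyn).
near=> N; apply: le_trans (ineq N _) _; first by near: N; exact: nbhs_infty_ge.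
by rewrite ler_wpM2l ?mulr_ge0// lerBlDr lerDl exprn_ge0.
Unshelve. all: by end_near.
Qed.

(** The lowest nonzero coefficient dominates near the centre, so the centre of a
    nonzero expansion is isolated among the zeros. *)
Lemma power_series_eq0 h a (x0 r : R) : 0 < r ->
  (forall x, `|x - x0| < r -> series (fun k => a k * (x - x0) ^+ k) @ \oo --> h x) ->
  (forall e : R, 0 < e -> exists y, [/\ y != 0, `|y| < e & h (x0 + y) = 0]) ->
  forall x, `|x - x0| < r -> h x = 0.
Proof.
move=> r0 ha acc; have [B [rho [B0 rho0 rhor H]]] := power_series_remainder r0 ha.
have a0 k : a k = 0.
  have [m] := ubnP k; elim: m k => // m IH k; rewrite ltnS => km.
  have ak0 j : (j < k)%N -> a j = 0 by move=> jk; apply: IH; exact: leq_trans km.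
  apply/eqP; rewrite -normr_le0; apply/ler_addgt0Pr => e e0; rewrite add0r.
  pose d := Num.min (rho / 2) (e / (2 * B + 1) * rho ^+ k.+1).
  have c0 : 0 < 2 * B + 1 by rewrite ltr_wpDl// mulr_ge0.
  have d0 : 0 < d by rewrite lt_min !divr_gt0//= mulr_gt0 ?exprn_gt0// divr_gt0.
  have [y [y0 yd hy]] := acc d d0.
  have [yd1 yd2] : `|y| < rho / 2 /\ `|y| < e / (2 * B + 1) * rho ^+ k.+1.
    by move: yd; rewrite lt_min => /andP[].
  have := H k y (ltW yd1) ak0; rewrite hy sub0r normrN normrM normrX expr_div_n.
  have yk : 0 < `|y| ^+ k by rewrite exprn_gt0// normr_gt0.
  rewrite [`|y| ^+ k.+1]exprSr -!mulrA mulrCA [_ * (_ * (_ * _))]mulrC.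
  have rk : 0 < rho ^+ k.+1 by rewrite exprn_gt0.
  move=> H1.
  have H2 : `|a k| <= 2 * B * (`|y| / rho ^+ k.+1).
    rewrite -(ler_pM2r yk); apply: le_trans H1 _; rewrite le_eqVlt; apply/orP; left; apply/eqP; ring.
  apply: le_trans H2 _; apply: le_trans (_ : (2 * B + 1) * (`|y| / rho ^+ k.+1) <= _).
    by apply: ler_wpM2r; [rewrite divr_ge0// ltW|rewrite lerDl].
  by rewrite mulrC -ler_pdivlMr// ler_pdivrMr// ltW.
move=> x xr; apply: (cvg_unique (@Rhausdorff R) (ha x xr)).
rewrite (_ : series _ = fun=> 0); first exact: cvg_cst.
by apply/funext => N; rewrite /series /= big1// => k _; rewrite a0 mul0r.
Qed.

Lemma real_analyticB W1 W2 (c : R) : real_analytic W1 -> real_analytic W2 ->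
  real_analytic (fun x => W1 x - W2 x - c).
Proof.
move=> A1 A2 x0; have [r1 [a1 [r10 H1]]] := A1 x0; have [r2 [a2 [r20 H2]]] := A2 x0.
exists (Num.min r1 r2), (fun k => a1 k - a2 k - c * (k == 0%N)%:R).
split; first by rewrite lt_min r10.
move=> x; rewrite lt_min => /andP[/H1 c1 /H2 c2].
have c3 : series (fun k => c * (k == 0%N)%:R * (x - x0) ^+ k) @ \oo --> c.
  apply: cvg_near_cst; near=> N; rewrite /series /=.
  have [N' ->] : exists N', N = N'.+1 by exists N.-1; rewrite prednK//; near: N; exact: nbhs_infty_gt.
  rewrite big_nat_recl//= expr0 !mulr1 big1 ?addr0// => k _.
  by rewrite mulr0 mul0r.
rewrite (_ : series _ = series (fun k => a1 k * (x - x0) ^+ k) - series (fun k => a2 k * (x - x0) ^+ k)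
  - series (fun k => c * (k == 0%N)%:R * (x - x0) ^+ k)); first exact: cvgB (cvgB c1 c2) c3.
apply/funext => N; rewrite /series !fctE /= -!sumrB.
by apply: eq_bigr => k _; ring.
Unshelve. all: by end_near.
Qed.

(** The interior of the zero set is open by definition and closed by
    [power_series_eq0], and the line is connected. *)
Theorem real_analytic_identity h (x0 r : R) : real_analytic h -> 0 < r ->
  (forall x, `|x - x0| < r -> h x = 0) -> forall x, h x = 0.
Proof.
move=> A r0 h0.
pose Z : set R := [set x | exists2 e : R, 0 < e & forall y, `|y - x| < e -> h y = 0].
have Zh x : Z x -> h x = 0 by move=> [e e0]; apply; rewrite subrr normr0.
suff ZT : Z = setT by move=> x; apply: Zh; rewrite ZT.
have oZ : open Z.
  rewrite openE => x [e e0 xe]; apply/nbhs_ballP; exists (e / 2); first by rewrite /= divr_gt0.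
  move=> y; rewrite -ball_normE /= => xy; exists (e / 2); first by rewrite divr_gt0.
  move=> z zy; apply: xe; have := ler_distD y z x; rewrite (distrC y x).
  lra.
have cZ : closed Z.
  move=> x xZ; have [e [a [e0 ha]]] := A x.
  exists e => //; apply: (power_series_eq0 e0 ha) => d d0.
  have [y [Zy]] := xZ _ (nbhsx_ballx x d d0); rewrite -ball_normE /= => xy.
  have [Ez|/eqP yx] := eqVneq y x; last first.
    by exists (y - x); rewrite subr_eq0 (negbT (introF eqP yx)) distrC; split=> //; rewrite addrCA subrr addr0; exact: Zh.
  have [b b0 Hb] := Zy; pose t := Num.min b d / 2.
  have t0 : 0 < t by rewrite divr_gt0// lt_min b0.
  have [tb td] : t < b /\ t < d.
    rewrite /t; have : Num.min b d <= b by rewrite ge_min lexx.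
    have : Num.min b d <= d by rewrite ge_min lexx orbT.
    by split; move: t0; rewrite /t; lra.
  exists t; split; [by rewrite gt_eqF|by rewrite gtr0_norm|].
  by apply: Hb; rewrite Ez addrAC subrr add0r gtr0_norm.
have /connected_intervalP cT : is_interval [set: R] by [].
apply: cT.
- by exists x0; exists r.
- by exists Z => //; rewrite setTI.
- by exists Z => //; rewrite setTI.
Qed.

End analytic_identity.

(** * Continuation for functions of finite energy *)

Section bump_pairings.
Context (R : realType) (n : nat) (s : R).
Hypothesis s01 : 0 < s < 1.
Hypothesis n0 : (0 < n)%N.
Local Notation Rn := 'rV[R]_n.
Local Notation mu := (@lebesgue_rV R n).
Local Notation LRn := (caratheodory_type (@lebesgue_borel R n)^*%mu).
Implicit Types (Om : set Rn) (h u : Rn -> R).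

Lemma bump_mul_integrable h (kap : R) (a c : Rn) : 0 < kap -> Lmeasurable_fun setT h ->
  (forall x, cbox a c x -> {for x, continuous h}) ->
  mu.-integrable (setT : set LRn) (EFin \o (fun x => h x * bump kap a c x)).
Proof.
move=> kap0 mh ch; have [M M0 HM] := bounded_on_compact (@compact_cbox R n a c) ch.
apply: (@bounded_integrable R n _ (cbox a c) M _ (@compact_cbox R n a c)).
- exact: (@measurable_funM _ LRn R setT h _ mh (@measurable_bump R n kap a c)).
- by move=> x xb; rewrite bump_eq0_cbox// mulr0.
- move=> x xb; rewrite (normrM (h x)) (ger0_norm (bump_ge0 _ _ _ _)).
  by apply: le_trans (HM x xb); rewrite ler_piMr ?bump_le1.
Qed.

Lemma pairing_int Om h (kap : R) (a c : Rn) : 0 < kap -> cbox a c `<=` Om ->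
  pairing Om h (bump kap a c) = \int[mu]_x (h x * bump kap a c x).
Proof.
move=> kap0 acO; rewrite /pairing /Rintegral; congr fine.
rewrite [LHS](@integral_mkcond _ LRn R mu Om).
apply: eq_integral => x _; rewrite !patchE; case: ifPn => // xO.
rewrite bump_eq0_cbox ?mulr0// => /acO xO'; by move/negP: xO; apply; rewrite inE.
Qed.

Lemma cvg_Hminus_test Om (T_ : nat -> (Rn -> R) -> R) T phi : cvg_Hminus s Om T_ T ->
  test Om phi -> Hs s phi -> T_ k phi @[k --> \oo] --> T phi.
Proof.
move=> [_ _ cT] tphi [_ fin].
have N0 : (0 <= Hs_norm s phi)%E by exact: poweR_ge0.
have EN : Hs_norm s phi = (fine (Hs_norm s phi))%:E by rewrite fineK// ge0_fin_numE.
set N := fine (Hs_norm s phi) in EN.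
have {}N0 : 0 <= N by rewrite fine_ge0.
apply/cvgrPdist_le => e e0.
have e1 : 0 < e / (N + 1) by rewrite divr_gt0// ltr_wpDl.
have := cT _ e1; apply: filterS => k /(_ _ tphi); rewrite EN -EFinM lee_fin distrC.
move=> H; apply: le_trans H _; rewrite mulrAC ler_pdivrMr ?ltr_wpDl//.
by rewrite ler_pM2l// lerDl.
Qed.

Lemma ae_eq_continuous (U : set Rn) u1 u2 : open U ->
  (forall x, U x -> {for x, continuous u1}) -> (forall x, U x -> {for x, continuous u2}) ->
  {ae mu, forall x, u1 x = u2 x} -> forall x, U x -> u1 x = u2 x.
Proof.
move=> oU c1 c2 ae x Ux; apply/eqP; apply: contrapT => /negP ne.
have d0 : 0 < `|u1 x - u2 x| by rewrite normr_gt0 subr_eq0.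
have c1x : u1 @ x --> u1 x by exact: c1.
have c2x : u2 @ x --> u2 x by exact: c2.
have cc : (u1 - u2) @ x --> u1 x - u2 x by exact: cvgB c1x c2x.
move/cvgrPdist_lt : cc => /(_ _ d0)/nbhs_ballP[r /= r0 rH].
have [y yr E] := open_ae_exists (@ball_open R Rn x r) (ex_intro _ x (ballxx x r0)) ae.
by have := rH y yr; rewrite !fctE E subrr subr0 ltxx.
Qed.

Let kge0 (x y : LRn) : 0 <= kernel s (x : Rn) (y : Rn). Proof. exact: kernel_ge0. Qed.

Lemma fin_energy_bump Om (kap : R) (a c : Rn) : Lmeasurable Om -> 0 < kap ->
  (forall i, a ord0 i <= c ord0 i) -> fin_energy s Om (bump kap a c).
Proof. by move=> mOm kap0 ac; apply: Hs_fin_energy => //; exact: Hs_bump. Qed.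

Lemma fin_energyB Om u1 u2 : Lmeasurable Om -> fin_energy s Om u1 -> fin_energy s Om u2 ->
  fin_energy s Om (fun x => u1 x - u2 x).
Proof.
move=> mOm f1 f2.
exact: (@finite_energyB _ LRn R mu _ Om (@measurable_kernel_pair R n s) kge0 mOm u1 u2 f1 f2).
Qed.

Lemma bintB Om u1 u2 phi : Lmeasurable Om -> fin_energy s Om u1 -> fin_energy s Om u2 ->
  fin_energy s Om phi -> bint s Om (fun x => u1 x - u2 x) phi = bint s Om u1 phi - bint s Om u2 phi.
Proof.
move=> mOm f1 f2 f3.
exact: (@int_bformB _ LRn R mu _ Om (@measurable_kernel_pair R n s) kge0 mOm u1 u2 phi f1 f2 f3).
Qed.

Lemma frac_lap_ae Om u1 u2 phi : Lmeasurable Om -> fin_energy s Om u1 -> fin_energy s Om u2 ->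
  fin_energy s Om phi -> {ae mu, forall x, u1 x = u2 x} ->
  frac_lap s Om u1 phi = frac_lap s Om u2 phi.
Proof.
move=> mOm f1 f2 f3 ae; rewrite !frac_lap_bint//; congr (_ * _).
exact: (@bform_ae _ LRn R mu _ Om (@measurable_kernel_pair R n s) kge0 mOm u1 u2 phi f1 f2 f3 ae).
Qed.

Lemma energy_ae Om u1 u2 : Lmeasurable Om -> Lmeasurable_fun setT u1 -> Lmeasurable_fun setT u2 ->
  {ae mu, forall x, u1 x = u2 x} -> energy s u1 Om = energy s u2 Om.
Proof.
move=> mOm m1 m2 ae.
have E u : Lmeasurable_fun setT u -> energy s u Om =
    ((cns n s / 4)%:E * \int[mu \x mu]_p (@qform _ LRn R (kernel s) Om u p)%:E)%E.
  move=> mu_; congr (_ * _)%E.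
  exact: (@two_fold_qform _ LRn R mu _ Om (@measurable_kernel_pair R n s) kge0 mOm u mu_).
rewrite (E u1 m1) (E u2 m2); congr (_ * _)%E.
exact: (@qform_ae _ LRn R mu _ Om (@measurable_kernel_pair R n s) mOm u1 u2 m1 m2 ae).
Qed.

Lemma fin_energy_cst Om (c : R) : Lmeasurable Om -> fin_energy s Om (fun=> c).
Proof.
move=> mOm; have mc : @Lmeasurable_fun R n setT (fun=> c) by apply: continuous_Lmeasurable; exact: cst_continuous.
apply: (@finite_energyP _ LRn R mu _ Om (@measurable_kernel_pair R n s) kge0 mOm (fun=> c) mc).
rewrite [X in (X < _)%E](_ : _ = 0%E)// /two_fold.
have d0 A B : dint (mu : {measure set LRn -> \bar R}) A B (fun x y => ((c - c) ^+ 2 * kernel s (x : Rn) (y : Rn))%R) = 0%E.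
  rewrite /dint integral0_eq// => x _; rewrite integral0_eq// => y _.
  by rewrite subrr expr0n mul0r.
by rewrite !d0 mule0 adde0.
Qed.

Lemma unique_continuation_two Om u1 u2 (x0 : Rn) (r : R) : open Om -> 0 < r ->
  ball x0 (2 * r) `<=` Om -> fin_energy s Om u1 -> fin_energy s Om u2 ->
  (forall y, ball x0 (2 * r) y -> u1 y = u2 y) ->
  bumps_in (ball x0 r) (fun phi => frac_lap s Om u1 phi = frac_lap s Om u2 phi) ->
  {ae mu, forall y, u1 y = u2 y}.
Proof.
move=> oOm r0 rO f1 f2 u12 H; have mOm := open_Lmeasurable oOm.
have rr : ball x0 r `<=` Om by apply: subset_trans rO; apply: le_ball; rewrite ler_peMl ?ltW// ltr1n.
have fv := fin_energyB mOm f1 f2; have [mv _] := fv.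
have v0 y : ball x0 (2 * r) y -> u1 y - u2 y = 0 by move/u12 ->; rewrite subrr.
have := @bint_unique_continuation R n s s01 (fun x => u1 x - u2 x) x0 r r0 mv v0 Om 0 mOm rr fv.
move=> UC; apply: (aeS _ (UC _)) => [y|]; first by move/eqP; rewrite subr_eq0 => /eqP.
move=> kap a c kap0 ac acr; rewrite mul0r.
have fphi := fin_energy_bump mOm kap0 ac.
have := H kap a c kap0 ac acr; rewrite !frac_lap_bint// => /mulfI E.
rewrite bintB// E ?subrr// gt_eqF// divr_gt0//; exact: cns_gt0.
Qed.

Lemma unique_continuation_cst Om u (c C : R) (x0 : Rn) (r : R) : open Om -> 0 < r ->
  ball x0 (2 * r) `<=` Om -> fin_energy s Om u ->
  (forall y, ball x0 (2 * r) y -> u y = c) ->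
  bumps_in (ball x0 r) (fun phi => frac_lap s Om u phi = C * \int[mu]_x phi x) ->
  {ae mu, forall y, u y = c}.
Proof.
move=> oOm r0 rO f1 uc H; have mOm := open_Lmeasurable oOm.
have rr : ball x0 r `<=` Om by apply: subset_trans rO; apply: le_ball; rewrite ler_peMl ?ltW// ltr1n.
have f2 := fin_energy_cst c mOm.
have fv := fin_energyB mOm f1 f2; have [mv _] := fv.
have v0 y : ball x0 (2 * r) y -> u y - c = 0 by move/uc ->; rewrite subrr.
have c0 : 0 < cns n s by exact: cns_gt0.
have := @bint_unique_continuation R n s s01 (fun x => u x - c) x0 r r0 mv v0 Om (C / (cns n s / 2)) mOm rr fv.
move=> UC; apply: (aeS _ (UC _)) => [y|]; first by move/eqP; rewrite subr_eq0 => /eqP.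
move=> kap a b kap0 ab abr; have fphi := fin_energy_bump mOm kap0 ab.
rewrite bintB// [X in _ - X](_ : _ = 0); last first.
  transitivity (\int[(mu \x mu)%E]_(p in (setT : set (LRn * LRn))) (0 : R)).
    by apply: eq_Rintegral => p _; rewrite /bform subrr !mul0r.
  by rewrite /Rintegral integral0.
have := H kap a b kap0 ab abr; rewrite frac_lap_bint// subr0 => E.
apply: (@mulfI _ (cns n s / 2)); first by rewrite gt_eqF// divr_gt0.
by rewrite E; move: (cns n s / 2) (divr_gt0 c0 (ltr0Sn R 1)) => D D0; rewrite mulrA mulrCA divff ?mulr1// gt_eqF.
Qed.

End bump_pairings.

(** * One sequence of solutions *)

Lemma eq_pairing (R : realType) (n : nat) (Om : set 'rV[R]_n) (h1 h2 phi : 'rV[R]_n -> R) :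
  (forall x, Om x -> h1 x = h2 x) -> pairing Om h1 phi = pairing Om h2 phi.
Proof.
move=> H; rewrite /pairing; congr fine; apply: eq_integral => x xO.
by rewrite H//; exact: set_mem xO.
Qed.

Lemma bump_pairing_inj (R : realType) (n : nat) (Om V : set 'rV[R]_n) (h1 h2 : 'rV[R]_n -> R) :
  open V -> V `<=` Om -> Lmeasurable_fun setT h1 -> Lmeasurable_fun setT h2 ->
  (forall x, V x -> {for x, continuous h1}) -> (forall x, V x -> {for x, continuous h2}) ->
  bumps_in V (fun phi => pairing Om h1 phi = pairing Om h2 phi) ->
  forall x, V x -> h1 x = h2 x.
Proof.
move=> oV VO m1 m2 c1 c2 H x Vx.
have [r /= r0 rV] : exists2 r : R, 0 < r & ball x r `<=` V.
  by have /nbhs_ballP[r r0 rU] := oV x Vx; exists r.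
apply/eqP; rewrite -subr_eq0; apply/eqP.
apply: (@bump_tests_eq0 R n (fun y => h1 y - h2 y) x r r0) => //; last exact: ballxx.
- move=> kap a c kap0 ac acr; have acV := subset_trans acr rV.
  have i1 := bump_mul_integrable kap0 m1 (fun y Hy => c1 y (acV y Hy)).
  have i2 := bump_mul_integrable kap0 m2 (fun y Hy => c2 y (acV y Hy)).
  have E y : bump kap a c y * (h1 y - h2 y) = h1 y * bump kap a c y - h2 y * bump kap a c y by ring.
  split.
    have := @RintegrableB _ _ R _ setT _ _ measurableT i1 i2.
    by apply: eq_integrable => // y _; rewrite /= E.
  under eq_Rintegral do rewrite E.
  rewrite (@RintegralB _ _ R _ setT _ _ measurableT i1 i2).
  have := H kap a c kap0 ac acV; rewrite (pairing_int _ kap0 (subset_trans acV VO)).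
  by rewrite (pairing_int _ kap0 (subset_trans acV VO)) => ->; rewrite subrr.
- move=> y y_ yr y_r cy; apply: cvgB.
    exact: (@cvg_comp _ _ _ y_ h1 _ _ _ cy (c1 y (rV y yr))).
  exact: (@cvg_comp _ _ _ y_ h2 _ _ _ cy (c2 y (rV y yr))).
Qed.

Section datum.
Context (R : realType) (n : nat) (s p : R) (Om K : set 'rV[R]_n) (eps : nat -> R) (W : R -> R).
Context (g_ f_ u_ : nat -> 'rV[R]_n -> R) (g f : 'rV[R]_n -> R) (E : set 'rV[R]_n).
Local Notation Rn := 'rV[R]_n.
Local Notation mu := (@lebesgue_rV R n).
Local Notation LRn := (caratheodory_type (@lebesgue_borel R n)^*%mu).
Hypothesis n0 : (0 < n)%N.
Hypothesis s2 : 0 < s < 2^-1.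
Hypothesis dOm : smooth_bounded_domain Om.
Hypothesis eps0 : forall k, 0 < eps k.
Hypothesis p2 : 2 <= p.
Hypothesis admW : admissible_potential p W.
Hypothesis data : admissible_data s p Om W eps g_ f_ u_ g f E.
Hypothesis EOm : E `&` Om <> Om /\ E `&` Om <> set0.
Hypothesis suppf : forall k, Ckc 1 Om (f_ k) /\ supp (f_ k) `<=` K.

Let s01 : 0 < s < 1. Proof. by case/andP: s2 => s0 s2'; rewrite s0/=; lra. Qed.
Let oOm : open Om. Proof. by case: dOm => -[]. Qed.
Let mOm : Lmeasurable Om. Proof. exact: open_Lmeasurable. Qed.

(** The right-hand side of the equation written for [(-Delta)^s u_k] alone. *)
Definition reaction k (x : Rn) : R := f_ k x - (eps k `^ (2 * s))^-1 * derive1 W (u_ k x).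

Lemma derive1_continuous : continuous (derive1 W).
Proof.
by case: admW => -[_ D2 _] _ _ _ _ t; apply: differentiable_continuous; apply/derivable1_diffP.
Qed.

Lemma datum_continuous k x : Om x -> {for x, continuous (u_ k)}.
Proof. exact: A4_continuous (data_A4 data) k x. Qed.

Lemma datum_weak_solution k : weak_solution s p (eps k) W (f_ k) (g_ k) Om (u_ k).
Proof. by have [H _] := data_A3 data. Qed.

Lemma datum_fin_energy k : fin_energy s Om (u_ k).
Proof. by have [H _ _] := datum_weak_solution k; exact: Hsg_fin_energy H. Qed.

Lemma datum_measurable k : Lmeasurable_fun setT (u_ k).
Proof. by have [] := datum_fin_energy k. Qed.

Lemma source_continuous k : continuous (f_ k).
Proof. by have [[[cf _ _] _ _] _] := suppf k. Qed.

Lemma source_eq0 k x : ~ K x -> f_ k x = 0.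
Proof.
have [_ fK] := suppf k; move=> Kx; apply: contrapT => /eqP fx; apply: Kx; apply: fK.
exact: subset_closure.
Qed.

Lemma reaction_measurable k : Lmeasurable_fun setT (reaction k).
Proof.
have m1 : Lmeasurable_fun setT (f_ k) by apply: continuous_Lmeasurable; exact: source_continuous.
have m2 : measurable_fun setT (derive1 W) by apply: continuous_measurable_fun; exact: derive1_continuous.
have m3 : Lmeasurable_fun setT (fun x => derive1 W (u_ k x)).
  by apply: (measurableT_comp m2); exact: datum_measurable.
apply: (@measurable_funB _ LRn R setT _ _ m1).
exact: (@measurable_funM _ LRn R setT _ _ (@measurable_cst _ _ LRn _ setT _) m3).
Qed.

Lemma reaction_continuous k x : Om x -> {for x, continuous (reaction k)}.
Proof.
move=> Ox; have cu : u_ k @ x --> u_ k x by exact: datum_continuous.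
have cf : f_ k @ x --> f_ k x by exact: source_continuous.
have cW : (fun y => derive1 W (u_ k y)) @ x --> derive1 W (u_ k x).
  have dW : derive1 W @ u_ k x --> derive1 W (u_ k x) by exact: derive1_continuous.
  exact: (@cvg_comp _ _ _ (u_ k) (derive1 W) _ _ _ cu dW).
have ce : (fun _ : Rn => (eps k `^ (2 * s))^-1) @ x --> (eps k `^ (2 * s))^-1 by exact: (@cst_continuous Rn R ((eps k `^ (2 * s))^-1) x).
exact: cvgB cf (cvgM ce cW).
Qed.

Lemma datum_equation k : bumps_in Om (fun phi => frac_lap s Om (u_ k) phi = pairing Om (reaction k) phi).
Proof.
move=> kap a c kap0 ac acO.
case: admW => -[D1 D2 c2] [W0 _] _ _ _.
have [[_ csf sfO] _] := suppf k.
have [_ [M HM]] := data_A3 data.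
apply: (@weak_solution_frac_lap R n s p (eps k) W Om (f_ k) (g_ k) (u_ k)) => //.
- by apply: lt_le_trans p2; rewrite ltr0n.
- exact: source_continuous.
- exact: datum_continuous.
- exact: datum_weak_solution.
- exact: le_lt_trans (HM k) (ltry _).
Qed.

(** Otherwise [E] would be relatively clopen in the connected set [Om]. *)
Lemma boundary_nonempty : exists x, (boundary E `&` Om) x.
Proof.
apply: contrapT => H; have [[EO1 EO2] [oE _]] := (EOm, A4a (data_A4 data)).
have [_ cOm _ _] := dOm; apply: EO1; apply: cOm.
- by apply/set0P; apply/eqP.
- by exists (E `&` Om) => //; apply/seteqP; split=> x [] // Ex Ox; case: Ox.
- exists (closure E); first exact: closed_closure.
  apply/seteqP; split=> x [xE xO].
    by split=> //; exact: subset_closure.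
  split=> //; apply: contrapT => nE; apply: H; exists x; split=> //; split=> //.
  by move=> /interior_subset.
Qed.

(** Level sets converge to a nonempty interface. *)
Lemma level_attained (d : R) : -1 < d < 1 -> \forall k \near \oo, exists2 x, Om x & u_ k x = d.
Proof.
move=> d1; have [x [bx Ox]] := boundary_nonempty.
have cx : compact [set x] by exact: compact_set1.
have xO : [set x] `<=` Om by move=> _ ->.
have := A4e (data_A4 data) d1 cx xO ltr01; apply: filterS => k [_ /(_ x)].
by move=> /(_ (conj bx erefl)) [y [uy Oy] _]; exists y.
Qed.

(** If [u_ k] were constant on a ball where [f_ k] vanishes, its fractional
    Laplacian would be constant there, and unique continuation would make [u_ k]
    constant on [Om], although it attains several levels. *)
Lemma datum_nonconstant : \forall k \near \oo, forall (x0 : Rn) (r c : R), 0 < r ->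
  ball x0 (2 * r) `<=` Om -> (forall y, ball x0 (2 * r) y -> ~ K y) ->
  ~ (forall y, ball x0 (2 * r) y -> u_ k y = c).
Proof.
have d0 : -1 < (0 : R) < 1 by rewrite ltrN10 ltr01.
have d2 : -1 < (2^-1 : R) < 1 by lra.
have L1 := level_attained d0; have L2 := level_attained d2.
near=> k => x0 r c r0 rO rK uc.
have rr : ball x0 r `<=` ball x0 (2 * r) by apply: le_ball; rewrite ler_peMl ?ltW// ltr1n.
have ae : {ae mu, forall y, u_ k y = c}.
  apply: (@unique_continuation_cst R n s s01 n0 Om (u_ k) c (- ((eps k `^ (2 * s))^-1 * derive1 W c)) x0 r oOm r0 rO (datum_fin_energy k) uc).
  move=> kap a b kap0 ab abr.
  have abO : cbox a b `<=` Om by apply: subset_trans rO; exact: subset_trans rr.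
  rewrite (datum_equation k kap0 ab abO) (pairing_int _ kap0 abO).
  rewrite -(@RintegralZl _ LRn R mu setT _ _ measurableT (bump_integrable kap0 ab)).
  apply: eq_Rintegral => x _; have [xb|xb] := pselect (cbox a b x); last first.
    by rewrite bump_eq0_cbox// !mulr0.
  have xr := rr _ (abr _ xb).
  by rewrite /reaction source_eq0 ?sub0r ?uc//; exact: rK.
have cc (x : Rn) : Om x -> {for x, continuous (fun=> c : R)} by move=> _; exact: cst_continuous.
have uO := @ae_eq_continuous R n Om (u_ k) (fun=> c) oOm (fun x => @datum_continuous k x) cc ae.
have [x Ox ux] : exists2 x, Om x & u_ k x = 0 by near: k.
have [y Oy uy] : exists2 x, Om x & u_ k x = 2^-1 by near: k.
have : (0 : R) = 2^-1 by rewrite -ux -uy !uO.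
by move/eqP; rewrite eq_sym invr_eq0 pnatr_eq0.
Unshelve. all: by end_near.
Qed.

Lemma limit_source_L1loc : L1loc Om f.
Proof.
have [_ [q [_ _ [_ [_ H] _]]]] := data_A2 data.
by have [h [Lf _ _] _] := H (Ordinal n0).
Qed.

End datum.

(** * Uniqueness of potentials and incompatibility of phases *)

Section potentials.
Context {R : realType}.
Implicit Types (W : R -> R) (p : R).

Lemma analytic_potential_unique W1 W2 p1 p2 (a b : R) :
  admissible_potential p1 W1 -> admissible_potential p2 W2 ->
  real_analytic W1 -> real_analytic W2 -> a < b ->
  (forall t, a <= t <= b -> derive1 W1 t = derive1 W2 t) -> W1 = W2.
Proof.
move=> [[D1 _ _] _ Z1 _ _] [[D2 _ _] _ Z2 _ _] A1 A2 ab dW.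
pose m := (a + b) / 2; pose r := (b - a) / 2.
have r0 : 0 < r by rewrite divr_gt0// subr_gt0.
pose c := W1 m - W2 m.
have dD z : is_derive z (1 : R) (fun t => W1 t - W2 t) (derive1 W1 z - derive1 W2 z).
  by apply: is_deriveB; rewrite derive1E; exact: DeriveDef.
have loc x : `|x - m| < r -> W1 x - W2 x - c = 0.
  move=> xm; apply/eqP; rewrite -normr_le0 -(mul0r `|x - m|).
  apply: (mean_value_le dD) => z zx; rewrite dW ?subrr ?normr0//.
  have : `|z - m| <= r by exact: le_trans zx (ltW xm).
  by rewrite ler_norml /m /r; lra.
have H := real_analytic_identity (real_analyticB c A1 A2) r0 loc.
have c0 : c = 0.
  have := H 1; rewrite (Z1 1).2; last by left.
  by rewrite (Z2 1).2; [rewrite subrr sub0r => /eqP; rewrite oppr_eq0 => /eqP|left].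
by apply/funext => x; have := H x; rewrite c0 subr0 => /eqP; rewrite subr_eq0 => /eqP.
Qed.

Lemma injective_near (h dh : R -> R) (c : R) : (forall z, is_derive z (1 : R) h (dh z)) ->
  continuous dh -> 0 < dh c ->
  exists2 e : R, 0 < e & forall a b, `|a - c| < e -> `|b - c| < e -> h a = h b -> a = b.
Proof.
move=> Dh cdh pc.
have ch : continuous h.
  by move=> t; apply: differentiable_continuous; apply/derivable1_diffP; case: (Dh t).
have cc : dh @ c --> dh c by exact: cdh.
move/cvgrPdist_lt : cc => /(_ _ pc)/nbhs_ballP[e /= e0 eH].
have pos z : `|z - c| < e -> 0 < dh z.
  rewrite distrC => zc; have H : `|dh c - dh z| < dh c by exact: eH zc.
  by move: H; rewrite ltr_norml => /andP[_]; rewrite ltrBlDr ltrDl.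
have lt a b : `|a - c| < e -> `|b - c| < e -> a < b -> h a < h b.
  move=> ac bc ab; have [z zab E] := MVT ab (fun z _ => Dh z) (continuous_subspaceT ch).
  rewrite -subr_gt0 E; apply: mulr_gt0; last by rewrite subr_gt0.
  by apply: pos; move: zab ac bc; rewrite in_itv/= !ltr_norml; lra.
exists e => // a b ac bc Eab; case: (ltgtP a b) => // ab.
- by have := lt a b ac bc ab; rewrite Eab ltxx.
- by have := lt b a bc ac ab; rewrite Eab ltxx.
Qed.

Lemma ball_ivt (n : nat) (u : 'rV[R]_n -> R) (x0 y1 y2 : 'rV[R]_n) (r t : R) :
  (forall y, ball x0 r y -> {for y, continuous u}) -> ball x0 r y1 -> ball x0 r y2 ->
  u y1 <= t <= u y2 -> exists2 z, ball x0 r z & u z = t.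
Proof.
move=> cu b1 b2 ut.
pose l (tau : R) : 'rV[R]_n := y1 + tau *: (y2 - y1).
have lb tau : 0 <= tau <= 1 -> ball x0 r (l tau).
  move=> /andP[t0 t1]; move: b1 b2; rewrite -!ball_normE /= => b1 b2.
  have -> : x0 - l tau = (1 - tau) *: (x0 - y1) + tau *: (x0 - y2).
    by apply/rowP => i; rewrite /l !mxE; ring.
  have t1' : 0 <= 1 - tau by rewrite subr_ge0.
  apply: le_lt_trans (ler_normD _ _) _; rewrite !normrZ (ger0_norm t0) (ger0_norm t1').
  have H1 := ler_wpM2l t1' (ltW b1); have H2 := ler_wpM2l t0 (ltW b2).
  have [->|tne] := eqVneq tau 0; first by rewrite subr0 mul1r mul0r addr0.
  have tp : 0 < tau by rewrite lt_neqAle eq_sym tne.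
  have H3 : tau * `|x0 - y2| < tau * r by rewrite ltr_pM2l.
  lra.
have cl : continuous l.
  move=> tau; apply: cvgD; first exact: cvg_cst.
  by apply: cvgZ; [exact: cvg_id|exact: cvg_cst].
have cul : {within `[0, 1], continuous (u \o l)}.
  apply: continuous_in_subspaceT => tau; rewrite inE /= in_itv /= => /lb lt.
  apply: continuous_comp; [exact: cl|exact: cu].
have [|tau] := IVT ler01 cul (v := t).
  have -> : (u \o l) 0 = u y1 by rewrite /l /= scale0r addr0.
  have -> : (u \o l) 1 = u y2 by rewrite /l /= scale1r addrCA subrr addr0.
  by move: ut => /andP[u1 u2]; rewrite ge_min u1 le_max u2 orbT.
by rewrite in_itv /= => /lb lt ul; exists (l tau).
Qed.

End potentials.

Section phase_potentials.
Context (R : realType) (n : nat) (s : R).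
Hypothesis s01 : 0 < s < 1.
Hypothesis n0 : (0 < n)%N.
Local Notation Rn := 'rV[R]_n.
Local Notation mu := (@lebesgue_rV R n).
Local Notation LRn := (caratheodory_type (@lebesgue_borel R n)^*%mu).
Implicit Types (E : set Rn).

(** The factor of the phase in the limit of the right-hand sides, without the
    normalizing constant. *)
Definition phase_potential E (x : Rn) : R :=
  fine (\int[mu]_y (`|phase E x - phase E y| ^+ 2 * kernel s x y)%:E)%E.

Let jump E (sg : R) (y : Rn) : R := `|sg - phase E y| ^+ 2.

Let phase_in E x : E x -> phase E x = 1 :> R.
Proof. by move=> Ex; rewrite /phase !indicE mem_set// memNset ?subr0// => /(_ Ex). Qed.

Let phase_out E x : ~ E x -> phase E x = -1 :> R.
Proof. by move=> Ex; rewrite /phase !indicE memNset// mem_set ?sub0r. Qed.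

Let jump_bounded E (sg : R) y : `|sg| <= 1 -> 0 <= jump E sg y <= 4.
Proof.
move=> sg1; rewrite sqr_ge0 /jump /=.
have p1 : `|phase E y : R| <= 1.
  by have [/phase_in ->|/phase_out ->] := pselect (E y); rewrite ?normrN normr1.
have H : `|sg - phase E y| <= 2 by apply: le_trans (ler_normB _ _) _; lra.
have H0 := normr_ge0 (sg - phase E y); move: H H0; move: `|sg - phase E y| => z z2 z0.
by rewrite expr2; nra.
Qed.

Let measurable_jump E (sg : R) : Lmeasurable E -> Lmeasurable_fun setT (jump E sg).
Proof.
move=> mE.
have m1 : @measurable_fun _ _ LRn R setT \1_E by exact: (@measurable_indic _ LRn R setT _ mE).
have m2 : @measurable_fun _ _ LRn R setT \1_(~` E).
  by exact: (@measurable_indic _ LRn R setT _ (@measurableC _ LRn _ mE)).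
have m3 : Lmeasurable_fun setT (fun y => sg - phase E y).
  apply: (@measurable_funB _ LRn R setT (fun=> sg) _ (@measurable_cst _ _ LRn _ setT sg)).
  exact: (@measurable_funB _ LRn R setT _ _ m1 m2).
apply: (@measurable_funX _ LRn R setT _ 2).
by apply: (measurableT_comp (@normr_measurable R setT)).
Qed.

(** On a ball lying in the phase [1] of [E1] the limit operator is nonnegative,
    and on a ball lying in the phase [-1] of [E2] it is minus the potential of a
    nonnegative far field. Both can only agree if that far field has zero
    potential, hence vanishes, which an open set inside [E2] forbids. *)
Lemma opposite_phases_absurd E1 E2 (x0 : Rn) (r : R) (U : set Rn) : 0 < r ->
  Lmeasurable E2 -> ball x0 (2 * r) `<=` E1 ->
  (forall y, ball x0 (2 * r) y -> ~ E2 y) -> open U -> U !=set0 -> U `<=` E2 ->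
  bumps_in (ball x0 r) (fun phi =>
    pairing (ball x0 r) (fun x => cns n s / 2 * phase_potential E1 x * phase E1 x) phi =
    pairing (ball x0 r) (fun x => cns n s / 2 * phase_potential E2 x * phase E2 x) phi) -> False.
Proof.
move=> r0 mE rE1 rE2 oU U0 UE2 H.
have rr : ball x0 r `<=` ball x0 (2 * r) by apply: le_ball; rewrite ler_peMl ?ltW// ltr1n.
pose v := jump E2 (-1).
have n2 : `|-1 : R| <= 1 by rewrite normrN normr1.
have v04 y : 0 <= v y <= 4 by exact: jump_bounded.
have v0 y : ball x0 (2 * r) y -> v y = 0.
  by move=> /rE2 Ey; rewrite /v /jump phase_out// subrr normr0 expr0n.
have mv : Lmeasurable_fun setT v by exact: measurable_jump.
have vk0 x y : 0 <= v y * kernel s x y.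
  by apply: mulr_ge0; [case/andP: (v04 y)|exact: kernel_ge0].
have i0 : mu.-integrable (setT : set LRn) (EFin \o (fun y => v y * kernel s x0 y)).
  have mt : Lmeasurable_fun setT (trunc_kernel s x0).
    exact: (@measurable_trunc_kernel R n s _ LRn (fun=> x0) (fun y => y) (@measurable_cst _ _ LRn LRn setT x0) (@measurable_id _ LRn setT)).
  have it : mu.-integrable (setT : set LRn) (EFin \o trunc_kernel s x0).
    apply: (@integrable_ge0 _ LRn R mu _ mt (trunc_kernel_ge0 s x0)).
    exact: le_lt_trans (trunc_kernel_int s01 x0) (ltry _).
  pose C := 4 * (1 + (r ^+ 2)^-1).
  apply: (@integrable_dominated _ LRn R mu _ _ (measurable_potential_integrand s mv x0) (@RintegrableZl _ LRn R mu setT C _ measurableT it)).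
  move=> y; have /andP[_ v_4] := v04 y; rewrite (ger0_norm (vk0 x0 y)).
  have r2 : 0 < r ^+ 2 by rewrite exprn_gt0.
  have ri : 0 <= (r ^+ 2)^-1 by rewrite invr_ge0 ltW.
  have C0 : 0 <= C by rewrite mulr_ge0// addr_ge0.
  have [yb|yb] := pselect (ball x0 (2 * r) y).
    by rewrite v0// mul0r; apply: mulr_ge0 => //; exact: trunc_kernel_ge0.
  rewrite /trunc_kernel mulrA; apply: ler_wpM2r; first exact: kernel_ge0.
  have yr : r <= `|x0 - y|.
    by move: yb; rewrite -ball_normE /= => /negP; rewrite -leNgt; apply: le_trans; rewrite ler_peMl ?ltW// ltr1n.
  have q : r ^+ 2 <= sqn (x0 - y).
    apply: le_trans (norm_le_sqn _); apply: lerXn2r yr; rewrite nnegrE; [exact: ltW|exact: normr_ge0].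
  apply: le_trans v_4 _; rewrite /C -mulrA ler_peMr//.
  case: (leP 1 (sqn (x0 - y))) => q1; first by rewrite mulr1 lerDl.
  apply: le_trans (_ : (r ^+ 2)^-1 * r ^+ 2 <= _); first by rewrite mulVf// gt_eqF.
  by apply: ler_pM => //; [exact: ltW|rewrite lerDr].
pose P x := \int[mu]_y (v y * kernel s x y).
have ik x : ball x0 r x -> mu.-integrable (setT : set LRn) (EFin \o (fun y => v y * kernel s x y)).
  by move=> xr; exact: (@potential_integrable R n s s01 v x0 r r0 mv v0 x x0 xr (ballxx x0 r0) i0).
have P0 x : 0 <= P x by rewrite /P; apply: Rintegral_ge0 => y _; exact: vk0.
have mP : Lmeasurable_fun setT P.
  have mF : measurable_fun [set: LRn * LRn] (fun q => (v q.2 * kernel s (q.1 : Rn) (q.2 : Rn))%:E).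
    apply/measurable_EFinP; apply: measurable_funM (@measurable_kernel_pair R n s).
    exact: (measurableT_comp mv).
  have F0 (q : LRn * LRn) : (0 <= (v q.2 * kernel s (q.1 : Rn) (q.2 : Rn))%:E)%E by rewrite lee_fin.
  have mFF := @measurable_fun_fubini_tonelli_F _ _ LRn LRn R mu _ mF F0.
  exact: (measurableT_comp (@fine_measurable R setT measurableT) mFF).
have PB x : ball x0 r x -> P x <= (n%:R * 3) `^ (n%:R + 2 * s) * P x0.
  move=> xr; have iC := @RintegrableZl _ LRn R mu setT ((n%:R * 3) `^ (n%:R + 2 * s)) _ measurableT i0.
  rewrite /P -(@RintegralZl _ LRn R mu setT _ _ measurableT i0).
  apply: (@le_Rintegral _ LRn R mu setT _ _ measurableT (ik x xr) iC) => y _.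
  have := @potential_dominated R n s s01 v x0 r r0 v0 x x0 y xr (ballxx x0 r0).
  by rewrite (ger0_norm (vk0 x y)) (ger0_norm (vk0 x0 y)).
have c0 : 0 < cns n s / 2 by rewrite divr_gt0// cns_gt0.
have r2 : 0 < r / 2 by rewrite divr_gt0.
have r2r : 0 <= r / 2 < r by lra.
set a := cube_lo x0 (r / 2); set c := cube_hi x0 (r / 2).
have ac : forall i, a ord0 i <= c ord0 i by apply: cube_le; exact: ltW.
have acr : cbox a c `<=` ball x0 r by exact: cube_sub_ball.
pose phi := bump 1 a c.
have phi_in x : phi x != 0 -> ball x0 r x.
  move=> px; apply: acr; apply: contrapT => xb.
  by move/eqP: px; apply; exact: (bump_eq0_cbox ltr01 xb).
have iP : mu.-integrable (setT : set LRn) (EFin \o (fun x => P x * phi x)).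
  apply: (@bounded_integrable R n _ (cbox a c) ((n%:R * 3) `^ (n%:R + 2 * s) * P x0) _ (@compact_cbox R n a c)).
  - exact: (@measurable_funM _ LRn R setT P _ mP (@measurable_bump R n 1 a c)).
  - by move=> x xb; rewrite /phi bump_eq0_cbox// mulr0.
  - move=> x xb; rewrite (normrM (P x)) (ger0_norm (P0 x)) (ger0_norm (bump_ge0 _ _ _ _)).
    by apply: le_trans (PB x (acr _ xb)); rewrite ler_piMr// bump_le1.
have Pphi0 x : 0 <= P x * phi x by rewrite mulr_ge0// bump_ge0.
have int0 : \int[mu]_x (P x * phi x) = 0.
  apply/eqP; rewrite eq_le; apply/andP; split; last first.
    by apply: Rintegral_ge0 => x _; exact: Pphi0.
  rewrite -(pmulr_rle0 _ c0) -(@RintegralZl _ LRn R mu setT _ _ measurableT iP) -oppr_ge0.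
  have := H 1 a c ltr01 ac acr.
  rewrite (pairing_int _ ltr01 acr) (pairing_int _ ltr01 acr) => H1.
  have -> : - (\int[mu]_x (cns n s / 2 * (P x * phi x))) =
      \int[mu]_x (cns n s / 2 * phase_potential E2 x * phase E2 x * bump 1 a c x).
    rewrite -mulN1r -RintegralZl//; last exact: (@RintegrableZl _ LRn R mu setT _ _ measurableT iP).
    apply: eq_Rintegral => x _; have [px|px] := eqVneq (phi x) 0; first by rewrite -/(phi x) px !mulr0.
    have p1 := phase_out (rE2 _ (rr _ (phi_in x px))).
    have EP : phase_potential E2 x = P x by rewrite /phase_potential p1.
    by rewrite EP p1 -/(phi x); ring.
  rewrite -H1; apply: Rintegral_ge0 => x _.
  have [px|px] := eqVneq (phi x) 0; first by rewrite -/(phi x) px mulr0.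
  have p1 := phase_in (rE1 _ (rr _ (phi_in x px))).
  rewrite p1 mulr1; apply: mulr_ge0; last exact: bump_ge0.
  apply: mulr_ge0; [exact: ltW|apply: fine_ge0; apply: integral_ge0 => y _].
  by rewrite lee_fin; apply: mulr_ge0; [exact: exprn_ge0|exact: kernel_ge0].
have ae1 := @Rintegral_eq0_ae _ LRn R mu _ iP Pphi0 int0.
have [x xb /eqP Px] := open_ae_exists (@ball_open R Rn x0 (r / 2)) (ex_intro _ x0 (ballxx x0 r2)) ae1.
have xr : ball x0 r x by apply: le_ball xb; case/andP: r2r => _ /ltW.
have px : 0 < phi x by rewrite /phi bump_gt0// -/a /a /c /cube_lo /cube_hi -ball_box.
move: Px; rewrite mulf_eq0 (gt_eqF px) orbF => /eqP Px.
have ae2 := @Rintegral_eq0_ae _ LRn R mu _ (ik x xr) (vk0 x) Px.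
have [y Uy /eqP vy] := open_ae_exists oU U0 ae2.
have xy : x != y.
  by apply/eqP => xy; apply: (rE2 y _ (UE2 y Uy)); rewrite -xy; exact: rr.
have kp : 0 < kernel s x y.
  apply: lt_le_trans (kernel_ge (proj1 (andP s01)) xy (lexx _)).
  by rewrite invr_gt0 powR_gt0// mulr_gt0 ?ltr0n// normr_gt0 subr_eq0.
move: vy; rewrite mulf_eq0 (gt_eqF kp) orbF /v /jump phase_in; last exact: UE2.
by rewrite -opprD normrN expf_eq0 /= normr_eq0 -(natrD _ 1 1) pnatr_eq0.
Qed.

End phase_potentials.

(** * Two sequences of solutions *)

Section two_data.
Context (R : realType) (n : nat) (s p : R) (Om K V : set 'rV[R]_n) (eps : nat -> R).
Context (W : bool -> R -> R) (g_ f_ u_ : bool -> nat -> 'rV[R]_n -> R).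
Context (g f : bool -> 'rV[R]_n -> R) (E : bool -> set 'rV[R]_n).
Local Notation Rn := 'rV[R]_n.
Local Notation mu := (@lebesgue_rV R n).
Local Notation LRn := (caratheodory_type (@lebesgue_borel R n)^*%mu).
Hypothesis n0 : (0 < n)%N.
Hypothesis s2 : 0 < s < 2^-1.
Hypothesis dOm : smooth_bounded_domain Om.
Hypothesis eps0 : forall k, 0 < eps k.
Hypothesis p2 : 2 <= p.
Hypothesis admW : forall j, admissible_potential p (W j).
Hypothesis data : forall j, admissible_data s p Om (W j) eps (g_ j) (f_ j) (u_ j) (g j) (f j) (E j).
Hypothesis EOm : forall j, E j `&` Om <> Om /\ E j `&` Om <> set0.
Hypothesis suppf : forall j k, Ckc 1 Om (f_ j k) /\ supp (f_ j k) `<=` K.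
Hypothesis cvg_f : forall j,
  cvg_Hminus s Om (fun k => pairing Om (f_ j k)) (pairing Om (f j)).
Hypothesis V0 : V !=set0.
Hypothesis oV : open V.
Hypothesis VOm : V `<=` Om.
Hypothesis VK : V `&` K = set0.
Hypothesis frac_eq : forall k, frac_lap_eq_on s Om V (u_ true k) (u_ false k).

Let s01 : 0 < s < 1. Proof. by case/andP: s2 => s0 s2'; rewrite s0/=; lra. Qed.
Let oOm : open Om. Proof. by case: dOm => -[]. Qed.
Let mOm : Lmeasurable Om. Proof. exact: open_Lmeasurable. Qed.
Let rea j k := reaction s eps (W j) (f_ j) (u_ j) k.

Let cu j k x : Om x -> {for x, continuous (u_ j k)}.
Proof. exact: datum_continuous (data j) k x. Qed.

Let fu j k : fin_energy s Om (u_ j k).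
Proof. exact: datum_fin_energy n0 s2 dOm (data j) k. Qed.

Let mrea j k : Lmeasurable_fun setT (rea j k).
Proof. exact: reaction_measurable n0 s2 dOm (admW j) (data j) (suppf j) k. Qed.

Let crea j k x : Om x -> {for x, continuous (rea j k)}.
Proof. exact: reaction_continuous (admW j) (data j) (suppf j) k x. Qed.

Let eqn j k : bumps_in Om (fun phi => frac_lap s Om (u_ j k) phi = pairing Om (rea j k) phi).
Proof. exact: datum_equation n0 s2 dOm eps0 p2 (admW j) (data j) (suppf j) k. Qed.

Let notK x : V x -> ~ K x.
Proof. by move=> Vx Kx; have : (V `&` K) x by []; rewrite VK. Qed.

Lemma reactions_agree k x : V x -> rea true k x = rea false k x.
Proof.
apply: (@bump_pairing_inj R n Om V (rea true k) (rea false k) oV VOm (mrea true k) (mrea false k)).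
- by move=> y /VOm; exact: crea.
- by move=> y /VOm; exact: crea.
- move=> kap a c kap0 ac acV; have acO := subset_trans acV VOm.
  rewrite -(eqn true k kap0 ac acO) -(eqn false k kap0 ac acO).
  by apply: frac_eq; exact: test_bump.
Qed.

Lemma derive_potentials_agree k x : V x ->
  derive1 (W true) (u_ true k x) = derive1 (W false) (u_ false k x).
Proof.
move=> Vx; have := reactions_agree k Vx; rewrite /rea /reaction.
rewrite (source_eq0 (suppf true) k (notK Vx)) (source_eq0 (suppf false) k (notK Vx)) !sub0r.
by move=> /oppr_inj /mulfI; apply; rewrite gt_eqF// invr_gt0 powR_gt0.
Qed.

Lemma solutions_agree k (x0 : Rn) (r : R) : 0 < r -> ball x0 (2 * r) `<=` V ->
  (forall y, ball x0 (2 * r) y -> u_ true k y = u_ false k y) ->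
  {ae mu, forall y, u_ true k y = u_ false k y}.
Proof.
move=> r0 rV uu.
apply: (@unique_continuation_two R n s s01 n0 Om _ _ x0 r oOm r0 (subset_trans rV VOm) (fu true k) (fu false k) uu).
move=> kap a c kap0 ac acr; apply: frac_eq; apply: test_bump => //.
apply: subset_trans rV; apply: subset_trans acr _.
by apply: le_ball; rewrite ler_peMl ?ltW// ltr1n.
Qed.

Let ae_agree := \forall k \near \oo, {ae mu, forall y, u_ true k y = u_ false k y}.

(** Where the solutions and the potentials agree, the difference of the sources is
    the difference of the right-hand sides, which have equal pairings. *)
Lemma limit_sources_agree : W true = W false -> ae_agree ->
  {ae mu, forall x, Om x -> f true x = f false x}.
Proof.
move=> WW uu; apply: (pairing_eq_ae oOm (limit_source_L1loc n0 (data true)) (limit_source_L1loc n0 (data false))).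
move=> kap a c kap0 ac acO.
have tphi := test_bump kap0 acO; have Hphi := Hs_bump s01 kap0 ac.
have c1 := cvg_Hminus_test (cvg_f true) tphi Hphi.
have c2 := cvg_Hminus_test (cvg_f false) tphi Hphi.
apply: (cvg_unique (@Rhausdorff R) c1); apply: cvg_trans c2; apply: near_eq_cvg.
apply: filterS uu => k uuk.
have uO := @ae_eq_continuous R n Om _ _ oOm (fun x => @cu true k x) (fun x => @cu false k x) uuk.
have fphi := fin_energy_bump s01 mOm kap0 ac.
have ef := frac_lap_ae mOm (fu true k) (fu false k) fphi uuk.
move: ef; rewrite (eqn true k kap0 ac acO) (eqn false k kap0 ac acO).
rewrite !(pairing_int _ kap0 acO) => ef.
have mf j : Lmeasurable_fun setT (f_ j k) by apply: continuous_Lmeasurable; exact: (source_continuous (suppf j)).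
have if_ j := @bump_mul_integrable R n (f_ j k) kap a c kap0 (mf j) (fun x _ => @source_continuous R n Om K (f_ j) (suppf j) k x).
have ir j := bump_mul_integrable kap0 (mrea j k) (fun x Hx => @crea j k x (acO x Hx)).
apply/eqP; rewrite -subr_eq0 -(@RintegralB _ LRn R mu setT _ _ measurableT (if_ false) (if_ true)).
apply/eqP; transitivity (\int[mu]_x (rea false k x * bump kap a c x - rea true k x * bump kap a c x)).
  apply: eq_Rintegral => x _; have [xb|xb] := pselect (cbox a c x); last first.
    by rewrite (bump_eq0_cbox kap0 xb) !mulr0.
  rewrite /rea /reaction (uO x (acO x xb)) WW.
  by move: (bump kap a c x) (derive1 _ _) (_^-1) (f_ true k x) (f_ false k x) => b w e' ft ff; ring.
by rewrite (@RintegralB _ LRn R mu setT _ _ measurableT (ir false) (ir true)) ef subrr.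
Qed.

(** A point of one interface is a limit of zeros of [u_ j k], which are zeros of
    [u_ j' k] and hence close to the other interface. *)
Let sub_boundary j j' : (\forall k \near \oo, forall x, Om x -> u_ j k x = u_ j' k x) ->
  boundary (E j) `&` Om `<=` boundary (E j') `&` Om.
Proof.
move=> uu x [bx Ox]; split=> //; apply: contrapT => nbx.
have cb : closed (boundary (E j')).
  by rewrite /boundary setDE; apply: closedI; [exact: closed_closure|apply: open_closedC; exact: open_interior].
have oU : open (Om `&` ~` boundary (E j')) by apply: openI => //; exact: closed_openC.
have [d /= d0 dU] : exists2 d : R, 0 < d & ball x d `<=` Om `&` ~` boundary (E j').
  by have /nbhs_ballP[d d0 H] := oU x (conj Ox nbx); exists d.
have d4 : 0 < d / 4 by rewrite divr_gt0.
have d01 : -1 < (0 : R) < 1 by rewrite ltrN10 ltr01.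
have d2d : 0 <= d / 2 < d by lra.
set a := cube_lo x (d / 2); set c := cube_hi x (d / 2).
have cubeO : cbox a c `<=` Om.
  by apply: subset_trans (@cube_sub_ball R n _ _ _ d2d) _ => y /dU[].
have xO : [set x] `<=` Om by move=> _ ->.
have H1 := A4e (data_A4 (data j)) d01 (@compact_set1 _ x) xO d4.
have H2 := A4e (data_A4 (data j')) d01 (@compact_cbox R n a c) cubeO d4.
have [k [[[_ T1] [T2 _]] uk]] := filter_ex (filterI (filterI H1 H2) uu).
have [z [uz Oz] xz] := T1 x (conj bx erefl).
have xz' : `|x - z| < d / 4 by exact: le_lt_trans (norm_le_enorm _) xz.
have zc : cbox a c z.
  move=> i; have := coord_le_norm (x - z) i; rewrite !mxE ler_norml => /andP[].
  by move: xz'; lra.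
have uz' : u_ j' k z = 0 by rewrite -(uk z Oz).
have [b [bb _] zb] := T2 z (conj uz' zc).
have zb' : `|z - b| < d / 4 by exact: le_lt_trans (norm_le_enorm _) zb.
have /dU[_] : ball x d b.
  by rewrite -ball_normE /=; have := ler_distD z x b; lra.
exact.
Qed.

Lemma limits_agree : W true = W false -> ae_agree ->
  [/\ {ae mu, forall x, Om x -> f true x = f false x},
      boundary (E true) `&` Om = boundary (E false) `&` Om &
      forall Om', compactly_contained Om' Om ->
        perimeter s (E true) Om' = perimeter s (E false) Om'].
Proof.
move=> WW uu.
have uO : \forall k \near \oo, forall x, Om x -> u_ true k x = u_ false k x.
  apply: filterS uu => k uuk.
  exact: (@ae_eq_continuous R n Om _ _ oOm (fun x => @cu true k x) (fun x => @cu false k x) uuk).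
split; first exact: limit_sources_agree.
- apply/seteqP; split; first exact: sub_boundary.
  by apply: sub_boundary; apply: filterS uO => k H x Ox; rewrite H.
- move=> Om' cO; have [oO' _ _] := cO.
  have c1 := A4c (data_A4 (data true)) cO; have c2 := A4c (data_A4 (data false)) cO.
  have c0 : 0 < 2 * cns n s by rewrite mulr_gt0// cns_gt0.
  have eqc : ((2 * cns n s)%:E * perimeter s (E true) Om' = (2 * cns n s)%:E * perimeter s (E false) Om')%E.
    apply: (cvg_unique (@ereal_hausdorff R) c1); apply: cvg_trans c2; apply: near_eq_cvg.
    apply: filterS uu => k uuk.
    by apply/esym/energy_ae => //; [exact: open_Lmeasurable|case: (fu true k)|case: (fu false k)].
  have inv (P : \bar R) : P = (((2 * cns n s)^-1)%:E * ((2 * cns n s)%:E * P))%E.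
    by rewrite muleA -EFinM (mulVf (lt0r_neq0 c0)) mul1e.
  by rewrite (inv (perimeter s (E true) Om')) eqc -inv.
Qed.

Let one_sided j (U : set Rn) : open U -> U !=set0 -> U `<=` Om ->
  exists2 U', [/\ open U', U' !=set0 & U' `<=` U] & U' `<=` E j \/ (forall y, U' y -> ~ E j y).
Proof.
move=> oU U0 UO; have [oE _] := A4a (data_A4 (data j)).
have [[y [Uy Ey]]|H] := pselect (exists y, U y /\ E j y).
  exists (U `&` (E j `&` Om)); last by left=> z [_ []].
  by split; [exact: openI|exists y; split=> //; split=> //; exact: UO|move=> z []].
by exists U; [split|right=> y Uy Ey; apply: H; exists y].
Qed.

Let one_sided_ball : exists x0 r, [/\ 0 < r, ball x0 (2 * r) `<=` V &
  forall j, ball x0 (2 * r) `<=` E j \/ (forall y, ball x0 (2 * r) y -> ~ E j y)].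
Proof.
have [U1 [q1 ne1 U1V] S1] := one_sided true oV V0 VOm.
have [U2 [q2 [x0 U2x] U21] S2] := one_sided false q1 ne1 (subset_trans U1V VOm).
have [d /= d0 dU] : exists2 d : R, 0 < d & ball x0 d `<=` U2.
  by have /nbhs_ballP[d d0 H] := q2 x0 U2x; exists d.
exists x0, (d / 2); have -> : 2 * (d / 2) = d by rewrite mulrC divfK.
split; [by rewrite divr_gt0|exact: subset_trans dU (subset_trans U21 U1V)|].
move=> [|].
- case: S1 => H; [left; exact: subset_trans dU (subset_trans U21 H)|right=> y /dU /U21; exact: H].
- case: S2 => H; [left; exact: subset_trans dU H|right=> y /dU; exact: H].
Qed.

Let phase_convergence j (x0 : Rn) (r : R) : 0 < r -> ball x0 (2 * r) `<=` Om ->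
  ball x0 (2 * r) `<=` E j \/ (forall y, ball x0 (2 * r) y -> ~ E j y) ->
  forall e : R, 0 < e -> \forall k \near \oo, forall x, ball x0 r x -> `|u_ j k x - phase (E j) x| < e.
Proof.
move=> r0 rO side e e0.
have r2 : 0 <= r < 2 * r by lra.
have sub : cbox (cube_lo x0 r) (cube_hi x0 r) `<=` Om `\` boundary (E j).
  move=> y /(@cube_sub_ball R n _ _ _ r2) yr; split; first exact: rO.
  have nb : nbhs y (ball x0 (2 * r)) by apply: open_nbhs_nbhs; split=> //; exact: ball_open.
  move=> [cy iy]; case: side => H.
    by apply: iy; apply: filterS nb.
  by have [z [Ez zr]] := cy _ nb; exact: (H z).
have := A4b (data_A4 (data j)) (@compact_cbox R n _ _) sub e0.
apply: filterS => k H x xr; apply: H => i.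
by move: xr; rewrite ball_box// => /(_ i) /andP[H1 H2]; rewrite !ltW.
Qed.

(** The right-hand sides agree on the ball for every [k], hence so do their limits. *)
Lemma opposite_sides_absurd (j j' : bool) (x0 : Rn) (r : R) : 0 < r -> ball x0 (2 * r) `<=` V ->
  ball x0 (2 * r) `<=` E j -> (forall y, ball x0 (2 * r) y -> ~ E j' y) -> False.
Proof.
move=> r0 rV rE rE'.
have r2 : 0 <= r < 2 * r by lra.
have rr : ball x0 r `<=` ball x0 (2 * r) by apply: le_ball; rewrite ler_peMl ?ltW// ltr1n.
have clr : closure (ball x0 r) `<=` cbox (cube_lo x0 r) (cube_hi x0 r).
  rewrite [X in _ `<=` X](closure_id _).1; last exact: closed_cbox.
  apply: closureS => x; rewrite ball_box// => xb i; have /andP[H1 H2] := xb i; by rewrite !ltW.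
have cc : compactly_contained (ball x0 r) Om.
  split; first exact: ball_open.
  - by apply: subclosed_compact clr; [exact: closed_closure|exact: compact_cbox].
  - exact: subset_trans clr (subset_trans (@cube_sub_ball R n _ _ _ r2) (subset_trans rV VOm)).
have [mE' _] := A4_perimeter (data_A4 (data j')).
have [oE' _] := A4a (data_A4 (data j')).
have E'0 : (E j' `&` Om) !=set0 by apply/set0P/eqP; case: (EOm j').
have E'E : E j' `&` Om `<=` E j' by move=> y [].
apply: (@opposite_phases_absurd R n s s01 n0 (E j) (E j') x0 r _ r0 mE' rE rE' oE' E'0 E'E).
move=> kap a c kap0 ac acr.
have tphi := test_bump kap0 acr; have Hphi := Hs_bump s01 kap0 ac.
have c1 := cvg_Hminus_test (A4d (data_A4 (data j)) cc) tphi Hphi.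
have c2 := cvg_Hminus_test (A4d (data_A4 (data j')) cc) tphi Hphi.
have c3 : pairing (ball x0 r) (rea j k) (bump kap a c) @[k --> \oo] -->
    pairing (ball x0 r) (fun x => cns n s / 2 * phase_potential s (E j') x * phase (E j') x) (bump kap a c).
  rewrite (_ : (fun k => _) = fun k => pairing (ball x0 r) (rea j' k) (bump kap a c)); first exact: c2.
  apply/funext => k; apply: eq_pairing => x xr.
  by have := reactions_agree k (rV _ (rr _ xr)); case: (j) (j') => -[].
exact: (cvg_unique (@Rhausdorff R) c1 c3).
Qed.

(** On a one-sided ball both sequences approach constant phases. If the phases
    agree, [W'] is injective near their common value and the solutions coincide
    there for large [k]; different phases contradict the limit equations. *)
Lemma eventually_agree : W true = W false -> ae_agree.
Proof.
move=> WW; have [x0 [r [r0 rV side]]] := one_sided_ball.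
have rO := subset_trans rV VOm.
have near_phase (sg : R) : 0 < derive1n 2 (W true) sg ->
    (forall j x, ball x0 r x -> phase (E j) x = sg) -> ae_agree.
  move=> pos ph; have [[_ D2 c2] _ _ _ _] := admW true.
  have d2 z : is_derive z (1 : R) (derive1 (W true)) (derive1n 2 (W true) z).
    by rewrite derive1nS derive1E; exact: DeriveDef.
  have [e e0 inj] := injective_near d2 c2 pos.
  have N1 := phase_convergence r0 rO (side true) e0.
  have N2 := phase_convergence r0 rO (side false) e0.
  apply: filterS (filterI N1 N2) => k [H1 H2].
  have r2 : 0 < r / 2 by rewrite divr_gt0.
  have E2 : 2 * (r / 2) = r by rewrite mulrC divfK.
  have rr : ball x0 r `<=` ball x0 (2 * r) by apply: le_ball; rewrite ler_peMl ?ltW// ltr1n.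
  apply: (solutions_agree r2); rewrite E2; first exact: subset_trans rr rV.
  move=> y yr; apply: inj.
  - by rewrite -(ph true y yr); exact: H1.
  - by rewrite -(ph false y yr); exact: H2.
  - by rewrite (derive_potentials_agree k (rV _ (rr _ yr))) WW.
have [_ _ _ [_ _ W1 WN1] _] := admW true.
have rr : ball x0 r `<=` ball x0 (2 * r) by apply: le_ball; rewrite ler_peMl ?ltW// ltr1n.
have pin j : ball x0 (2 * r) `<=` E j -> forall x, ball x0 r x -> phase (E j) x = 1 :> R.
  by move=> H x /rr /H Ex; rewrite /phase !indicE mem_set// memNset ?subr0// => /(_ Ex).
have pout j : (forall y, ball x0 (2 * r) y -> ~ E j y) -> forall x, ball x0 r x -> phase (E j) x = -1 :> R.
  by move=> H x /rr /H Ex; rewrite /phase !indicE memNset// mem_set ?sub0r.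
case: (side true) (side false) => St [] Sf.
- by apply: (near_phase 1 W1); case; [exact: (pin true St)|exact: (pin false Sf)].
- by have := opposite_sides_absurd r0 rV St Sf.
- by have := opposite_sides_absurd r0 rV Sf St.
- by apply: (near_phase (-1) WN1); case; [exact: (pout true St)|exact: (pout false Sf)].
Qed.

(** A nonconstant continuous function on a ball covers an interval, on which the
    derivatives of the potentials agree. *)
Lemma potentials_agree : (forall j, real_analytic (W j)) ->
  (forall k x, V x -> u_ true k x = u_ false k x) -> W true = W false.
Proof.
move=> anaW uu.
have /filter_ex[k nc] := datum_nonconstant n0 s2 dOm eps0 p2 (admW true) (data true) (EOm true) (suppf true).
have [x0 Vx0] := V0.
have [d /= d0 dV] : exists2 d : R, 0 < d & ball x0 d `<=` V.
  by have /nbhs_ballP[d d0 H] := oV Vx0; exists d.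
have d2 : 0 < d / 2 by rewrite divr_gt0.
have E2 : 2 * (d / 2) = d by rewrite mulrC divfK.
have := nc x0 (d / 2) (u_ true k x0) d2; rewrite E2.
move=> /(_ (subset_trans dV VOm) (fun y Hy => notK (dV y Hy))) H.
have [y yd uy] : exists2 y, ball x0 d y & u_ true k y <> u_ true k x0.
  by apply: contrapT => H'; apply: H => y yd; apply: contrapT => uy; apply: H'; exists y.
have cb z : ball x0 d z -> {for z, continuous (u_ true k)} by move=> /dV /VOm; exact: cu.
have x0d := ballxx x0 d0.
have WE t z : ball x0 d z -> u_ true k z = t -> derive1 (W true) t = derive1 (W false) t.
  move=> zd zt; have := derive_potentials_agree k (dV z zd).
  by rewrite -(uu k z (dV z zd)) zt.
case: (ltgtP (u_ true k x0) (u_ true k y)) => lt; last by case: uy.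
- apply: (analytic_potential_unique (admW true) (admW false) (anaW true) (anaW false) lt) => t tt.
  by have [z zd zt] := ball_ivt cb x0d yd tt; exact: WE zd zt.
- apply: (analytic_potential_unique (admW true) (admW false) (anaW true) (anaW false) lt) => t tt.
  by have [z zd zt] := ball_ivt cb yd x0d tt; exact: WE zd zt.
Qed.

End two_data.

(* The index j = 1, 2 is a boolean: true for 1 and false for 2. *)
Theorem theorem1p1 (R : realType) (n : nat) (s p : R) (Omega K V : set 'rV[R]_n)
    (eps : nat -> R) (W : bool -> R -> R)
    (g_ f_ u_ : bool -> nat -> 'rV[R]_n -> R)
    (g f : bool -> 'rV[R]_n -> R) (E : bool -> set 'rV[R]_n) :
  (0 < n)%N ->
  0 < s < 2^-1 ->
  smooth_bounded_domain Omega ->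
  (forall k, 0 < eps k) -> eps @ \oo --> (0 : R) ->
  2 <= p ->
  (forall j, admissible_potential p (W j) /\ real_analytic (W j)) ->
  (forall j, admissible_data s p Omega (W j) eps
     (g_ j) (f_ j) (u_ j) (g j) (f j) (E j)) ->
  (forall j, E j `&` Omega <> Omega /\ E j `&` Omega <> set0) ->
  (forall j k, ~ (forall x, ~ Omega x -> g_ j k x = 1) /\
               ~ (forall x, ~ Omega x -> g_ j k x = -1)) ->
  compact K -> K `<=` Omega ->
  (forall j k, Ckc 1 Omega (f_ j k) /\ supp (f_ j k) `<=` K) ->
  (forall j, cvg_Hminus s Omega
     (fun k => pairing Omega (f_ j k)) (pairing Omega (f j))) ->
  V !=set0 -> open V -> V `<=` Omega -> V `&` K = set0 ->
  ((forall k, {in V, u_ true k =1 u_ false k}) ->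
   (forall k, frac_lap_eq_on s Omega V (u_ true k) (u_ false k)) ->
   [/\ W true = W false,
       {ae @lebesgue_rV R n, forall x, Omega x -> f true x = f false x},
       boundary (E true) `&` Omega = boundary (E false) `&` Omega &
       forall Omega', compactly_contained Omega' Omega ->
         perimeter s (E true) Omega' = perimeter s (E false) Omega']) /\
  (W true = W false ->
   (forall k, frac_lap_eq_on s Omega V (u_ true k) (u_ false k)) ->
   [/\ {ae @lebesgue_rV R n, forall x, Omega x -> f true x = f false x},
       boundary (E true) `&` Omega = boundary (E false) `&` Omega &
       forall Omega', compactly_contained Omega' Omega ->
         perimeter s (E true) Omega' = perimeter s (E false) Omega']).
Proof.
move=> n0 s2 dOm eps0 _ p2 adm data EOm _ _ _ suppf cvg_f V0 oV VOm VK.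
have admW j : admissible_potential p (W j) by case: (adm j).
have anaW j : real_analytic (W j) by case: (adm j).
split=> [uu frac_eq|WW frac_eq]; last first.
  apply: (limits_agree n0 s2 dOm eps0 p2 admW data suppf cvg_f WW).
  exact: (eventually_agree n0 s2 dOm eps0 p2 admW data EOm suppf V0 oV VOm VK frac_eq WW).
have uV k x : V x -> u_ true k x = u_ false k x by move=> Vx; apply: uu; exact: mem_set.
have WW := potentials_agree n0 s2 dOm eps0 p2 admW data EOm suppf V0 oV VOm VK frac_eq anaW uV.
have agree : \forall k \near \oo, {ae @lebesgue_rV R n, forall y, u_ true k y = u_ false k y}.
  have [x0 Vx0] := V0; have /nbhs_ballP[d /= d0 dV] := oV x0 Vx0.
  have d2 : 0 < d / 2 by rewrite divr_gt0.
  have E2 : 2 * (d / 2) = d by rewrite mulrC divfK.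
  apply: nearW => k.
  apply: (@solutions_agree R n s p Omega V eps W g_ f_ u_ g f E n0 s2 dOm data VOm frac_eq k x0 _ d2).
    by rewrite E2.
  by rewrite E2 => y /dV; exact: uV.
by have [] := limits_agree n0 s2 dOm eps0 p2 admW data suppf cvg_f WW agree; split.
Qed.
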